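(* Let $q$ be even, let $Q^+(5,q)$ be a hyperbolic (Klein) quadric in $\mathrm{PG}(5,q)$ with associated symplectic polarity $\zeta$, and let $\Pi$ be a $3$-dimensional subspace of $\mathrm{PG}(5,q)$ with $\Pi\cap Q^+(5,q)=Q^-(3,q)$ an elliptic quadric. Let $W(q)$ be the generalized quadrangle whose points are the points of $\Pi$ and whose lines are the lines of $\Pi$ meeting $Q^-(3,q)$ in exactly one point. For an ovoid $O\neq Q^-(3,q)$ of $W(q)$ define \[ H_O:=\Big(\bigcup_{x\in O\setminus Q^-(3,q)}\mathcal{C}_x\Big)\cup\big(Q^-(3,q)\setminus O\big), \] where for $x\in\Pi\setminus Q^-(3,q)$, $\pi_x$ is the plane of $\Pi$ containing all lines of $W(q)$ through $x$ and $\mathcal{C}_x:=\pi_x^\zeta\cap Q^+(5,q)$. Let $O_1,O_2$ be two ovoids of $W(q)$ distinct from $Q^-(3,q)$. Then the following are equivalent: (1) the hyperovals $H_{O_1}$ and $H_{O_2}$ are isomorphic, i.e. there is a collineation of $\mathrm{PG}(5,q)$ stabilizing $Q^+(5,q)$ and mapping $H_{O_1}$ to $H_{O_2}$; (2) there exists a collineation of $\Pi$ stabilizing $Q^-(3,q)$ and mapping $O_1$ to $O_2$.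
   Context: $Q^+(5,q)$ is the set of singular points of a nondegenerate quadratic form $Q$ of plus type on $V=\mathbb{F}_q^6$; $\zeta$ is the symplectic polarity of $\mathrm{PG}(5,q)$ associated with the bilinear form $B(v,w)=Q(v+w)-Q(v)-Q(w)$. An ovoid of $W(q)$ is a set of points of $\Pi$ meeting every line of $W(q)$ in exactly one point. For $x\in\Pi\setminus Q^-(3,q)$, $\pi_x$ meets $Q^-(3,q)$ in an irreducible conic and $\mathcal{C}_x$ is an irreducible conic of the plane $\pi_x^\zeta$. A hyperoval of $Q^+(5,q)$ is a nonempty set of points of $Q^+(5,q)$ meeting every line contained in $Q^+(5,q)$ in $0$ or $2$ points; $H_O$ is such a hyperoval. *)

(* Defs.v *)
From HB Require Import structures.
From mathcomp Require Import all_boot all_order all_algebra.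
From mathcomp Require Import boolp classical_sets functions.

Set Implicit Arguments.
Unset Strict Implicit.
Unset Printing Implicit Defensive.

Import GRing.Theory.

Local Open Scope ring_scope.
Local Open Scope classical_set_scope.

(* The projective space PG(U) of a vector space U : a projective subspace is   *)
(* a vector subspace of U, whose projective dimension is its vector dimension  *)
(* minus one; sets of points are sets of vector subspaces of dimension 1.      *)
Section ProjectiveSpace.
Variables (F : fieldType) (V : vectType F).
Implicit Types U : {vspace V}.

Definition subspaces (d : nat) U : set {vspace V} :=
  [set W | \dim W = d /\ (W <= U)%VS].

Definition points := subspaces 1%N.
Definition lines := subspaces 2%N.
Definition planes := subspaces 3%N.

(* Only the values of f at the points of PG(U) matter. *)
Definition collineation U (f : {vspace V} -> {vspace V}) : Prop :=
  set_bij (points U) (points U) f /\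
  (forall L, lines U L -> exists2 L', lines U L' & f @` points L = points L').

End ProjectiveSpace.

Section QuadraticForms.
Variables (F : fieldType) (V : vectType F).
Implicit Types (Q : V -> F) (U W : {vspace V}).

Definition polar_form Q (v w : V) : F := Q (v + w) - Q v - Q w.

(* Linearity in one argument is enough: polar_form Q is symmetric. *)
Definition quadratic_form Q : Prop :=
  (forall (a : F) (v : V), Q (a *: v) = a ^+ 2 * Q v) /\
  (forall w, scalar (fun v => polar_form Q v w)).

(* The radical of the polar form may be nonzero, as happens in characteristic  *)
(* 2 when \dim U is odd, but it contains no nonzero singular vector.           *)
Definition nondegenerate_on Q U : Prop :=
  forall v, v \in U -> Q v = 0 ->
    (forall w, w \in U -> polar_form Q v w = 0) -> v = 0.

Definition totally_singular Q W : Prop := forall v, v \in W -> Q v = 0.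

Definition witt_index Q U (m : nat) : Prop :=
  (exists W, [/\ (W <= U)%VS, totally_singular Q W & \dim W = m]) /\
  (forall W, (W <= U)%VS -> totally_singular Q W -> (\dim W <= m)%N).

(* Plus and minus type of the restriction of Q to U, for \dim U even. *)
Definition plus_type Q U : Prop := witt_index Q U (\dim U)./2.
Definition minus_type Q U : Prop := witt_index Q U (\dim U)./2.-1.

Definition quadric Q : set {vspace V} :=
  [set p | points fullv p /\ totally_singular Q p].

(* W^zeta, as a set of points. *)
Definition polarity Q W : set {vspace V} :=
  [set p | points fullv p /\
     forall v w, v \in p -> w \in W -> polar_form Q v w = 0].

End QuadraticForms.

Section Hyperovals.
Variables (F : fieldType) (V : vectType F) (Q : V -> F) (Pi : {vspace V}).

(* Q^-(3,q) *)
Definition section_quadric : set {vspace V} := points Pi `&` quadric Q.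

(* The lines of the generalized quadrangle W(q), whose points are points Pi. *)
Definition W_lines : set {vspace V} :=
  [set L | lines Pi L /\ exists! p, (points L `&` section_quadric) p].

Definition W_ovoid (O : set {vspace V}) : Prop :=
  O `<=` points Pi /\
  forall L, W_lines L -> exists! p, (points L `&` O) p.

(* "The" plane pi_x; the default value of xget is irrelevant, as such a plane  *)
(* exists and is unique whenever x is a point of Pi off Q^-(3,q), q even.      *)
Definition W_plane (x : {vspace V}) : {vspace V} :=
  xget 0%VS [set P | planes Pi P /\
                     forall L, W_lines L -> (x <= L)%VS -> (L <= P)%VS].

Definition conic (x : {vspace V}) : set {vspace V} :=
  polarity Q (W_plane x) `&` quadric Q.

Definition hyperoval_of (O : set {vspace V}) : set {vspace V} :=
  (\bigcup_(x in O `\` section_quadric) conic x) `|` (section_quadric `\` O).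

End Hyperovals.

(* Isomorphism of sets of points of the quadric of Q. *)
Definition quadric_isomorphic (F : fieldType) (V : vectType F) (Q : V -> F)
    (H1 H2 : set {vspace V}) : Prop :=
  exists f : {vspace V} -> {vspace V},
    [/\ collineation fullv f, f @` quadric Q = quadric Q & f @` H1 = H2].

(* Main.v *)
Require Import Defs.
From mathcomp Require Import all_boot all_order all_algebra.
From mathcomp Require Import boolp classical_sets functions.
From mathcomp Require Import abelian finfield ring.

(* Let L = Pi^zeta, an anisotropic line, so that V = Pi + L.  A singular vector
   x + l, with x in Pi and l in L, lies on H_O iff either l <> 0 and x is on O, or
   l = 0 and x is not on O.  By the fundamental theorem of projective geometry the
   collineations involved are semilinear, and they are similarities of Q.

   A similarity of Pi extends to V, because any two nonzero multiples of Galois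
   twists of the anisotropic form on L are isometric; this gives (2) => (1).

   Conversely, let G map H_{O_1} to H_{O_2}.  If G fixes L, it restricts to Pi.  In
   general H_{O_2} is invariant under the reflections with centers on G(L).  A
   center a + m outside L and Pi puts q/2 points of O_2 on a line through a, which
   is impossible for q > 4 as no three points of an ovoid are collinear; if G(L) lies
   in Pi, comparing the two descriptions of H_{O_2} also forces q <= 4.  For q = 4
   both cases show that O_2, and by symmetry O_1, contains a conic of Q^-(3,q), hence
   is an elliptic quadric {Q = B(a, .)^2} with Q(a) = 1; for q = 2 every ovoid other
   than Q^-(3,q) is such a quadric with Q(a) = 0.  The isometries of Pi are transitive
   on these quadrics. *)

Set Implicit Arguments.
Unset Strict Implicit.
Unset Printing Implicit Defensive.

Import GRing.Theory.

Local Open Scope ring_scope.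
Local Open Scope classical_set_scope.

(** * Semilinear maps and points *)

(** For nonzero l, membership of a singular x + l in H_O depends on x alone; this is the invariance
    under reflections with centers on L, and a similarity carries it to the centers on G(L). The
    number q/2 counts the elements of F not of the form z^2 + z: since L is anisotropic, a vector l
    of L with Q(l) = Q(x) and B(m, l) = b, where b and m are nonzero, exists exactly when Q(x) Q(m)
    / b^2 is such an element, and distinct b give distinct points on the line through a. The
    obstacle is q = 4: two points on a line contradict nothing, so there is no way to conclude that
    G fixes L. What survives is that these two points keep a, and every nonsingular point orthogonal
    to a, off O_2. This forces the conic in the plane orthogonal to a into O_2, and the ovoids are
    then compared through their classification instead of through G. *)

Record field_automorphism (F : fieldType) (s : F -> F) : Prop := {
  autD : forall x y, s (x + y) = s x + s y;
  autM : forall x y, s (x * y) = s x * s y;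
  aut_bij : bijective s }.

(** Relative to [U], so that one theory serves Pi, its orthogonal line and the whole space; [g] is
    unconstrained off [U]. Over a finite field the trivial kernel [semi_inj] already makes [g]
    bijective on [U]. *)
Record semilinear (F : fieldType) (V : vectType F) (U : {vspace V})
    (s : F -> F) (g : V -> V) : Prop := {
  semi_aut : field_automorphism s;
  semi_mem : forall v, v \in U -> g v \in U;
  semiD : forall u v, u \in U -> v \in U -> g (u + v) = g u + g v;
  semiZ : forall c v, v \in U -> g (c *: v) = s c *: g v;
  semi_inj : forall v, v \in U -> g v = 0 -> v = 0 }.

Section Automorphisms.
Variables (F : fieldType) (s : F -> F) (s_aut : field_automorphism s).

Lemma aut0 : s 0 = 0.
Proof. by apply: (addrI (s 0)); rewrite -(autD s_aut) !addr0. Qed.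

Lemma aut_eq0 x : (s x == 0) = (x == 0).
Proof. by rewrite -{1}aut0 (inj_eq (bij_inj (aut_bij s_aut))). Qed.

Lemma aut1 : s 1 = 1.
Proof.
have s1 : s 1 != 0 by rewrite aut_eq0 oner_eq0.
by apply: (mulfI s1); rewrite -(autM s_aut) !mulr1.
Qed.

Lemma autV x : s x^-1 = (s x)^-1.
Proof.
have [->|x0] := eqVneq x 0; first by rewrite invr0 aut0 invr0.
have sx : s x != 0 by rewrite aut_eq0.
by apply: (mulfI sx); rewrite -(autM s_aut) !divff // aut1.
Qed.

Lemma autX x n : s (x ^+ n) = s x ^+ n.
Proof. by elim: n => [|n IH]; rewrite ?expr0 ?aut1 // !exprS (autM s_aut) IH. Qed.

End Automorphisms.

Section Points.
Variables (F : fieldType) (V : vectType F).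
Implicit Types (U L : {vspace V}) (u v w : V).

Lemma points_line U v : v \in U -> v != 0 -> points U <[v]>%VS.
Proof. by move=> vU v0; split; [rewrite dim_vline v0 | rewrite -memvE]. Qed.

Lemma pointsP U p : points U p -> exists v, [/\ v \in U, v != 0 & p = <[v]>%VS].
Proof.
move=> [dp pU]; have p0 : p != 0%VS by rewrite -dimv_eq0 dp.
exists (vpick p); rewrite vpick0; split=> //.
  exact: subvP pU _ (memv_pick p).
apply/eqP; rewrite eq_sym eqEdim -memvE memv_pick dp dim_vline vpick0 p0.
by [].
Qed.

Lemma line_eq u v : v != 0 -> v \in <[u]>%VS -> <[v]>%VS = <[u]>%VS.
Proof.
move=> v0 vu; apply/eqP; rewrite eqEdim -memvE vu !dim_vline v0.
by case: (u != 0).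
Qed.

Lemma line_eqP u v : v != 0 -> <[v]>%VS = <[u]>%VS -> exists2 c, c != 0 & v = c *: u.
Proof.
move=> v0 e; have : v \in <[u]>%VS by rewrite -e memv_line.
case/vlineP => c vE; exists c => //; apply: contraNneq v0 => c0.
by rewrite vE c0 scale0r.
Qed.

Lemma scale_line c v : c != 0 -> <[c *: v]>%VS = <[v]>%VS.
Proof.
move=> c0; have [->|v0] := eqVneq v 0; first by rewrite scaler0.
by apply: line_eq; rewrite ?scaler_eq0 ?negb_or ?c0 // memvZ // memv_line.
Qed.

Lemma mem_add2 u v w :
  reflect (exists a b, w = a *: u + b *: v) (w \in <[u]> + <[v]>)%VS.
Proof.
apply: (iffP idP) => [/memv_addP [x /vlineP [a ->] [y /vlineP [b ->] ->]]|[a [b ->]]].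
  by exists a, b.
by apply: memv_add; rewrite memvZ ?memv_line.
Qed.

Lemma dim_add2 u v : u != 0 -> v \notin <[u]>%VS -> \dim (<[u]> + <[v]>) = 2%N.
Proof.
move=> u0 vu; have v0 : v != 0 by apply: contraNneq vu => ->; rewrite mem0v.
rewrite dimv_disjoint_sum ?dim_vline ?u0 ?v0 //.
apply/eqP; rewrite -subv0; apply/subvP => w /memv_capP [wu /vlineP [b wE]].
have [b0|b0] := eqVneq b 0; first by rewrite wE b0 scale0r mem0v.
by case/negP: vu; rewrite -(scalerK b0 v) -wE memvZ.
Qed.

Lemma lines_add2 U u v : u \in U -> v \in U -> u != 0 -> v \notin <[u]>%VS ->
  lines U (<[u]> + <[v]>)%VS.
Proof.
by move=> uU vU u0 vu; split; rewrite ?dim_add2 // subv_add -!memvE uU.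
Qed.

Lemma lines_eq U L u v : lines U L -> u \in L -> v \in L -> u != 0 ->
  v \notin <[u]>%VS -> L = (<[u]> + <[v]>)%VS.
Proof.
move=> [dL _] uL vL u0 vu; apply/eqP; rewrite eq_sym eqEdim dim_add2 // dL.
by rewrite subv_add -!memvE uL vL.
Qed.

Lemma linesP U L : lines U L ->
  exists u v, [/\ u \in U, v \in U, u != 0, v \notin <[u]>%VS
    & L = (<[u]> + <[v]>)%VS].
Proof.
move=> Ll; have [dL LU] := Ll.
have L0 : L != 0%VS by rewrite -dimv_eq0 dL.
have nsub : ~~ (L <= <[vpick L]>)%VS.
  by apply/negP => /dimvS; rewrite dL dim_vline; case: (_ != 0).
have [v vL vu] : exists2 v, v \in L & v \notin <[vpick L]>%VS.
  by move/subvPn: nsub => [v vL vu]; exists v.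
exists (vpick L), v; rewrite vpick0; split=> //.
- exact: subvP LU _ (memv_pick L).
- exact: subvP LU _ vL.
by apply: lines_eq Ll _ vL _ vu; rewrite ?memv_pick ?vpick0.
Qed.

Lemma notin_line_sym u v : u != 0 -> v \notin <[u]>%VS -> u \notin <[v]>%VS.
Proof.
move=> u0; apply: contra => uv; rewrite (line_eq u0 uv); exact: memv_line.
Qed.

Lemma notin_line0 u v : v \notin <[u]>%VS -> v != 0.
Proof. by apply: contraNneq => ->; rewrite mem0v. Qed.

End Points.

(** * The fundamental theorem of projective geometry *)

Ltac vring := apply/rowP => ?; rewrite !mxE; ring.

Section FundamentalTheorem.
Variables (F : finFieldType) (n : nat).
Let V := 'rV[F]_n.
Variables (U : {vspace V}) (f : {vspace V} -> {vspace V}).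
Hypotheses (char2 : (1 + 1 : F) = 0) (dimU : (2 < \dim U)%N).
Hypothesis f_coll : collineation U f.
Implicit Types u v w : V.

Let f_inj p q : points U p -> points U q -> f p = f q -> p = q.
Proof. by move=> pU qU; case: f_coll => -[_ inj _] _; apply: inj; exact: mem_set. Qed.

Let f_points p : points U p -> points U (f p).
Proof. by move=> pU; case: f_coll => -[fU _ _] _; apply: fU. Qed.

(** The image point fixes [v'] only up to a scalar; the work of the theorem is to choose these
    scalars coherently. *)
Let rep v v' := [/\ v' \in U, v' != 0 & f <[v]>%VS = <[v']>%VS].

Let rep_ex v : v \in U -> v != 0 -> exists v', rep v v'.
Proof.
move=> vU v0; have /pointsP [v' [v'U v'0 e]] := f_points (points_line vU v0).
by exists v'.
Qed.

Let rep_scale c v v' : c != 0 -> rep v v' -> rep v (c *: v').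
Proof.
move=> c0 [v'U v'0 e]; split; first exact: memvZ.
  by rewrite scaler_eq0 negb_or c0.
by rewrite scale_line.
Qed.

Let rep_notin u v u' v' : u \in U -> u != 0 -> v \in U -> v \notin <[u]>%VS ->
  rep u u' -> rep v v' -> v' \notin <[u']>%VS.
Proof.
move=> uU u0 vU vu [_ _ eu] [_ v'0 ev]; have v0 := notin_line0 vu.
apply: contra vu => /(line_eq v'0); rewrite -eu -ev => /f_inj e; rewrite -e ?memv_line //; exact: points_line.
Qed.

(** An equality and not only an implication: the image of a line is a full line and [f] is injective
    on points. *)
Let rep_line u v w u' v' w' : u \in U -> u != 0 -> v \in U ->
  v \notin <[u]>%VS -> w \in U -> w != 0 -> rep u u' -> rep v v' -> rep w w' ->
  (w \in <[u]> + <[v]>)%VS = (w' \in <[u']> + <[v']>)%VS.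
Proof.
move=> uU u0 vU vu wU w0 ru rv rw; have v'u' := rep_notin uU u0 vU vu ru rv.
have v0 := notin_line0 vu.
have [u'U u'0 eu] := ru; have [v'U v'0 ev] := rv; have [w'U w'0 ew] := rw.
have Luv := lines_add2 uU vU u0 vu.
have [_ /(_ _ Luv) [L' L'l L'E]] := f_coll.
have in_L z z' : z \in U -> z != 0 -> rep z z' ->
    (z \in <[u]> + <[v]>)%VS = (z' \in L')%VS.
  move=> zU z0 [z'U z'0 ez]; apply/idP/idP => [zL|z'L].
    have : points L' (f <[z]>%VS) by rewrite -L'E; exists <[z]>%VS => //; exact: points_line.
    by case=> _; rewrite ez -memvE.
  have : points L' <[z']>%VS by exact: points_line.
  rewrite -L'E => -[p pL]; rewrite -ez => /f_inj pz.
  rewrite memvE -pz; first by case: pL.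
    by case: pL => dp pL; split=> //; apply: subv_trans pL _; case: Luv.
  exact: points_line.
rewrite (in_L w w') //; rewrite (lines_eq L'l _ _ u'0 v'u') //.
  by rewrite -(in_L u) // memvE addvSl.
by rewrite -(in_L v) // memvE addvSr.
Qed.

(** Three noncollinear points have independent images because [rep_line] also reflects collinearity;
    this permits comparison of coefficients. *)
Let rep_free u v w u' v' w' : u \in U -> u != 0 -> v \in U ->
  v \notin <[u]>%VS -> w \in U -> (w \notin <[u]> + <[v]>)%VS ->
  rep u u' -> rep v v' -> rep w w' ->
  forall a b c, a *: u' + b *: v' + c *: w' = 0 -> [/\ a = 0, b = 0 & c = 0].
Proof.
move=> uU u0 vU vu wU wuv ru rv rw a b c.
have w0 : w != 0 by apply: contraNneq wuv => ->; rewrite mem0v.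
have [c0|c0] := eqVneq c 0; last first.
  move=> /eqP; rewrite addr_eq0 => /eqP e; case/negP: wuv.
  rewrite (rep_line uU u0 vU vu wU w0 ru rv rw).
  rewrite -[w'](scalerK c0) -[c *: w']opprK -e.
  rewrite memvZ // rpredN; apply/mem_add2; by exists a, b.
rewrite c0 scale0r addr0; have [b0|b0] := eqVneq b 0.
  move=> /eqP; rewrite b0 scale0r addr0 scaler_eq0.
  by case: ru => _ /negPf -> _; rewrite orbF => /eqP.
move=> /eqP; rewrite addrC addr_eq0 => /eqP e.
case/negP: (rep_notin uU u0 vU vu ru rv).
by rewrite -[v'](scalerK b0) e memvZ // rpredN memvZ // memv_line.
Qed.

(* On a complement [W] of a point [<[e]>], represented in the image by [e'], the
   vector [g v] is the representative of [f <[v]>] for which [e' + g v] represents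
   [f <[e + v]>]; writing [<[u + v]>] as an intersection of lines makes [g] additive. *)
Lemma fundamental_theorem_projective_geometry :
  exists s g, semilinear U s g /\
    forall v, v \in U -> v != 0 -> f <[v]>%VS = <[g v]>%VS.
Proof.
have U0 : U != 0%VS by rewrite -dimv_eq0 -lt0n; apply: leq_trans dimU.
pose e := vpick U; have eU : e \in U := memv_pick U.
have e0 : e != 0 by rewrite vpick0.
pose W := (U :\: <[e]>)%VS; have WU : (W <= U)%VS by exact: diffvSl.
have WeU : (W + <[e]>)%VS = U by rewrite addv_diff; apply/addv_idPl; rewrite -memvE.
have We0 : (W :&: <[e]>)%VS = 0%VS by rewrite /W capv_diff.
have memWU v : v \in W -> v \in U by exact: (subvP WU).
have We k v : v \in W -> k *: e + v = 0 -> k = 0 /\ v = 0.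
  move=> vW /eqP; rewrite addrC addr_eq0 => /eqP vE.
  have : v \in (W :&: <[e]>)%VS by rewrite memv_cap vW vE rpredN memvZ ?memv_line.
  rewrite We0 memv0 => /eqP v0; split=> //; move/eqP: vE.
  by rewrite v0 eq_sym oppr_eq0 scaler_eq0 (negPf e0) orbF => /eqP.
have [e' re] := rep_ex eU e0; have [e'U e'0 _] := re.
have W_notin v : v \in W -> v != 0 -> v \notin <[e]>%VS.
  move=> vW v0; apply/negP => ve; case/negP: v0.
  by rewrite -memv0 -We0 memv_cap vW.
have We_notin u v : u \in W -> v \in W -> u != 0 -> v \notin <[u]>%VS ->
    (v \notin <[e]> + <[u]>)%VS.
  move=> uW vW u0; apply: contra => /mem_add2 [a [b vE]].
  have [|_ /eqP] := We a (b *: u - v) (rpredB (rpredZ b uW) vW).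
    by rewrite addrA -vE subrr.
  by rewrite subr_eq0 => /eqP <-; rewrite memvZ // memv_line.
have eD0 v : v \in W -> e + v != 0.
  move=> vW; apply/eqP; rewrite -{1}[e]scale1r => /(We _ _ vW) [/eqP].
  by rewrite oner_eq0.
have eD_U v : v \in W -> e + v \in U by move=> vW; rewrite rpredD // memWU.
pose gP v v' := (v = 0 /\ v' = 0) \/ (v != 0 /\ rep v v' /\ rep (e + v) (e' + v')).
have gex v : exists v', v \in W -> gP v v'.
  have [v0|v0] := eqVneq v 0; first by exists 0 => _; left.
  have [vW|vW] := boolP (v \in W); last by exists 0.
  have [z rz] := rep_ex (eD_U _ vW) (eD0 _ vW).
  have [y ry] := rep_ex (memWU _ vW) v0.
  have ve := W_notin _ vW v0; have vU := memWU _ vW.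
  have : ((e + v)%R \in <[e]> + <[v]>)%VS by apply/mem_add2; exists 1, 1; rewrite !scale1r.
  rewrite (rep_line eU e0 vU ve (eD_U _ vW) (eD0 _ vW) re ry rz).
  case/mem_add2 => a [b zE].
  (* Both coefficients of [z] are nonzero because [<[e + v]>] differs from [<[v]>] and from [<[e]>];
     hence [y] can be rescaled so that [e' + (b / a) *: y] is proportional to [z]. *)
  have a0 : a != 0.
    apply/eqP => a0; have : z \notin <[y]>%VS.
      apply: (rep_notin vU v0 (eD_U _ vW) _ ry rz).
      apply: contra (notin_line_sym e0 ve) => H.
      by rewrite -(addrK v e) rpredB // memv_line.
    by rewrite zE a0 scale0r add0r memvZ ?memv_line.
  have b0 : b != 0.
    apply/eqP => b0; have : z \notin <[e']>%VS.
      apply: (rep_notin eU e0 (eD_U _ vW) _ re rz).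
      by apply: contra ve => H; rewrite -(addKr e v) rpredD // rpredN memv_line.
    by rewrite zE b0 scale0r addr0 memvZ ?memv_line.
  exists ((b / a) *: y) => _; right; split=> //; split.
    by apply: rep_scale => //; rewrite mulf_neq0 ?invr_eq0.
  have -> : e' + (b / a) *: y = a^-1 *: z.
    by rewrite zE scalerDr !scalerA mulVf // scale1r mulrC.
  by apply: rep_scale; rewrite ?invr_eq0.
have [g gW] := choice gex.
have g0 : g 0 = 0.
  have [[_ ->] //|[]] := gW 0 (mem0v W).
  by rewrite eqxx.
have gR v : v \in W -> v != 0 -> rep v (g v) /\ rep (e + v) (e' + g v).
  by move=> vW v0; have [[vz _]|[_ //]] := gW v vW; rewrite vz eqxx in v0.
(* Since [e'] and [g v] are independent, representing both [<[v]>] and [<[e + v]>] leaves no freedom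
   of scaling. *)
have g_uniq v v' : v \in W -> v != 0 -> rep v v' -> rep (e + v) (e' + v') -> v' = g v.
  move=> vW v0 rv [_ ev'0 eev]; have [rg [_ _ eeg]] := gR _ vW v0.
  have v'g : v' \in <[g v]>%VS.
    by case: rv => _ _; case: rg => _ _ -> ->; exact: memv_line.
  have [l v'E] := vlineP _ _ v'g.
  have [m m0 mE] : exists2 m, m != 0 & e' + v' = m *: (e' + g v).
    by apply: line_eqP => //; rewrite -eev -eeg.
  have gve := rep_notin eU e0 (memWU _ vW) (W_notin _ vW v0) re rg.
  have : (1 - m) *: e' + (l - m) *: g v = 0.
    rewrite !scalerBl scale1r -v'E addrACA mE scalerDr.
    by rewrite -opprD subrr.
  have [lm|lm] := eqVneq (l - m) 0.
    rewrite lm scale0r addr0 => /eqP; rewrite scaler_eq0 (negPf e'0) orbF subr_eq0.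
    move/eqP => m1; move: lm => /eqP; rewrite subr_eq0 -m1 => /eqP l1.
    by rewrite v'E l1 scale1r.
  move/eqP; rewrite addrC addr_eq0 => /eqP H; case/negP: gve.
  by rewrite -[g v](scalerK lm) H memvZ // rpredN memvZ // memv_line.
have gD_free u v : u \in W -> v \in W -> u != 0 -> v \notin <[u]>%VS ->
    g (u + v) = g u + g v.
  move=> uW vW u0 vu; have v0 := notin_line0 vu.
  have uvW : u + v \in W by rewrite rpredD.
  have uv0 : u + v != 0.
    apply: contraNneq vu => /eqP; rewrite addrC addr_eq0 => /eqP ->.
    by rewrite rpredN memv_line.
  have [[ru reu] [rv rev]] := (gR _ uW u0, gR _ vW v0).
  have [uU vU] := (memWU _ uW, memWU _ vW); have uvU := memWU _ uvW.
  have veu := We_notin _ _ uW vW u0 vu; have ue := W_notin _ uW u0.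
  have free := rep_free eU e0 uU ue vU veu re ru rv.
  have free_sub a b c a' b' c' :
      a *: e' + b *: g u + c *: g v = a' *: e' + b' *: g u + c' *: g v ->
      [/\ a = a', b = b' & c = c'].
    move=> /eqP; rewrite -subr_eq0 => /eqP H.
    have [|/eqP + /eqP + /eqP] := free (a - a') (b - b') (c - c').
      by rewrite -[RHS]H; vring.
    by rewrite !subr_eq0 => /eqP -> /eqP -> /eqP ->.
  have evu : e + v \notin <[e + u]>%VS.
    apply/negP => /vlineP [k]; rewrite scalerDr => H; case/negP: veu.
    rewrite -(addKr e v) H; apply/mem_add2; exists (k - 1), k.
    by rewrite scalerBl scale1r addrCA addrA addrC addrCA addrA.
  apply/esym/g_uniq => //.
    (* [<[u + v]>] is the intersection of the lines <u, v> and <e + u, e + v>, the latter because 1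
       + 1 = 0. *)
    have [z rz] := rep_ex uvU uv0.
    have /mem_add2 [a [b zE]] : (z \in <[g u]> + <[g v]>)%VS.
      rewrite -(rep_line uU u0 vU vu uvU uv0 ru rv rz).
      by apply/mem_add2; exists 1, 1; rewrite !scale1r.
    have /mem_add2 [c [d zE']] : (z \in <[(e' + g u)%R]> + <[(e' + g v)%R]>)%VS.
      rewrite -(rep_line (eD_U _ uW) (eD0 _ uW) (eD_U _ vW) evu uvU uv0 reu rev rz).
      apply/mem_add2; exists 1, 1; rewrite !scale1r.
      by apply/rowP => i; rewrite !mxE; ring: char2.
    have [|cd ac bd] := free_sub 0 a b (c + d) c d.
      by rewrite scale0r add0r -zE zE'; vring.
    have ab : a = b.
      have -> : a = d + (c + d) - (1 + 1) * d by rewrite ac; ring.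
      by rewrite -cd char2 bd; ring.
    have [zU z0 ez] := rz.
    have a0 : a != 0.
      by apply: contraNneq z0 => a0; rewrite zE -ab a0 !scale0r addr0.
    have -> : g u + g v = a^-1 *: z by rewrite zE -ab -scalerDr scalerK.
    by apply: rep_scale; rewrite ?invr_eq0.
  have euvU := eD_U _ uvW; have euv0 := eD0 _ uvW.
  (* [<[e + u + v]>] is the intersection of the lines <e + u, v> and <e + v, u>. *)
  have [z rz] := rep_ex euvU euv0.
  have veu' : v \notin <[e + u]>%VS.
    apply: contra veu => /vlineP [k ->]; rewrite scalerDr.
    by apply/mem_add2; exists k, k.
  have uev' : u \notin <[e + v]>%VS.
    apply/negP => /vlineP [k H].
    have : (u \in <[e]> + <[v]>)%VS by rewrite H scalerDr; apply/mem_add2; exists k, k.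
    by apply/negP/We_notin => //; apply: notin_line_sym.
  have /mem_add2 [a [b zE]] : (z \in <[(e' + g u)%R]> + <[g v]>)%VS.
    rewrite -(rep_line (eD_U _ uW) (eD0 _ uW) vU veu' euvU euv0 reu rv rz).
    by apply/mem_add2; exists 1, 1; rewrite !scale1r addrA.
  have /mem_add2 [c [d zE']] : (z \in <[(e' + g v)%R]> + <[g u]>)%VS.
    rewrite -(rep_line (eD_U _ vW) (eD0 _ vW) uU uev' euvU euv0 rev ru rz).
    by apply/mem_add2; exists 1, 1; rewrite !scale1r addrAC addrA.
  have [|ac ad bc] := free_sub a a b c d c.
    by rewrite -scalerDr -zE zE'; vring.
  have [zU z0 ez] := rz.
  have zE2 : z = a *: (e' + (g u + g v)) by rewrite zE bc -ac; vring.
  have a0 : a != 0 by apply: contraNneq z0 => a0; rewrite zE2 a0 scale0r.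
  rewrite -[e' + _](scalerK a0) -zE2.
  by apply: rep_scale; rewrite ?invr_eq0.
have [u0 u0W u00] : exists2 u, u \in W & u != 0.
  exists (vpick W); rewrite ?memv_pick // vpick0 -dimv_eq0.
  move: dimU; rewrite -WeU dimv_disjoint_sum // dim_vline e0.
  by case: (\dim W).
have [w0 w0W w0u] : exists2 w, w \in W & w \notin <[u0]>%VS.
  apply/subvPn/negP => /dimvS; rewrite dim_vline u00.
  move: dimU; rewrite -WeU dimv_disjoint_sum // dim_vline e0.
  by case: (\dim W) => [|[]].
have w00 := notin_line0 w0u.
have pick_free u : u \in W -> u != 0 -> exists2 w, w \in W & w \notin <[u]>%VS.
  move=> uW u_0; have [w0u'|w0u'] := boolP (w0 \in <[u]>%VS); last by exists w0.
  exists u0 => //; rewrite -(line_eq w00 w0u').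
  exact: notin_line_sym.
have gD u v : u \in W -> v \in W -> g (u + v) = g u + g v.
  move=> uW vW; have [->|u_0] := eqVneq u 0; first by rewrite g0 !add0r.
  have [->|v_0] := eqVneq v 0; first by rewrite g0 !addr0.
  have [vu|vu] := boolP (v \in <[u]>%VS); last exact: gD_free.
  have [uv0|uv0] := eqVneq (u + v) 0.
    have -> : v = u + v + u by apply/rowP => i; rewrite !mxE; ring: char2.
    rewrite uv0 add0r.
    have -> : u + u = 0 by apply/rowP => i; rewrite !mxE; ring: char2.
    by rewrite g0; apply/rowP => i; rewrite !mxE; ring: char2.
  (* For [v] on the line of [u], a vector [w] off it reduces additivity to the independent case:
     [g (u + v + w)] is expanded in two ways. *)
  have [w wW wu] := pick_free _ uW u_0; have uvW := rpredD uW vW.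
  have wv : w \notin <[v]>%VS by rewrite (line_eq v_0 vu).
  have uvu : u + v \in <[u]>%VS by rewrite rpredD // memv_line.
  have wuv : w \notin <[(u + v)%R]>%VS by rewrite (line_eq uv0 uvu).
  have vwu : v + w \notin <[u]>%VS.
    by apply: contra wu => H; rewrite -(addKr v w) rpredD // rpredN.
  have E1 := gD_free _ _ uvW wW uv0 wuv; have E2 := gD_free _ _ vW wW v_0 wv.
  have E3 := gD_free _ _ uW (rpredD vW wW) u_0 vwu.
  by apply: (addIr (g w)); rewrite -E1 -[u + v + w]addrA E3 E2 addrA.
have g_n0 v : v \in W -> v != 0 -> g v != 0.
  by move=> vW v_0; have [[]] := gR _ vW v_0.
have gZ_ex v c : exists k, v \in W -> v != 0 -> g (c *: v) = k *: g v.
  have [vW|] := boolP (v \in W); last by exists 0.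
  have [->|v_0] := eqVneq v 0; first by exists 0.
  have [->|c0] := eqVneq c 0; first by exists 0; rewrite !scale0r g0.
  have cv0 : c *: v != 0 by rewrite scaler_eq0 negb_or c0.
  have [[_ _ e1] _] := gR _ vW v_0.
  have [[_ cn0 e2] _] := gR _ (rpredZ c vW) cv0.
  have : g (c *: v) \in <[g v]>%VS by rewrite -e1 -(scale_line v c0) e2 memv_line.
  by case/vlineP => k kE; exists k.
have [s' s'E] : {s' | forall v c, v \in W -> v != 0 -> g (c *: v) = s' v c *: g v}.
  have [h hE] := choice (fun x => gZ_ex x.1 x.2).
  by exists (fun v c => h (v, c)) => v c; apply: (hE (v, c)).
(* Comparing the two expansions of [g (c *: (u + v))] shows that independent vectors have the same
   multiplier. *)
have s'_free u v c : u \in W -> v \in W -> u != 0 -> v \notin <[u]>%VS ->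
    s' u c = s' v c.
  move=> uW vW u_0 vu; have v_0 := notin_line0 vu.
  have [c0|c0] := eqVneq c 0.
    have s'0 w : w \in W -> w != 0 -> s' w c = 0.
      move=> wW w_0; have := s'E _ c wW w_0; rewrite c0 scale0r g0 => /esym/eqP.
      by rewrite scaler_eq0 (negPf (g_n0 _ wW w_0)) orbF => /eqP.
    by rewrite !s'0.
  have uv_0 : u + v != 0.
    apply: contraNneq vu => /eqP; rewrite addrC addr_eq0 => /eqP ->.
    by rewrite rpredN memv_line.
  have [ru _] := gR _ uW u_0; have [rv _] := gR _ vW v_0.
  have gvu := rep_notin (memWU _ uW) u_0 (memWU _ vW) vu ru rv.
  have := s'E _ c (rpredD uW vW) uv_0.
  rewrite scalerDr !gD ?rpredZ // !s'E //; set k := s' (u + v) c => H.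
  have H2 : (s' v c - k) *: g v = (k - s' u c) *: g u.
    by apply/eqP; rewrite -subr_eq0 -(subrr (k *: (g u + g v))) -{1}H; apply/eqP; vring.
  have kv : s' v c = k.
    apply/eqP; rewrite -subr_eq0; apply: contraNT gvu => kv.
    by rewrite -[g v](scalerK kv) H2 !memvZ // memv_line.
  move/eqP: H2; rewrite kv subrr scale0r eq_sym scaler_eq0 subr_eq0.
  by rewrite (negPf (g_n0 _ uW u_0)) orbF => /eqP.
pose s c := s' u0 c.
have gZ v c : v \in W -> g (c *: v) = s c *: g v.
  move=> vW; have [->|v_0] := eqVneq v 0; first by rewrite scaler0 g0 scaler0.
  rewrite s'E //; congr (_ *: _); rewrite /s.
  have [vu|vu] := boolP (v \in <[u0]>%VS); last by rewrite (s'_free u0 v).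
  have w0v : w0 \notin <[v]>%VS by rewrite (line_eq v_0 vu).
  by rewrite (s'_free v w0) // (s'_free u0 w0).
have gu0 := g_n0 _ u0W u00.
have scalerI0 (a b : F) : a *: g u0 = b *: g u0 -> a = b.
  move/eqP; rewrite -subr_eq0 -scalerBl scaler_eq0 (negPf gu0) orbF subr_eq0.
  by move/eqP.
have s_aut : field_automorphism s.
  split=> [x y|x y|].
  - by apply: scalerI0; rewrite scalerDl -!gZ // scalerDl gD ?rpredZ.
  - by apply: scalerI0; rewrite -scalerA -!gZ ?rpredZ // scalerA.
  apply: injF_bij => x y /(congr1 (fun c => c *: g u0)).
  rewrite -!gZ // => H; have xyW : (x - y) *: u0 \in W by rewrite rpredZ.
  apply: contra_eq H => xy; have xy0 : (x - y) *: u0 != 0.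
    by rewrite scaler_eq0 negb_or subr_eq0 xy.
  apply: contra_neq (g_n0 _ xyW xy0) => H.
  have := gD _ _ xyW (rpredZ y u0W); rewrite -scalerDl subrK => E.
  by apply: (addIr (g (y *: u0))); rewrite -E add0r.
have decomp v : exists kw : F * V, v \in U -> kw.2 \in W /\ v = kw.1 *: e + kw.2.
  have [vU|] := boolP (v \in U); last by exists (0, 0).
  move: (vU); rewrite -WeU => /memv_addP [w wW [x /vlineP [k ->] ->]].
  by exists (k, w) => _; rewrite addrC.
have [d dE] := choice decomp.
have dE_uniq k w : w \in W -> d (k *: e + w) = (k, w).
  move=> wW; have vU : k *: e + w \in U by rewrite rpredD ?rpredZ // memWU.
  have [dW dv] := dE _ vU; move: dW dv; case: (d _) => [k' w'] /= w'W H.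
  have [|/eqP + /eqP] := We (k - k') (w - w') (rpredB wW w'W).
    by rewrite scalerBl addrACA H -opprD subrr.
  by rewrite !subr_eq0 => /eqP -> /eqP ->.
pose G v := s (d v).1 *: e' + g (d v).2.
have GE k w : w \in W -> G (k *: e + w) = s k *: e' + g w.
  by move=> wW; rewrite /G dE_uniq.
have gWU w : w \in W -> g w \in U.
  move=> wW; have [->|w_0] := eqVneq w 0; first by rewrite g0 mem0v.
  by have [[]] := gR _ wW w_0.
have GR v : v \in U -> v != 0 -> rep v (G v).
  move=> vU v_0; have [wW vE] := dE _ vU.
  move: (d v) wW vE => [k w] /= wW vE; rewrite vE GE //.
  have [k0|k0] := eqVneq k 0.
    rewrite k0 (aut0 s_aut) !scale0r !add0r.
    move: v_0; rewrite vE k0 scale0r add0r => w_0.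
    by have [] := gR w wW w_0.
  have sk0 : s k != 0 by rewrite (aut_eq0 s_aut).
  have [w_0|w_0] := eqVneq w 0.
    rewrite w_0 g0 !addr0; have [e'_U e'_0 ee] := rep_scale sk0 re.
    by split=> //; rewrite scale_line.
  (* [v] is [k] times [e + k^-1 *: w], whose image point is represented by [e' + g (k^-1 *: w)] by
     the choice of [g]. *)
  have kwW : k^-1 *: w \in W by rewrite rpredZ.
  have kw0 : k^-1 *: w != 0 by rewrite scaler_eq0 negb_or invr_eq0 k0.
  have [_ /(rep_scale sk0)] := gR _ kwW kw0.
  rewrite scalerDr -gZ // scalerA divff // scale1r => -[H1 H2 H3].
  split=> //; rewrite -H3 -(scale_line (e + _) k0) scalerDr scalerA divff //.
  by rewrite scale1r.
exists s, G; split; last by move=> v vU v_0; have [] := GR v vU v_0.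
split=> // [v vU|u v uU vU|c v vU|v vU].
- have [wW ->] := dE _ vU; rewrite GE // rpredD ?rpredZ ?gWU //.
- have [wW uE] := dE _ uU; have [xW vE] := dE _ vU.
  rewrite {1}uE {1}vE addrACA -scalerDl GE ?rpredD // gD // (autD s_aut).
  by rewrite scalerDl addrACA.
- have [wW vE] := dE _ vU; rewrite {1}vE scalerDr scalerA GE ?rpredZ // gZ //.
  by rewrite (autM s_aut) -scalerA -scalerDr.
by apply: contra_eq => v_0; have [] := GR v vU v_0.
Qed.

End FundamentalTheorem.

(** * Collineations induced by semilinear maps *)

Section SemilinearMaps.
Variables (F : finFieldType) (n : nat).
Let V := 'rV[F]_n.
Variables (U : {vspace V}) (s : F -> F) (g : V -> V).
Hypothesis g_semi : semilinear U s g.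
Implicit Types u v w : V.

Lemma semi0 : g 0 = 0.
Proof.
rewrite -[X in g X](scale0r (0 : V)) (semiZ g_semi) ?mem0v //.
by rewrite (aut0 (semi_aut g_semi)) scale0r.
Qed.

Lemma semi_eq0 v : v \in U -> (g v == 0) = (v == 0).
Proof.
by move=> vU; apply/eqP/eqP => [/(semi_inj g_semi vU)|->]; rewrite ?semi0.
Qed.

Lemma semiB u v : u \in U -> v \in U -> g (u - v) = g u - g v.
Proof.
move=> uU vU; apply/eqP; rewrite eq_sym subr_eq -(semiD g_semi) ?rpredB //.
by rewrite subrK.
Qed.

Lemma semilinear_inj u v : u \in U -> v \in U -> g u = g v -> u = v.
Proof.
move=> uU vU /eqP; rewrite -subr_eq0 -semiB // semi_eq0 ?rpredB // subr_eq0.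
by move/eqP.
Qed.

Lemma semilinear_surj w : w \in U -> exists2 v, v \in U & g v = w.
Proof.
(* Extending [g] by the identity off [U] gives an injective self-map of a finite type, hence a
   bijection. *)
move=> wU; pose h v := if v \in U then g v else v.
have h_inj : injective h.
  move=> u v; rewrite /h; case: ifP => uU; case: ifP => vU //.
  - exact: semilinear_inj.
  - by move=> E; rewrite -E (semi_mem g_semi) in vU.
  - by move=> E; rewrite E (semi_mem g_semi) in uU.
have [k hk kh] := injF_bij h_inj; exists (k w).
  by have := kh w; rewrite /h; case: ifP => // kU E; rewrite E in kU; rewrite kU in wU.
by have := kh w; rewrite /h; case: ifP => // kU E; rewrite E wU in kU.
Qed.

Definition line_map (p : {vspace V}) : {vspace V} := <[g (vpick p)]>%VS.

Lemma line_mapE v : v \in U -> v != 0 -> line_map <[v]>%VS = <[g v]>%VS.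
Proof.
move=> vU v0; rewrite /line_map; set w := vpick _.
have /vlineP [c wE] : w \in <[v]>%VS by exact: memv_pick.
have w0 : w != 0 by rewrite vpick0 -dimv_eq0 dim_vline v0.
have c0 : c != 0 by apply: contraNneq w0 => c0; rewrite wE c0 scale0r.
by rewrite wE (semiZ g_semi) // scale_line // (aut_eq0 (semi_aut g_semi)).
Qed.

Lemma line_map_image (S T : set {vspace V}) :
  S `<=` points U -> T `<=` points U ->
  (forall v, v \in U -> v != 0 -> S <[v]>%VS <-> T <[g v]>%VS) ->
  line_map @` S = T.
Proof.
move=> SU TU ST; rewrite eqEsubset; split=> [_ [p pS <-]|p pT].
  have [v [vU v0 pE]] := pointsP (SU _ pS).
  by rewrite pE line_mapE //; apply/ST => //; rewrite -pE.
have [w [wU w0 pE]] := pointsP (TU _ pT).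
have [v vU gv] := semilinear_surj wU.
have v0 : v != 0 by rewrite -semi_eq0 // gv.
exists <[v]>%VS; last by rewrite line_mapE // gv pE.
by apply/ST => //; rewrite gv -pE.
Qed.

Lemma semilinear_line u v : u \in U -> u != 0 -> v \in U ->
  (g v \in <[g u]>%VS) = (v \in <[u]>%VS).
Proof.
move=> uU u0 vU; have s_aut := semi_aut g_semi.
apply/vlineP/vlineP => -[c E]; last by exists (s c); rewrite E (semiZ g_semi).
have [t _ st] := aut_bij s_aut; exists (t c); apply: semilinear_inj => //.
  exact: rpredZ.
by rewrite (semiZ g_semi) // st.
Qed.

Lemma line_map_collineation : collineation U line_map.
Proof.
have s_aut := semi_aut g_semi; have [t _ st] := aut_bij s_aut.
have g_point v : v \in U -> v != 0 -> points U <[g v]>%VS.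
  by move=> vU v0; apply: points_line; rewrite ?(semi_mem g_semi) // semi_eq0.
split; first split.
- by move=> p /pointsP [v [vU v0 ->]]; rewrite line_mapE //; apply: g_point.
- move=> p q /set_mem/pointsP [u [uU u0 ->]] /set_mem/pointsP [v [vU v0 ->]].
  rewrite !line_mapE // => E; apply: line_eq => //.
  by rewrite -semilinear_line // -E memv_line.
- move=> p /pointsP [w [wU w0 ->]]; have [v vU gv] := semilinear_surj wU.
  have v0 : v != 0 by rewrite -semi_eq0 // gv.
  by exists <[v]>%VS; [exact: points_line | rewrite line_mapE // gv].
move=> L /linesP [u [v [uU vU u0 vu ->]]].
exists (<[g u]> + <[g v]>)%VS.
  apply: lines_add2; rewrite ?(semi_mem g_semi) ?semi_eq0 //.
  by rewrite semilinear_line.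
have LU : (<[u]> + <[v]> <= U)%VS by rewrite subv_add -!memvE uU.
rewrite eqEsubset; split=> [_ [p /pointsP [w [wL w0 ->]] <-]|p /pointsP [w [wL w0 ->]]].
  rewrite line_mapE ?(subvP LU) //; apply: points_line; last first.
    by rewrite semi_eq0 ?(subvP LU).
  have /mem_add2 [a [b ->]] := wL; apply/mem_add2; exists (s a), (s b).
  by rewrite (semiD g_semi) ?rpredZ // !(semiZ g_semi).
have /mem_add2 [a [b wE]] := wL.
have zE : g (t a *: u + t b *: v) = w.
  by rewrite (semiD g_semi) ?rpredZ // !(semiZ g_semi) // !st.
have zU : t a *: u + t b *: v \in U by rewrite rpredD ?rpredZ.
have z0 : t a *: u + t b *: v != 0 by rewrite -semi_eq0 // zE.
exists <[(t a *: u + t b *: v)%R]>%VS; last by rewrite line_mapE // zE.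
by apply: points_line => //; apply/mem_add2; exists (t a), (t b).
Qed.

End SemilinearMaps.

Lemma collineation_image (F : finFieldType) n (U : {vspace 'rV[F]_n}) f g
    (S T : set {vspace 'rV[F]_n}) : collineation U f ->
  (forall v, v \in U -> v != 0 -> f <[v]>%VS = <[g v]>%VS) ->
  S `<=` points U -> f @` S = T ->
  forall v, v \in U -> v != 0 -> S <[v]>%VS <-> T <[g v]>%VS.
Proof.
move=> [[_ f_inj _] _] fg SU fST v vU v0; rewrite -fg // -fST.
split; first by exists <[v]>%VS.
move=> [p Sp fp]; suff <- : p = <[v]>%VS by [].
by apply: f_inj fp; apply/mem_set; [exact: SU | exact: points_line].
Qed.

(** * Quadratic forms in characteristic two *)

Section ArtinSchreier.
Local Open Scope set_scope.
Variable F : finFieldType.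
Hypothesis char2 : (1 + 1 : F) = 0.
Implicit Types s t z : F.

(** The image of the additive map z -> z^2 + z, whose kernel is {0, 1}: the subgroup of index two of
    the elements of absolute trace zero. It decides which quadratic equations are solvable in
    characteristic two. *)
Definition artin_schreier s := [exists z, s == z ^+ 2 + z].

Lemma artin_schreierP s : reflect (exists z, s = z ^+ 2 + z) (artin_schreier s).
Proof. exact: 'exists_eqP. Qed.

Lemma addxx2 s : s + s = 0.
Proof. by ring: char2. Qed.

Lemma oppr2 s : - s = s.
Proof. by apply/esym/eqP; rewrite -addr_eq0 addxx2. Qed.

Lemma exists_notin (A : seq F) : (size A < #|F|)%N -> exists z, z \notin A.
Proof.
move=> AF; apply/existsP; rewrite -negb_forall; apply: contraL AF => /forallP H.
rewrite -leqNgt; apply: leq_trans (card_size A).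
by apply/subset_leq_card/fintype.subsetP => x _; have := H x.
Qed.

Lemma sqrt2 s : exists r, r ^+ 2 = s.
Proof.
have sq_inj : injective (fun r : F => r ^+ 2).
  move=> x y /eqP; rewrite -subr_eq0 => /eqP H; apply/eqP; rewrite -subr_eq0.
  rewrite -sqrf_eq0 -[X in _ == X]H; apply/eqP; rewrite !oppr2.
  by ring: char2.
by have [h _ hK] := injF_bij sq_inj; exists (h s).
Qed.

Lemma artin_schreierD s t : artin_schreier s -> artin_schreier t ->
  artin_schreier (s + t).
Proof.
move=> /artin_schreierP [x ->] /artin_schreierP [y ->].
by apply/artin_schreierP; exists (x + y); ring: char2.
Qed.

(** The fibres of z -> z^2 + z have at most two elements, so the image [I] contains at least half of
    the field; the coset [J] of [s] is disjoint from [I], so the two fill the field. *)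
Lemma artin_schreier_add s t : ~~ artin_schreier s -> ~~ artin_schreier t ->
  artin_schreier (s + t).
Proof.
move=> sI tI; pose I := [set x | artin_schreier x].
have IE : I = [set z ^+ 2 + z | z in [set: F]].
  apply/finset.setP => x; rewrite inE; apply/artin_schreierP/imsetP => [[z ->]|[z _ ->]].
    by exists z.
  by exists z.
have card_I : (#|F| <= 2 * #|I|)%N.
  rewrite -cardsT -sum1_card (partition_big_imset (fun z : F => z ^+ 2 + z)) /=.
  rewrite -IE mulnC -sum_nat_const; apply: leq_sum => x; rewrite inE.
  move=> /artin_schreierP [z ->].
  rewrite sum1_card; have two : (#|[set z; (z + 1)%R]| <= 2)%N by rewrite cards2; case: (_ != _).
  apply: leq_trans two.
  apply/subset_leq_card/fintype.subsetP => y /andP [_ /eqP H]; rewrite !inE.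
  have : (y - z) * (y - (z + 1)) == 0.
    by rewrite -(addxx2 (y ^+ 2 + y)) {2}H !oppr2; apply/eqP; ring: char2.
  by rewrite mulf_eq0 !subr_eq0.
pose J : {set F} := [set s + x | x in I].
have card_sI : #|J| = #|I| by apply/card_imset/addrI.
have disj : finset.setI I J = finset.set0.
  apply/finset.setP => x; rewrite !inE; apply/negP.
  move=> /andP [xI /imsetP [y]]; rewrite inE => yI xE; case/negP: sI.
  have -> : s = x + y by rewrite xE; ring: char2.
  exact: artin_schreierD.
have : finset.setU I J == [set: F].
  rewrite eqEcard finset.subsetT cardsU disj cards0 subn0 card_sI cardsT.
  by rewrite addnn -mul2n.
move/eqP/finset.setP/(_ t); rewrite !inE (negPf tI) /= => /imsetP [x]; rewrite inE => xI ->.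
by have -> : s + (s + x) = x by ring: char2.
Qed.

Lemma artin_schreier0 : artin_schreier 0.
Proof. by apply/artin_schreierP; exists 0; ring. Qed.

Lemma artin_schreier_shift s z :
  artin_schreier (s + (z ^+ 2 + z)) = artin_schreier s.
Proof.
have zI : artin_schreier (z ^+ 2 + z) by apply/artin_schreierP; exists z.
apply/idP/idP => H; last exact: artin_schreierD.
have -> : s = s + (z ^+ 2 + z) + (z ^+ 2 + z) by ring: char2.
exact: artin_schreierD.
Qed.

Lemma two_non_artin_schreier d : (2 < #|F|)%N -> ~~ artin_schreier d ->
  exists d', d' != d /\ ~~ artin_schreier d'.
Proof.
move=> F2 dI.
have [z] := @exists_notin [:: 0; 1] F2.
rewrite !inE negb_or => /andP [z0 z1]; exists (d + (z ^+ 2 + z)).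
rewrite artin_schreier_shift dI; split=> //.
have -> : z ^+ 2 + z = z * (z - 1) by rewrite !oppr2; ring.
by rewrite -subr_eq0 addrAC subrr add0r mulf_neq0 // subr_eq0.
Qed.

(** The translates of [d] by x^2 + x and y^2 + y differ from [d] and from each other when [x] avoids
    0, 1 and [y] avoids 0, 1, x, x + 1; hence the bound 4. *)
Lemma three_non_artin_schreier d : (4 < #|F|)%N -> ~~ artin_schreier d ->
  exists d1 d2, [/\ d1 != d, d2 != d, d1 != d2, ~~ artin_schreier d1
    & ~~ artin_schreier d2].
Proof.
move=> F4 dI.
have F2 : (2 < #|F|)%N by apply: leq_trans F4.
have key x y : x != y -> x != y + 1 -> d + (x ^+ 2 + x) != d + (y ^+ 2 + y).
  move=> xy xy1; rewrite -subr_eq0.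
  have -> : d + (x ^+ 2 + x) - (d + (y ^+ 2 + y)) = (x - y) * (x - (y + 1)).
    by rewrite !oppr2; ring: char2.
  by rewrite mulf_neq0 // subr_eq0.
have [x] := @exists_notin [:: 0; 1] F2; rewrite !inE negb_or => /andP [x0 x1].
have [y] := @exists_notin [:: 0; 1; x; x + 1] F4.
rewrite !inE !negb_or => /and4P [y0 y1 yx yx1].
exists (d + (x ^+ 2 + x)), (d + (y ^+ 2 + y)); rewrite !artin_schreier_shift.
have d0 : d = d + (0 ^+ 2 + 0) by ring.
split=> //; first by rewrite {2}d0 key // add0r.
  by rewrite {2}d0 key // add0r.
by rewrite eq_sym key.
Qed.

(** Since z^4 = z, the product (z^2 + z)(z^2 + z + 1) = z^4 + z vanishes, so the image is the prime
    field. *)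
Lemma card4_artin_schreier s : #|F| = 4%N -> artin_schreier s = (s \in [:: 0; 1]).
Proof.
move=> F4; have F4x (x : F) : x ^+ 4 = x by rewrite -F4 expf_card.
apply/idP/idP => [/artin_schreierP [z ->]|].
  have : (z ^+ 2 + z) * (z ^+ 2 + z - 1) == 0.
    rewrite oppr2; have -> : (z ^+ 2 + z) * (z ^+ 2 + z + 1) = z ^+ 4 + z by ring: char2.
    by rewrite F4x addxx2.
  by rewrite mulf_eq0 subr_eq0 !inE.
rewrite !inE => /orP [] /eqP ->; first exact: artin_schreier0.
have [z] : exists z : F, z \notin [:: 0; 1] by apply: exists_notin; rewrite F4.
rewrite !inE negb_or => /andP [z0 z1]; apply/artin_schreierP; exists z.
have : (z * (z - 1)) * (z ^+ 2 + z - 1) == 0.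
  rewrite !oppr2; have -> : z * (z + 1) * (z ^+ 2 + z + 1) = z ^+ 4 + z by ring: char2.
  by rewrite F4x addxx2.
rewrite !mulf_eq0 (negPf z0) subr_eq0 (negPf z1) /= subr_eq0.
by move/eqP => ->.
Qed.

Lemma card4_non_artin_schreier s : #|F| = 4%N -> ~~ artin_schreier s -> s ^+ 2 = s + 1.
Proof.
move=> F4; rewrite card4_artin_schreier // !inE negb_or => /andP [s0 s1].
have : (s * (s - 1)) * (s ^+ 2 - (s + 1)) == 0.
  rewrite !oppr2; have -> : s * (s + 1) * (s ^+ 2 + (s + 1)) = s ^+ 4 + s by ring: char2.
  by rewrite -F4 expf_card addxx2.
rewrite !mulf_eq0 (negPf s0) subr_eq0 (negPf s1) /= subr_eq0.
by move/eqP.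
Qed.

End ArtinSchreier.

Lemma even_card_char2 (F : finFieldType) : ~~ odd #|F| -> (1 + 1 : F) = 0.
Proof.
move=> evenF; have [p p_pr pF] := finPcharP F.
suff p2 : p = 2%N by move: pF; rewrite p2 inE => /andP [_ /eqP].
have [n oF] : exists n, #|F| = (p ^ n)%N.
  have := fin_ring_pchar_abelem pF => /abelem_pgroup /p_natP [n].
  by rewrite cardsT; exists n.
case: (even_prime p_pr) => // p_odd; case/negP: evenF.
by rewrite oF oddX p_odd orbT.
Qed.

(** * Polar forms, transvections and semisimilarities *)

Section QuadraticFormTheory.
Variables (F : finFieldType) (n : nat).
Let V := 'rV[F]_n.
Variable Q : V -> F.
Hypotheses (char2 : (1 + 1 : F) = 0) (Q_quad : quadratic_form Q).
Implicit Types u v w : V.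
Local Notation B := (polar_form Q).

Lemma quadZ a v : Q (a *: v) = a ^+ 2 * Q v.
Proof. by case: Q_quad. Qed.

Lemma quad0 : Q 0 = 0.
Proof. by have := quadZ 0 0; rewrite scale0r => ->; ring. Qed.

Lemma quadD u v : Q (u + v) = Q u + Q v + B u v.
Proof. by rewrite /polar_form; ring. Qed.

Lemma polarC u v : B u v = B v u.
Proof. by rewrite /polar_form (addrC u); ring. Qed.

Lemma polarDl u v w : B (u + v) w = B u w + B v w.
Proof. by have := Q_quad.2 w 1 u v; rewrite scale1r => ->; rewrite mul1r. Qed.

Lemma polar0l w : B 0 w = 0.
Proof. by rewrite /polar_form quad0 add0r; ring. Qed.

Lemma polarZl a v w : B (a *: v) w = a * B v w.
Proof. by have := Q_quad.2 w a v 0; rewrite !addr0 polar0l addr0. Qed.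

Lemma polarDr u v w : B w (u + v) = B w u + B w v.
Proof. by rewrite !(polarC w) polarDl. Qed.

Lemma polarZr a v w : B w (a *: v) = a * B w v.
Proof. by rewrite !(polarC w) polarZl. Qed.

Lemma polar0r w : B w 0 = 0.
Proof. by rewrite polarC polar0l. Qed.

Lemma polarvv v : B v v = 0.
Proof.
rewrite /polar_form; have -> : v + v = 0 by rewrite -{1 2}[v]scale1r -scalerDl char2 scale0r.
by rewrite quad0 sub0r -opprD addxx2 // oppr0.
Qed.

Definition quadE := (quadD, quadZ, polarDl, polarDr, polarZl, polarZr, polarvv).

(* In the plane spanned by [r] and [u], [x = b u + a r] has [B r x = b], and
   [Q x = c] becomes an Artin-Schreier equation for [a * Q r / b]. *)
Lemma plane_value r u b c : B r u = 1 -> ~~ artin_schreier (Q r * Q u) ->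
  b != 0 -> ~~ artin_schreier (c * Q r / b ^+ 2) ->
  exists a, Q (b *: u + a *: r) = c.
Proof.
move=> ru QI b0 cI.
have /artin_schreierP [z zE] := artin_schreier_add char2 QI cI.
have r0 : Q r != 0 by apply: contraNneq QI => ->; rewrite mul0r artin_schreier0.
exists (z * b / Q r); rewrite !quadE polarC ru.
have -> : c = (Q r * Q u + c * Q r / b ^+ 2 + Q r * Q u) * b ^+ 2 / Q r.
  rewrite addrAC addxx2 // add0r; field; by rewrite r0.
rewrite zE; field; by rewrite r0.
Qed.

Lemma plane_value_polar r u a b : B r u = 1 -> B r (b *: u + a *: r) = b.
Proof. by move=> ru; rewrite !quadE ru; ring. Qed.

(** A solution of z^2 + z = Q r * Q u would make [u + (z / Q r) *: r] singular. *)
Lemma anisotropic_plane r u : B r u = 1 -> Q r != 0 ->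
  (forall a, Q (u + a *: r) != 0) -> ~~ artin_schreier (Q r * Q u).
Proof.
move=> ru r0 H; apply/artin_schreierP => -[z zE].
have /eqP [] := H (z / Q r); rewrite !quadE polarC ru.
have -> : Q u = (z ^+ 2 + z) / Q r by rewrite -zE mulrC mulKf.
have -> : (z ^+ 2 + z) / Q r + (z / Q r) ^+ 2 * Q r + z / Q r * 1 =
  (1 + 1) * (z ^+ 2 + z) / Q r by field.
by rewrite char2 !mul0r.
Qed.

(** The orthogonal transvection with center [p]: the reflection of the overview. *)
Definition transvection p v := v + (B v p / Q p) *: p.

Lemma transvection_quad p v : Q p != 0 -> Q (transvection p v) = Q v.
Proof.
move=> p0; rewrite /transvection !quadE.
have -> : Q v + (B v p / Q p) ^+ 2 * Q p + B v p / Q p * B v p =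
  Q v + (1 + 1) * (B v p) ^+ 2 / Q p by field.
by rewrite char2 !mul0r addr0.
Qed.

Section Similarity.
Variables (U : {vspace V}) (s : F -> F) (g : V -> V).
Hypothesis g_semi : semilinear U s g.
Hypothesis nondeg : forall v, v \in U -> v != 0 -> exists2 w, w \in U & B v w != 0.
Hypothesis singular_ex : exists2 x, x \in U & x != 0 /\ Q x = 0.
Hypothesis g_singular : forall v, v \in U -> Q (g v) = 0 <-> Q v = 0.

(** A vector space is not the union of two hyperplanes, here x^perp and y^perp. *)
Lemma two_hyperplanes x y : x \in U -> y \in U -> x != 0 -> y != 0 ->
  exists2 u, u \in U & B x u != 0 /\ B y u != 0.
Proof.
move=> xU yU x0 y0.
have [u uU xu] := nondeg xU x0; have [v vU yv] := nondeg yU y0.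
have [yu|yu] := eqVneq (B y u) 0; last by exists u.
have [xv|xv] := eqVneq (B x v) 0; last by exists v.
exists (u + v); rewrite ?rpredD // !polarDr yu xv add0r addr0; by [].
Qed.

(* For [x] singular, the line through [x] and [v] has the single singular point
   [v + (Q v / B x v) x] besides [x], or none if [B x v = 0] and [Q v != 0]. *)
Lemma polar_semilinear x : x \in U -> x != 0 -> Q x = 0 ->
  exists2 c, c != 0 & (forall v, v \in U -> B (g x) (g v) = c * s (B x v)) /\
   (forall v, v \in U -> B x v != 0 -> Q (g v) = c * s (Q v)).
Proof.
move=> xU x0 Qx; have s_aut := semi_aut g_semi.
have [t _ st] := aut_bij s_aut.
have Qgx : Q (g x) = 0 by apply/g_singular.
have QgD a v : v \in U -> Q (g (v + a *: x)) = Q (g v) + s a * B (g x) (g v).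
  move=> vU; rewrite (semiD g_semi) ?rpredZ // (semiZ g_semi) // !quadE Qgx.
  by rewrite polarC; ring.
have QD a v : Q (v + a *: x) = Q v + a * B x v.
  by rewrite !quadE Qx polarC; ring.
(* If the images were not orthogonal, their line would have a singular point besides [g x], coming
   from some [v + a *: x]. Then Q v = 0 and the whole line of [x] and [v] is singular, whereas the
   image line has just one such further point. *)
have sB v : v \in U -> B x v = 0 -> B (g x) (g v) = 0.
  move=> vU xv; apply/eqP; apply: contraT => gxv.
  pose a := t (Q (g v) / B (g x) (g v)).
  have vaU c : v + c *: x \in U by rewrite rpredD ?rpredZ.
  have : Q (g (v + a *: x)) = 0.
    by rewrite QgD // st divfK // addxx2.
  move/(g_singular (vaU _)).1; rewrite QD xv mulr0 addr0 => Qv.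
  have : Q (g (v + (a + 1) *: x)) = 0.
    by apply/(g_singular (vaU _)); rewrite QD xv mulr0 addr0.
  rewrite QgD // (autD s_aut) st (aut1 s_aut) mulrDl divfK // mul1r addrA.
  by rewrite addxx2 // add0r => /eqP; rewrite (negPf gxv).
have [v0 v0U xv0] := nondeg xU x0.
pose c := B (g x) (g v0) / s (B x v0).
have sxv0 : s (B x v0) != 0 by rewrite (aut_eq0 s_aut).
have BE v : v \in U -> B (g x) (g v) = c * s (B x v).
  move=> vU; have wU : v + (B x v / B x v0) *: v0 \in U by rewrite rpredD ?rpredZ.
  have := sB _ wU; rewrite (semiD g_semi) ?rpredZ // (semiZ g_semi) // !quadE.
  rewrite divfK // addxx2 // => /(_ erefl) /eqP.
  rewrite addr_eq0 oppr2 // => /eqP ->.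
  by rewrite (autM s_aut) (autV s_aut) /c; field.
have QE v : v \in U -> B x v != 0 -> Q (g v) = c * s (Q v).
  move=> vU xv; have : Q (v + (Q v / B x v) *: x) = 0 by rewrite QD divfK // addxx2.
  move/(g_singular (rpredD vU (rpredZ _ xU))); rewrite QgD // BE // => /eqP.
  rewrite addr_eq0 oppr2 // => /eqP ->.
  rewrite mulrCA -(autM s_aut) divfK //.
exists c; last by split.
(* If [c] were 0, all vectors off x^perp would have singular images; when [v0] is itself singular,
   [v0 + x] is a nonsingular vector off x^perp. *)
have [Qv0|Qv0] := eqVneq (Q v0) 0.
  have v1U : v0 + 1 *: x \in U by rewrite rpredD ?rpredZ.
  have B1 : B x (v0 + 1 *: x) = B x v0 by rewrite !quadE mulr0 addr0.
  have := QE _ v1U; rewrite B1 => /(_ xv0) H.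
  apply/eqP => c0; move: H; rewrite c0 mul0r => /(g_singular v1U).1.
  by rewrite QD Qv0 mul1r add0r => /eqP; rewrite (negPf xv0).
apply/eqP => c0; have := QE _ v0U xv0.
by rewrite c0 mul0r => /(g_singular v0U).1 /eqP; rewrite (negPf Qv0).
Qed.

(** [polar_semilinear] leaves out the vectors orthogonal to [x]. Such a [v] is treated with a second
    singular vector [y] orthogonal to neither [x] nor [v]; the factors of [x] and [y] agree because
    both compute [B (g x) (g y)]. *)
Lemma semisimilarity : exists2 c, c != 0 & forall v, v \in U -> Q (g v) = c * s (Q v).
Proof.
have [x xU [x0 Qx]] := singular_ex; have s_aut := semi_aut g_semi.
have [c c0 [cB cQ]] := polar_semilinear xU x0 Qx; exists c => // v vU.
have [->|v0] := eqVneq v 0; first by rewrite (semi0 g_semi) quad0 (aut0 s_aut) mulr0.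
have [xv|xv] := eqVneq (B x v) 0; last exact: cQ.
have [u uU [xu vu]] := two_hyperplanes xU vU x0 v0.
pose y := u + (Q u / B x u) *: x.
have yU : y \in U by rewrite rpredD ?rpredZ.
have Qy : Q y = 0 by rewrite !quadE Qx mulr0 addr0 (polarC u) divfK // addxx2.
have xy : B x y = B x u by rewrite !quadE mulr0 addr0.
have yv : B y v != 0 by rewrite !quadE xv mulr0 addr0 polarC.
have y0 : y != 0 by apply: contraNneq yv => ->; rewrite polar0l.
have [d d0 [dB dQ]] := polar_semilinear yU y0 Qy.
suff -> : c = d by exact: dQ.
have sxu : s (B x u) != 0 by rewrite (aut_eq0 s_aut).
by apply: (mulIf sxu); rewrite -xy -cB // polarC dB // polarC.
Qed.

End Similarity.

Lemma semisimilarity_polar (U : {vspace V}) s g c : semilinear U s g ->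
  (forall v, v \in U -> Q (g v) = c * s (Q v)) ->
  forall u v, u \in U -> v \in U -> B (g u) (g v) = c * s (B u v).
Proof.
move=> g_semi gQ u v uU vU; have s_aut := semi_aut g_semi.
have := gQ _ (rpredD uU vU); rewrite (semiD g_semi) // !quadD !(autD s_aut).
rewrite !gQ // !mulrDr => /addrI; exact.
Qed.

End QuadraticFormTheory.

(** * The decomposition of the space by an elliptic section *)

Section OrthogonalPlane.
Variables (F : finFieldType) (n : nat).
Let V := 'rV[F]_n.
Variable Q : V -> F.
Hypotheses (char2 : (1 + 1 : F) = 0) (Q_quad : quadratic_form Q).
Local Notation B := (polar_form Q).
Let quadE := quadE char2 Q_quad.

Lemma addvv2 (v : V) : v + v = 0.
Proof. by rewrite -{1 2}[v]scale1r -scalerDl char2 scale0r. Qed.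

(* If [u] and [v] were orthogonal, a singular combination of them would be
   orthogonal to all of [U]. *)
Lemma orthogonal_plane (U E : {vspace V}) : (E <= U)%VS ->
  \dim U = (\dim E + 2)%N -> nondegenerate_on Q U ->
  (forall x, exists2 y, y \in E & forall z, z \in E -> B z (x + y) = 0) ->
  (forall z, z \in E -> (forall y, y \in E -> B z y = 0) -> z = 0) ->
  exists u v, [/\ u \in U, v \in U, B u v = 1,
    (forall z, z \in E -> B z u = 0 /\ B z v = 0)
    & forall x, x \in U -> exists y a b, y \in E /\ x = y + a *: u + b *: v].
Proof.
move=> EU dU ndU proj E_nd; pose C := (U :\: E)%VS.
have CE : (C + E)%VS = U by rewrite addv_diff; apply/addv_idPl.
have C0 : (C :&: E)%VS = 0%VS by rewrite /C capv_diff.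
have dC : \dim C = 2%N.
  apply: (@addIn (\dim E)); rewrite -dimv_disjoint_sum // CE dU addnC.
  by [].
have [|c1 [c2 [c1C c2C c10 c21 CE2]]] := @linesP _ _ U C.
  by split=> //; exact: diffvSl.
have [y1 y1E c1y] := proj c1; have [y2 y2E c2y] := proj c2.
set u := c1 + y1 in c1y; set v := c2 + y2 in c2y.
have yU y : y \in E -> y \in U by exact: (subvP EU).
have uU : u \in U by rewrite rpredD // yU.
have vU : v \in U by rewrite rpredD // yU.
have span x : x \in U -> exists y a b, y \in E /\ x = y + a *: u + b *: v.
  rewrite -CE CE2 => /memv_addP [c /mem_add2 [a [b ->]] [y yE ->]].
  exists (y - a *: y1 - b *: y2), a, b; split; first by rewrite !rpredB // rpredZ.
  by rewrite /u /v; vring.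
have free a b y : y \in E -> y + a *: u + b *: v = 0 -> a = 0 /\ b = 0.
  move=> yE H; have abE : a *: c1 + b *: c2 = 0.
    have : a *: c1 + b *: c2 \in (C :&: E)%VS.
      rewrite memv_cap CE2; apply/andP; split; first by apply/mem_add2; exists a, b.
      have -> : a *: c1 + b *: c2 =
          y + a *: u + b *: v - (y + a *: y1 + b *: y2) by rewrite /u /v; vring.
      by rewrite H sub0r rpredN !rpredD // rpredZ.
    by rewrite C0 memv0 => /eqP.
  have b0 : b = 0.
    apply/eqP; apply: contraNT c21 => b0; rewrite -[c2](scalerK b0).
    have -> : b *: c2 = - (a *: c1) by apply/eqP; rewrite -addr_eq0 addrC abE.
    by rewrite memvZ // rpredN memvZ // memv_line.
  move/eqP: abE; rewrite b0 scale0r addr0 scaler_eq0 (negPf c10) orbF.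
  by move/eqP.
clearbody u v.
have uvE z : z \in E -> B z u = 0 /\ B z v = 0 by move=> zE; split; [exact: c1y|exact: c2y].
have [uv0|uv0] := eqVneq (B u v) 0; last first.
  exists u, ((B u v)^-1 *: v); split=> //; first by rewrite rpredZ.
  - by rewrite (polarZr Q_quad) mulVf.
  - by move=> z zE; rewrite (polarZr Q_quad); have [-> ->] := uvE z zE; rewrite mulr0.
  move=> x /span [y [a [b [yE ->]]]]; exists y, a, (b * B u v); split=> //.
  by rewrite scalerA mulfK.
have rad w a b : w = a *: u + b *: v -> Q w = 0 -> w = 0.
  move=> wE Qw; have wU : w \in U by rewrite wE rpredD ?rpredZ.
  apply: (ndU w wU Qw) => x /span [y [a' [b' [yE ->]]]].
  have [yu yv] := uvE y yE.
  by rewrite wE !quadE !(polarC Q _ y) yu yv (polarC Q v) uv0; ring.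
have [Qu|Qu] := eqVneq (Q u) 0.
  have [] := free 1 0 0 (mem0v E).
    by rewrite -[RHS](rad u 1 0) //; vring.
  by move/eqP; rewrite oner_eq0.
have [k kE] := sqrt2 char2 (Q v / Q u).
have H : Q (k *: u + 1 *: v) = 0.
  by rewrite !quadE uv0 kE divfK //; ring: char2.
have [|_] := free k 1 0 (mem0v E).
  by rewrite -[RHS](rad _ k 1 erefl) //; vring.
by move/eqP; rewrite oner_eq0.
Qed.

End OrthogonalPlane.

(** The geometry of Pi and its orthogonal line in terms of vectors. [es_ell] expresses Witt index at
    most one on Pi, and [es_frame] completes [e], [f] to a symplectic basis of Pi, whether or not
    they are singular. *)
Record elliptic_section (F : finFieldType) (n : nat) (Q : 'rV[F]_n -> F)
    (Pi L : {vspace 'rV[F]_n}) : Prop := {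
  es_quad : quadratic_form Q;
  es_perp : forall x l, x \in Pi -> l \in L -> polar_form Q x l = 0;
  es_decomp : forall w, exists x l, [/\ x \in Pi, l \in L & w = x + l];
  es_aniso : forall l, l \in L -> Q l = 0 -> l = 0;
  es_ell : forall x y, x \in Pi -> y \in Pi -> x != 0 -> Q x = 0 -> Q y = 0 ->
    polar_form Q x y = 0 -> y \in <[x]>%VS;
  es_sing : exists2 x, x \in Pi & x != 0 /\ Q x = 0;
  es_frame : forall e f, e \in Pi -> f \in Pi -> polar_form Q e f = 1 ->
    exists u v, [/\ u \in Pi, v \in Pi, polar_form Q u v = 1,
      (polar_form Q e u = 0 /\ polar_form Q e v = 0) /\
      (polar_form Q f u = 0 /\ polar_form Q f v = 0) &
      forall x, x \in Pi -> exists a b c d,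
        x = a *: e + b *: f + c *: u + d *: v];
  es_pair : forall m, m \in L -> m != 0 -> exists2 u, u \in L &
    polar_form Q m u = 1 /\ forall l, l \in L -> exists a b, l = a *: m + b *: u;
  es_nondeg : forall x, x \in Pi -> x != 0 -> exists2 y, y \in Pi & polar_form Q x y = 1;
  es_nonempty : exists2 l, l \in L & l != 0 }.

Section EllipticSection.
Variables (F : finFieldType) (Q : 'rV[F]_6 -> F) (Pi : {vspace 'rV[F]_6}).
Local Notation B := (polar_form Q).
Hypotheses (char2 : (1 + 1 : F) = 0) (Q_quad : quadratic_form Q).
Hypotheses (Q_nondegenerate : nondegenerate_on Q fullv)
    (Q_plus : plus_type Q fullv) (dim_Pi : \dim Pi = 4%N)
    (Pi_nondegenerate : nondegenerate_on Q Pi) (Pi_minus : minus_type Q Pi).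
Let quadE := quadE char2 Q_quad.

Lemma ts_polar W v w : totally_singular Q W -> v \in W -> w \in W -> B v w = 0.
Proof. by move=> WQ vW wW; rewrite /polar_form !WQ ?rpredD //; ring. Qed.

Lemma elliptic_no_line x y : x \in Pi -> y \in Pi -> x != 0 -> Q x = 0 -> Q y = 0 ->
    B x y = 0 -> y \in <[x]>%VS.
Proof.
move=> xPi yPi x0 Qx Qy xy; apply: contraT => yx.
have [_] := Pi_minus; rewrite dim_Pi => /(_ (<[x]> + <[y]>)%VS).
rewrite subv_add -!memvE xPi yPi dim_add2 // => /(_ isT) H.
suff /H : totally_singular Q (<[x]> + <[y]>)%VS by [].
by move=> w /mem_add2 [a [b ->]]; rewrite !quadE Qx Qy xy; ring.
Qed.

Lemma elliptic_singular : exists2 x, x \in Pi & x != 0 /\ Q x = 0.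
Proof.
have [[W [WPi WQ dW]] _] := Pi_minus; rewrite dim_Pi /= in dW.
have [x [xPi x0 WE]] := pointsP (conj dW WPi); exists x => //; split=> //.
by apply: WQ; rewrite WE memv_line.
Qed.

Lemma singular_nondegenerate (U : {vspace 'rV[F]_6}) x : nondegenerate_on Q U ->
  x \in U -> x != 0 -> Q x = 0 -> exists2 y, y \in U & B x y = 1.
Proof.
move=> ndU xU x0 Qx; apply: contrapT => H; case/eqP: x0; apply: ndU => // y yU.
apply: contrapT => /eqP xy; apply: H; exists ((B x y)^-1 *: y); rewrite ?rpredZ //.
by rewrite (polarZr Q_quad) mulVf.
Qed.

Lemma elliptic_frame e f : e \in Pi -> f \in Pi -> B e f = 1 ->
  exists u v, [/\ u \in Pi, v \in Pi, B u v = 1,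
    (B e u = 0 /\ B e v = 0) /\ (B f u = 0 /\ B f v = 0) &
    forall x, x \in Pi -> exists a b c d,
      x = a *: e + b *: f + c *: u + d *: v].
Proof.
move=> ePi fPi ef; have fe := ef; rewrite polarC in fe.
have e0 : e != 0.
  by apply/eqP => e0; move/eqP: ef; rewrite e0 (polar0l Q_quad) eq_sym oner_eq0.
have fe_line : f \notin <[e]>%VS.
  apply/vlineP => -[k fE]; move/eqP: ef.
  by rewrite fE !quadE mulr0 eq_sym oner_eq0.
have eE : e \in (<[e]> + <[f]>)%VS by apply/mem_add2; exists 1, 0; vring.
have fE : f \in (<[e]> + <[f]>)%VS by apply/mem_add2; exists 0, 1; vring.
have [|||||u [v [uPi vPi uv H xE]]] := @orthogonal_plane _ _ Q char2 Q_quad Pi (<[e]> + <[f]>)%VS.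
- by rewrite subv_add -!memvE ePi.
- by rewrite dim_Pi dim_add2.
- exact: Pi_nondegenerate.
- move=> x; exists (B x f *: e + B x e *: f).
    by apply/mem_add2; exists (B x f), (B x e).
  move=> z /mem_add2 [a [b ->]]; rewrite !quadE fe ef (polarC Q e x) (polarC Q f x).
  by ring: char2.
- move=> z /mem_add2 [a [b zE]] H.
  have := H f fE; rewrite zE !quadE ef mulr0 addr0 mulr1 => ->.
  have := H e eE; rewrite zE !quadE fe mulr0 add0r mulr1 => ->.
  by vring.
exists u, v; split=> //; first by have [He Hf] := (H _ eE, H _ fE).
move=> x /xE [y [c [d [/mem_add2 [a [b ->]] ->]]]].
by exists a, b, c, d.
Qed.

Lemma elliptic_section_exists : exists L, elliptic_section Q Pi L.
Proof.
have [e ePi [e0 Qe]] := elliptic_singular.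
have [f fPi ef] := singular_nondegenerate Pi_nondegenerate ePi e0 Qe.
have [u [v [uPi vPi uv [[eu ev] [fu fv]] xE]]] := elliptic_frame ePi fPi ef.
have proj x : exists2 y, y \in Pi & forall z, z \in Pi -> B z (x + y) = 0.
  exists (B x f *: e + B x e *: f + B x v *: u + B x u *: v).
    by rewrite !rpredD ?rpredZ.
  move=> z /xE [a [b [c [d ->]]]]; rewrite !quadE !(polarC Q _ x).
  rewrite (polarC Q f e) (polarC Q v u) (polarC Q u e) (polarC Q u f).
  rewrite (polarC Q v e) (polarC Q v f) ef uv eu ev fu fv.
  by ring: char2.
have Pi_rad z : z \in Pi -> (forall y, y \in Pi -> B z y = 0) -> z = 0.
  move=> zPi H; have [a [b [c [d zE]]]] := xE _ zPi.
  have := H _ ePi; have := H _ fPi; have := H _ uPi; have := H _ vPi.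
  rewrite zE !quadE.
  rewrite (polarC Q f e) (polarC Q v u) (polarC Q u e) (polarC Q u f).
  rewrite (polarC Q v e) (polarC Q v f) ef uv eu ev fu fv.
  rewrite !(mulr0, mulr1, addr0, add0r) => -> -> -> ->; vring.
have [|||||m [l [_ _ ml mlPi wE]]] := @orthogonal_plane _ _ Q char2 Q_quad fullv Pi.
- exact: subvf.
- by rewrite dim_Pi dimvf /dim /= mul1n.
- exact: Q_nondegenerate.
- exact: proj.
- exact: Pi_rad.
have lm := ml; rewrite polarC in lm.
pose L := (<[m]> + <[l]>)%VS; exists L.
have PiL x y : x \in Pi -> y \in L -> B x y = 0.
  move=> xPi /mem_add2 [a [b ->]]; have [xm xl] := mlPi x xPi.
  by rewrite !quadE xm xl; ring.
have decomp w : exists x y, [/\ x \in Pi, y \in L & w = x + y].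
  have [y [a [b [yPi ->]]]] := wE w (memvf w).
  exists y, (a *: m + b *: l); split=> //; last by rewrite addrA.
  by apply/mem_add2; exists a, b.
have mL : m \in L by apply/mem_add2; exists 1, 0; vring.
have lL : l \in L by apply/mem_add2; exists 0, 1; vring.
have L_rad z : z \in L -> (forall y, y \in L -> B z y = 0) -> z = 0.
  move=> /mem_add2 [a [b zE]] H; have := H _ mL; have := H _ lL.
  rewrite zE !quadE ml lm !(mulr0, mulr1, addr0, add0r) => -> ->; vring.
have m0 : m != 0.
  by apply/eqP => m0; move/eqP: ml; rewrite m0 (polar0l Q_quad) eq_sym oner_eq0.
split=> //.
(* Anisotropy of [L]: a totally singular [W] of dimension 3 meets Pi in a point [w0], so W + Pi is
   everything and each y in [L] has a lift x + y in [W]. The lift of a singular [z] has x singular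
   and orthogonal to [w0], hence x on [w0] and [z] in [W]; being orthogonal to the lifts of all y,
   [z] is in the radical of [L]. *)
- move=> z zL Qz; have [[W [_ WQ dW']] _] := Q_plus.
  have dW : \dim W = 3%N by rewrite dW' dimvf.
  have dWPi : (\dim (W :&: Pi) <= 1)%N.
    have [_ ] := Pi_minus; rewrite dim_Pi; apply; first exact: capvSr.
    by move=> w /memv_capP [wW _]; exact: WQ.
  have dS := dimv_sum_cap W Pi; rewrite dW dim_Pi in dS.
  have dS6 : (\dim (W + Pi) <= 6)%N.
    by apply: leq_trans (dimvS (subvf _)) _; rewrite dimvf.
  have dWPi1 : \dim (W :&: Pi) = 1%N.
    by apply/eqP; rewrite eqn_leq dWPi -(leq_add2l 6) -[(6 + 1)%N]dS leq_add2r.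
  have WPi : (W + Pi)%VS = fullv.
    apply/eqP; rewrite eqEdim subvf.
    by rewrite dimvf -(leq_add2r 1) -[X in (_ <= _ + X)%N]dWPi1 dS.
  have [w0 [w0WPi w00 _]] := pointsP (conj dWPi1 (subvv _)).
  have /memv_capP [w0W w0Pi] := w0WPi.
  have WL y : y \in L -> exists2 x, x \in Pi & x + y \in W.
    move=> yL; have := memvf y; rewrite -WPi => /memv_addP [w wW [x xPi ->]].
    exists x => //; have -> : x + (w + x) = w by apply/rowP => i; rewrite !mxE; ring: char2.
    by [].
  have [x xPi xzW] := WL _ zL.
  have w0x : B w0 x = 0.
    have := ts_polar WQ w0W xzW; rewrite (polarDr Q_quad) (PiL _ _ w0Pi zL) addr0.
    by [].
  have Qx : Q x = 0.
    by have := WQ _ xzW; rewrite quadD Qz (PiL _ _ xPi zL) !addr0.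
  have /vlineP [k xw0] := elliptic_no_line w0Pi xPi w00 (WQ _ w0W) Qx w0x.
  have zW : z \in W.
    have -> : z = (x + z) - k *: w0 by rewrite xw0; vring.
    by rewrite rpredB // rpredZ.
  apply: L_rad => // y yL; have [x' x'Pi x'yW] := WL _ yL.
  have := ts_polar WQ zW x'yW; rewrite (polarDr Q_quad) (polarC Q z) (PiL _ _ x'Pi zL).
  by rewrite add0r.
- exact: elliptic_no_line.
- exact: elliptic_singular.
- exact: elliptic_frame.
- move=> z zL z0.
  have [y yL zy] : exists2 y, y \in L & B z y != 0.
    apply: contrapT => H; case/eqP: z0; apply: L_rad => // y yL.
    by apply: contrapT => /eqP zy; apply: H; exists y.
  exists ((B z y)^-1 *: y); first by rewrite rpredZ.
  have zy1 : B z ((B z y)^-1 *: y) = 1 by rewrite (polarZr Q_quad) mulVf.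
  have y'L : (B z y)^-1 *: y \in L by rewrite rpredZ.
  split=> // w; rewrite (@lines_eq _ _ fullv L z ((B z y)^-1 *: y)) //.
  - by move/mem_add2.
  - split; last exact: subvf.
    rewrite dim_add2 //; apply/vlineP => -[k lE]; move/eqP: ml.
    by rewrite lE !quadE mulr0 eq_sym oner_eq0.
  apply/vlineP => -[k E]; move/eqP: zy1.
  by rewrite E !quadE mulr0 eq_sym oner_eq0.
- move=> z zPi z0.
  have [y yPi zy] : exists2 y, y \in Pi & B z y != 0.
    apply: contrapT => H; case/eqP: z0; apply: Pi_rad => // y yPi.
    by apply: contrapT => /eqP zy; apply: H; exists y.
  exists ((B z y)^-1 *: y); first by rewrite rpredZ.
  by rewrite (polarZr Q_quad) mulVf.
by exists m.
Qed.

End EllipticSection.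

(** An ovoid as a scale-invariant predicate, with totally isotropic lines of Pi in place of the
    lines of W(q): [ov_uniq] gives at most one point on each, [ov_meet] at least one. Images under
    isometries can be handled in this form without sets of subspaces. *)
Record ovoid_vectors (F : finFieldType) (n : nat) (Q : 'rV[F]_n -> F)
    (Pi : {vspace 'rV[F]_n}) (o : 'rV[F]_n -> Prop) : Prop := {
  ov_mem : forall v, o v -> v \in Pi /\ v != 0;
  ov_scale : forall c v, c != 0 -> o v -> o (c *: v);
  ov_uniq : forall u v, o u -> o v -> polar_form Q u v = 0 -> v \in <[u]>%VS;
  ov_meet : forall u v, u \in Pi -> v \in Pi -> u != 0 -> v \notin <[u]>%VS ->
    polar_form Q u v = 0 -> o u \/ exists t, o (v + t *: u) }.

(** * Lines, planes and hyperovals in the coordinates x + l *)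

Section Geometry.
Variables (F : finFieldType) (Q : 'rV[F]_6 -> F) (Pi L : {vspace 'rV[F]_6}).
Local Notation B := (polar_form Q).
Hypotheses (char2 : (1 + 1 : F) = 0) (es : elliptic_section Q Pi L).
Let Q_quad := es_quad es.
Let quadE := quadE char2 Q_quad.

Lemma es_disjoint l : l \in Pi -> l \in L -> l = 0.
Proof.
move=> lPi lL; apply/eqP; apply: contraT => l0.
have [u uL [lu _]] := es_pair es lL l0.
by move/eqP: lu; rewrite (es_perp es) // eq_sym oner_eq0.
Qed.

Lemma es_memPi w : (forall l, l \in L -> B w l = 0) -> w \in Pi.
Proof.
move=> H; have [x [l [xPi lL wE]]] := es_decomp es w.
suff l0 : l = 0 by rewrite wE l0 addr0.
apply/eqP; apply: contraT => l0; have [u uL [lu _]] := es_pair es lL l0.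
have := H u uL; rewrite wE !quadE lu (es_perp es) // add0r => /eqP.
by rewrite oner_eq0.
Qed.

Lemma es_uniq x l x' l' : x \in Pi -> l \in L -> x' \in Pi -> l' \in L ->
  x + l = x' + l' -> x = x' /\ l = l'.
Proof.
move=> xPi lL x'Pi l'L E; have D : x - x' = l' - l.
  by apply/eqP; rewrite subr_eq addrAC [l' + _]addrC -E addrK.
have x0 : x - x' = 0 by apply: es_disjoint; [rewrite rpredB | rewrite D rpredB].
split; apply/eqP; first by rewrite -subr_eq0 x0.
by rewrite eq_sym -subr_eq0 -D x0.
Qed.

Lemma quad_es x l : x \in Pi -> l \in L -> Q (x + l) = Q x + Q l.
Proof. by move=> xPi lL; rewrite quadD (es_perp es) // addr0. Qed.

Lemma quad_es_eq0 x l : x \in Pi -> l \in L -> (Q (x + l) == 0) = (Q x == Q l).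
Proof. by move=> xPi lL; rewrite quad_es // addr_eq0 oppr2. Qed.

Lemma es_value c l : l \in L -> l != 0 -> exists2 l', l' \in L & Q l' = c.
Proof.
move=> lL l0; have Ql : Q l != 0 by apply: contra_neq l0 => /(es_aniso es lL).
have [k kE] := sqrt2 char2 (c / Q l).
by exists (k *: l); rewrite ?rpredZ // quadZ // kE divfK.
Qed.

Lemma line_quad0 v : (forall w, w \in <[v]>%VS -> Q w = 0) <-> Q v = 0.
Proof.
split=> [|Qv w /vlineP [k ->]]; first by apply; exact: memv_line.
by rewrite !quadE Qv mulr0.
Qed.

Lemma points_full (v : 'rV[F]_6) : v != 0 -> points fullv <[v]>%VS.
Proof. by move=> v0; apply: points_line; rewrite ?memvf. Qed.

Lemma section_quadricP v : v != 0 ->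
  section_quadric Q Pi <[v]>%VS <-> v \in Pi /\ Q v = 0.
Proof.
move=> v0; split=> [[[_ +] [_ Qv]]|[vPi Qv]].
  by rewrite -memvE => vPi; split=> //; apply/line_quad0.
by split; [exact: points_line | split; [exact: points_full | exact/line_quad0]].
Qed.

Lemma quadricP v : v != 0 -> quadric Q <[v]>%VS <-> Q v = 0.
Proof.
move=> v0; split=> [[_ Qv]|Qv]; first exact/line_quad0.
by split; [exact: points_full | exact/line_quad0].
Qed.

(** [Q] is additive on a totally isotropic line and square roots exist, which gives a singular
    point; a second one would contradict [es_ell]. *)
Lemma isotropic_W_line u v : u \in Pi -> v \in Pi -> u != 0 ->
  v \notin <[u]>%VS -> B u v = 0 -> W_lines Q Pi (<[u]> + <[v]>)%VS.
Proof.
move=> uPi vPi u0 vu uv; split; first exact: lines_add2.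
have LPi w : w \in (<[u]> + <[v]>)%VS -> w \in Pi.
  by apply/subvP; rewrite subv_add -!memvE uPi.
have LB w w' : w \in (<[u]> + <[v]>)%VS -> w' \in (<[u]> + <[v]>)%VS -> B w w' = 0.
  move=> /mem_add2 [a [b ->]] /mem_add2 [c [d ->]].
  by rewrite !quadE (polarC Q v u) uv; ring.
have [x xL [x0 Qx]] : exists2 x, x \in (<[u]> + <[v]>)%VS & x != 0 /\ Q x = 0.
  have [Qu|Qu] := eqVneq (Q u) 0.
    by exists u => //; apply/mem_add2; exists 1, 0; vring.
  have [k kE] := sqrt2 char2 (Q v / Q u); exists (k *: u + 1 *: v).
    by apply/mem_add2; exists k, 1.
  split; last by rewrite !quadE uv kE divfK //; ring: char2.
  apply: contraNneq vu => /eqP; rewrite scale1r addrC addr_eq0 => /eqP ->.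
  by rewrite rpredN memvZ // memv_line.
exists <[x]>%VS; split.
  split; first exact: points_line.
  by apply/section_quadricP => //; split=> //; apply: LPi.
move=> p [/pointsP [y [yL y0 ->]] /(section_quadricP y0) [yPi Qy]].
apply/esym/line_eq => //; apply: (es_ell es) => //; [exact: LPi | exact: LB].
Qed.

(** If the singular point [x] were not orthogonal to another vector [y] of the line,
    [y + (Q y / B x y) *: x] would be a second singular point. *)
Lemma W_line_isotropic M u v : W_lines Q Pi M -> u \in M -> v \in M -> B u v = 0.
Proof.
move=> [Ml [p [[pM pS] p_uniq]]]; have [x [xM x0 pE]] := pointsP pM.
have /(section_quadricP x0) [xPi Qx] : section_quadric Q Pi <[x]>%VS by rewrite -pE.
have [y yM yx] : exists2 y, y \in M & y \notin <[x]>%VS.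
  by apply/subvPn/negP => /dimvS; rewrite Ml.1 dim_vline x0.
have MPi w : w \in M -> w \in Pi by exact: (subvP Ml.2).
have xy : B x y = 0.
  apply/eqP; apply: contraT => xy; pose z := y + (Q y / B x y) *: x.
  have z0 : z != 0.
    apply: contraNneq yx => /eqP; rewrite addr_eq0 => /eqP ->.
    by rewrite rpredN memvZ // memv_line.
  have zM : z \in M by rewrite rpredD ?rpredZ.
  have Qz : Q z = 0 by rewrite !quadE Qx mulr0 addr0 (polarC Q y) divfK // addxx2.
  have : p = <[z]>%VS.
    apply: p_uniq; split; first exact: points_line.
    by apply/section_quadricP => //; split=> //; exact: MPi.
  rewrite pE => E; case/negP: yx.
  have -> : y = z - (Q y / B x y) *: x by rewrite /z addrK.
  by rewrite E rpredB ?memv_line // -E memvZ // memv_line.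
rewrite (lines_eq Ml xM yM x0 yx) => /mem_add2 [a [b ->]] /mem_add2 [c [d ->]].
by rewrite !quadE (polarC Q y x) xy; ring.
Qed.

Definition ovoid_pred (O : set {vspace 'rV[F]_6}) (v : 'rV[F]_6) : Prop :=
  [/\ v \in Pi, v != 0 & O <[v]>%VS].

Lemma ovoid_predZ O c v : c != 0 -> ovoid_pred O v -> ovoid_pred O (c *: v).
Proof.
move=> c0 [vPi v0 Ov]; split; first by rewrite rpredZ.
  by rewrite scaler_eq0 negb_or c0.
by rewrite scale_line.
Qed.

Lemma W_ovoid_vectors O : W_ovoid Q Pi O -> ovoid_vectors Q Pi (ovoid_pred O).
Proof.
move=> [OPi OW]; split=> [v [] //|c v|u v [uPi u0 Ou] [vPi v0 Ov] uv|].
- exact: ovoid_predZ.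
- apply: contraT => vu; have M := isotropic_W_line uPi vPi u0 vu uv.
  have [p [_ p_uniq]] := OW _ M.
  have pu : p = <[u]>%VS.
    apply: p_uniq; split=> //; apply: points_line => //.
    by apply/mem_add2; exists 1, 0; vring.
  have pv : p = <[v]>%VS.
    apply: p_uniq; split=> //; apply: points_line => //.
    by apply/mem_add2; exists 0, 1; vring.
  by rewrite -pu pv memv_line in vu.
move=> u v uPi vPi u0 vu uv.
have [p [[/pointsP [w [wM w0 pE]] Op] _]] := OW _ (isotropic_W_line uPi vPi u0 vu uv).
have ow : ovoid_pred O w.
  split=> //; last by rewrite -pE.
  by have [] := pointsP (OPi _ Op) => z [zPi z0 E]; rewrite memvE -pE E -memvE.
have /mem_add2 [a [b wE]] := wM; have [b0|b0] := eqVneq b 0; [left|right].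
  have a0 : a != 0 by apply: contraNneq w0 => a0; rewrite wE a0 b0 !scale0r addr0.
  rewrite -[u](scalerK a0); apply: ovoid_predZ; rewrite ?invr_eq0 //.
  by move: ow; rewrite wE b0 scale0r addr0.
exists (a / b); have -> : v + (a / b) *: u = b^-1 *: w.
  by rewrite wE scalerDr !scalerA mulVf // scale1r addrC mulrC.
by apply: ovoid_predZ; rewrite ?invr_eq0.
Qed.

(** In a frame x, f, u, v of Pi the vectors orthogonal to [x] form the span of x, u, v. The lines
    <x, u> and <x, v> belong to W(q) and span this plane, so it is the only candidate for [xget]. *)
Lemma W_planeE x : x \in Pi -> x != 0 ->
  forall w, w \in W_plane Q Pi <[x]>%VS <-> w \in Pi /\ B x w = 0.
Proof.
move=> xPi x0; have [f fPi xf] := es_nondeg es xPi x0.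
have [u [v [uPi vPi uv [[xu xv] [fu fv]] span]]] := es_frame es xPi fPi xf.
have u0 : u != 0.
  by apply/eqP => u0; move/eqP: uv; rewrite u0 (polar0l Q_quad) eq_sym oner_eq0.
have vu : v \notin <[u]>%VS.
  apply/vlineP => -[k vE]; move/eqP: uv.
  by rewrite vE !quadE mulr0 eq_sym oner_eq0.
have fx := xf; rewrite polarC in fx.
pose P := (<[x]> + (<[u]> + <[v]>))%VS.
have memP w : w \in P <-> w \in Pi /\ B x w = 0.
  split=> [/memv_addP [y /vlineP [a ->] [z /mem_add2 [b [c ->]] ->]]|[wPi xw]].
    by split; [rewrite !rpredD ?rpredZ | rewrite !quadE xu xv; ring].
  have [a [b [c [d wE]]]] := span w wPi.
  move: xw; rewrite wE !quadE xf xu xv !(mulr0, mulr1, addr0, add0r) => ->.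
  rewrite scale0r addr0 -addrA; apply: memv_add; first by rewrite memvZ ?memv_line.
  by apply/mem_add2; exists c, d.
have PPi : (P <= Pi)%VS by apply/subvP => w /memP [].
have dP : \dim P = 3%N.
  rewrite dimv_disjoint_sum ?dim_vline ?x0 ?dim_add2 //.
  apply/eqP; rewrite -subv0; apply/subvP => w.
  rewrite memv_cap memv0 => /andP [/vlineP [k ->] /mem_add2 [b [c E]]].
  have : B f (k *: x) = 0 by rewrite E !quadE fu fv; ring.
  by rewrite !quadE fx mulr1 => ->; rewrite scale0r.
suff -> : W_plane Q Pi <[x]>%VS = P by exact: memP.
apply: xget_subset1.
  split=> // M MW; rewrite -memvE => xM; apply/subvP => y yM; apply/memP.
  split; first exact: (subvP MW.1.2).
  exact: W_line_isotropic MW xM yM.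
have key P' : planes Pi P' ->
    (forall M, W_lines Q Pi M -> (<[x]> <= M)%VS -> (M <= P')%VS) -> P = P'.
  move=> [dP' P'Pi] H; apply/eqP; rewrite eqEdim dP dP' andbT.
  have inP' y : y \in Pi -> y \notin <[x]>%VS -> B x y = 0 ->
      (<[x]> + <[y]> <= P')%VS.
    move=> yPi yx xy; apply: H; last exact: addvSl.
    exact: isotropic_W_line.
  have notx y z : B y z = 1 -> B x z = 0 -> y \notin <[x]>%VS.
    move=> yz xz; apply/vlineP => -[k yE]; move/eqP: yz.
    by rewrite yE !quadE xz mulr0 eq_sym oner_eq0.
  have := inP' u uPi (notx _ _ uv xv) xu.
  have := inP' v vPi _ xv; rewrite (notx v u) // 1?polarC // => /(_ isT).
  by rewrite /P !subv_add => /andP [-> ->] /andP [_ ->].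
by move=> P1 P2 [? ?] [? ?]; rewrite -(key P1) // -(key P2).
Qed.

(** The plane of [x] is the orthogonal of [x] within Pi, so its polar is the span of [x] and [L]. *)
Lemma conicP x y l : x \in Pi -> x != 0 -> y \in Pi -> l \in L -> y + l != 0 ->
  conic Q Pi <[x]>%VS <[(y + l)%R]>%VS <-> y \in <[x]>%VS /\ Q (y + l) = 0.
Proof.
move=> xPi x0 yPi lL yl0; have WP := W_planeE xPi x0.
split=> [[[_ perp] /(quadricP yl0) Qyl]|[/vlineP [k yE] Qyl]].
  split=> //; have [f fPi xf] := es_nondeg es xPi x0.
  have [u [v [uPi vPi uv [[xu xv] [fu fv]] span]]] := es_frame es xPi fPi xf.
  have H w : w \in Pi -> B x w = 0 -> B y w = 0.
    move=> wPi xw; have := perp (y + l) w (memv_line _) ((WP w).2 (conj wPi xw)).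
    by rewrite !quadE (polarC Q l) (es_perp es wPi lL) addr0.
  have [a [b [c [d yE]]]] := span y yPi.
  have := H x xPi; rewrite polarvv // => /(_ erefl).
  have := H u uPi xu; have := H v vPi xv.
  rewrite yE !quadE (polarC Q f x) (polarC Q u x) (polarC Q v x) (polarC Q v u).
  rewrite xf xu xv fu fv uv !(mulr0, mulr1, addr0, add0r) => -> -> ->.
  by rewrite !scale0r !addr0 memvZ // memv_line.
split; last exact/quadricP.
split=> [|v w /vlineP [c ->] /WP [wPi xw]]; first exact: points_full.
by rewrite yE !quadE (polarC Q l) (es_perp es wPi lL) xw; ring.
Qed.

(** Here Q x = Q l and [L] is anisotropic, so l = 0 exactly when [x] is singular: the conics
    contribute the points with nonzero [l], the section those with l = 0. *)
Lemma hyperovalP O x l : O `<=` points Pi -> x \in Pi -> l \in L -> x + l != 0 -> Q (x + l) = 0 ->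
  hyperoval_of Q Pi O <[(x + l)%R]>%VS <->
  (l != 0 /\ ovoid_pred O x) \/ (l = 0 /\ ~ ovoid_pred O x).
Proof.
move=> OPi xPi lL xl0 Qxl.
have QxQl : Q x = Q l by apply/eqP; rewrite -quad_es_eq0 // Qxl.
split=> [[[p [Op nSp] H]|[/(section_quadricP xl0) [xlPi _] nO]]|[[l0 [_ x0 Ox]]|[l0 nO]]].
- left; have [y [yPi y0 pE]] := pointsP (OPi _ Op); subst p.
  have [/vlineP [k xE] _] := (conicP yPi y0 xPi lL xl0).1 H.
  have Qy : Q y <> 0 by move=> Qy; apply: nSp; apply/section_quadricP.
  have k0 : k != 0.
    apply: contraNneq xl0 => k0; rewrite k0 scale0r in xE.
    by rewrite xE add0r (es_aniso es lL) // -QxQl xE quad0.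
  split; first apply/eqP => l0.
    move/eqP: QxQl; rewrite xE l0 quadZ // quad0 // mulf_eq0 sqrf_eq0 (negPf k0) /=.
    by move/eqP.
  by rewrite xE; apply: ovoid_predZ.
- right; have l0 : l = 0.
    by apply: es_disjoint => //; rewrite -(addKr x l) rpredD // rpredN.
  by split=> //; rewrite l0 addr0 in nO; case.
- left; exists <[x]>%VS; last first.
    by apply/(conicP xPi x0 xPi lL xl0); rewrite memv_line.
  split=> // /(section_quadricP x0) [_ Qx]; case/eqP: l0; apply: (es_aniso es) => //.
  by rewrite -QxQl.
right; rewrite l0 addr0 in xl0 Qxl *; split; first exact/section_quadricP.
by move=> Ox; apply: nO.
Qed.

End Geometry.

(** * Extending similarities of Pi to the whole space *)

Section Extension.
Variables (F : finFieldType) (Q : 'rV[F]_6 -> F) (Pi L : {vspace 'rV[F]_6}).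
Local Notation B := (polar_form Q).
Hypotheses (char2 : (1 + 1 : F) = 0) (es : elliptic_section Q Pi L).
Let Q_quad := es_quad es.
Let quadE := quadE char2 Q_quad.
Local Notation ovoid_pred := (ovoid_pred Pi).

Lemma hyperoval_points O : hyperoval_of Q Pi O `<=` points fullv.
Proof. by move=> p [[q _ [_ []]]|[[_ []]]]. Qed.

Lemma hyperoval_similar O1 O2 s g c : O1 `<=` points Pi -> O2 `<=` points Pi ->
  semilinear fullv s g -> (forall v, Q (g v) = c * s (Q v)) ->
  (forall x, x \in Pi -> g x \in Pi) -> (forall l, l \in L -> g l \in L) ->
  (forall x, x \in Pi -> ovoid_pred O1 x <-> ovoid_pred O2 (g x)) ->
  forall v, v != 0 -> Q v = 0 ->
    hyperoval_of Q Pi O1 <[v]>%VS <-> hyperoval_of Q Pi O2 <[g v]>%VS.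
Proof.
move=> O1Pi O2Pi g_semi gQ gPi gL gO v v0 Qv; have s_aut := semi_aut g_semi.
have [x [l [xPi lL vE]]] := es_decomp es v; subst v.
have gxl : g (x + l) = g x + g l by rewrite (semiD g_semi) ?memvf.
have Qg : Q (g x + g l) = 0 by rewrite -gxl gQ Qv (aut0 s_aut) mulr0.
have gv0 : g x + g l != 0 by rewrite -gxl (semi_eq0 g_semi) ?memvf.
rewrite gxl.
apply: iff_trans (hyperovalP char2 es O1Pi xPi lL v0 Qv) _.
apply: iff_sym; apply: iff_trans (hyperovalP char2 es O2Pi (gPi _ xPi) (gL _ lL) gv0 Qg) _.
have gl0 : (g l == 0) = (l == 0) by rewrite (semi_eq0 g_semi) ?memvf.
have gO' := gO x xPi.
split=> [[[]|[]]|[[]|[]]].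
- by rewrite gl0 => l0 /gO'; left.
- by move=> /eqP; rewrite gl0 => /eqP l0 H; right; split=> // /gO'.
- by rewrite -gl0 => l0 /gO'; left.
by move=> /eqP; rewrite -gl0 => /eqP l0 H; right; split=> // /gO'.
Qed.

(** The only obstruction is whether Q m * Q u has the form z^2 + z, and field automorphisms preserve
    that. With [m'] a multiple of [m] such that Q m' = c * s (Q m), [plane_value] finds [u'] with B
    m' u' = c and Q u' = c * s (Q u). *)
Lemma plane_similarity s c : field_automorphism s -> c != 0 ->
  exists h, semilinear L s h /\ forall l, l \in L -> Q (h l) = c * s (Q l).
Proof.
move=> s_aut c0; have [m mL m0] := es_nonempty es.
have [u uL [mu span]] := es_pair es mL m0.
have um := mu; rewrite polarC in um.
have [t ts st] := aut_bij s_aut.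
have s_AS x : artin_schreier (s x) = artin_schreier x.
  apply/artin_schreierP/artin_schreierP => -[z zE].
    by exists (t z); apply: (can_inj ts); rewrite zE (autD s_aut) (autX s_aut) st.
  by exists (s z); rewrite zE (autD s_aut) (autX s_aut).
have Qm : Q m != 0 by apply: contra_neq m0 => /(es_aniso es mL).
have QmuI : ~~ artin_schreier (Q m * Q u).
  apply: anisotropic_plane => // a; apply/eqP => /(es_aniso es (rpredD uL (rpredZ a mL))) H.
  move/eqP: mu; rewrite -[u](addrK (a *: m)) H sub0r -scaleNr polarZr //.
  by rewrite polarvv // mulr0 eq_sym oner_eq0.
have [k kE] := sqrt2 char2 (c * s (Q m) / Q m).
have sQm : s (Q m) != 0 by rewrite (aut_eq0 s_aut).
have k0 : k != 0 by rewrite -sqrf_eq0 kE !mulf_neq0 ?invr_eq0.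
pose m' := k *: m; have Qm' : Q m' = c * s (Q m) by rewrite /m' quadZ // kE divfK.
have m'u : B m' (k^-1 *: u) = 1 by rewrite /m' !quadE mu mulr1 divff.
have [|||a aE] := @plane_value _ _ Q char2 Q_quad m' (k^-1 *: u) c (c * s (Q u)) m'u.
- rewrite !quadZ //; suff -> : k ^+ 2 * Q m * (k^-1 ^+ 2 * Q u) = Q m * Q u by [].
  by field.
- exact: c0.
- rewrite Qm'; have -> : c * s (Q u) * (c * s (Q m)) / c ^+ 2 = s (Q m) * s (Q u) by field.
  by rewrite -(autM s_aut) s_AS.
set u' := _ + _ in aE.
have m'u' : B m' u' = c by apply: plane_value_polar.
have m'0 : m' != 0 by rewrite /m' scaler_eq0 negb_or k0.
have m'L : m' \in L by rewrite rpredZ.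
have u'L : u' \in L by rewrite rpredD ?rpredZ.
clearbody u' m'.
(* [B l u] and [B l m] are the coordinates of [l] with respect to [m] and [u]. *)
pose h l := s (B l u) *: m' + s (B l m) *: u'.
have hE x y : h (x *: m + y *: u) = s x *: m' + s y *: u'.
  rewrite /h !quadE mu um; congr (s _ *: _ + s _ *: _); ring.
exists h; split; first split=> //.
- by move=> v _; rewrite rpredD ?rpredZ.
- by move=> v w _ _; rewrite /h !quadE !(autD s_aut) !scalerDl addrACA.
- by move=> d v _; rewrite /h !quadE !(autM s_aut) -!scalerA -scalerDr.
- move=> v /span [x [y ->]]; rewrite hE => H.
  have : B m' (s x *: m' + s y *: u') = 0 by rewrite H (polar0r Q_quad).
  rewrite !quadE m'u' mulr0 add0r => /eqP; rewrite mulf_eq0 (negPf c0) orbF => sy.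
  move: H => /eqP; rewrite (eqP sy) scale0r addr0 scaler_eq0 (negPf m'0) orbF.
  by move: sy; rewrite !(aut_eq0 s_aut) => /eqP -> /eqP ->; vring.
move=> v /span [x [y ->]]; rewrite hE !quadE Qm' aE m'u' mu.
by rewrite !(autD s_aut) mulr1 !(autM s_aut); ring.
Qed.

Lemma similarity_extension s g c : semilinear Pi s g -> c != 0 ->
  (forall x, x \in Pi -> Q (g x) = c * s (Q x)) ->
  exists G, [/\ semilinear fullv s G, (forall v, Q (G v) = c * s (Q v)),
    (forall x, x \in Pi -> G x = g x)
    & forall l, l \in L -> G l \in L].
Proof.
move=> g_semi c0 gQ; have s_aut := semi_aut g_semi.
have [h [h_semi hQ]] := plane_similarity s_aut c0.
have decomp v : exists xl, [/\ xl.1 \in Pi, xl.2 \in L & v = xl.1 + xl.2].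
  by have [x [l [xPi lL vE]]] := es_decomp es v; exists (x, l).
have [d dE] := choice decomp.
pose G v := g (d v).1 + h (d v).2.
have GE x l : x \in Pi -> l \in L -> G (x + l) = g x + h l.
  move=> xPi lL; have [x'Pi l'L E] := dE (x + l).
  by have [E1 E2] := es_uniq es xPi lL x'Pi l'L E; rewrite /G -E1 -E2.
have gPi x : x \in Pi -> g x \in Pi by exact: (semi_mem g_semi).
have hL l : l \in L -> h l \in L by exact: (semi_mem h_semi).
exists G; split.
- split=> // [v _|v w _ _|k v _|v _]; first exact: memvf.
  + have [xPi lL vE] := dE v; have [yPi mL wE] := dE w.
    rewrite {1}vE {1}wE addrACA GE ?rpredD // (semiD g_semi) // (semiD h_semi) //.
    by rewrite addrACA.
  + have [xPi lL vE] := dE v.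
    rewrite {1}vE scalerDr GE ?rpredZ // (semiZ g_semi) // (semiZ h_semi) //.
    by rewrite -scalerDr.
  have [xPi lL vE] := dE v; rewrite {1}vE GE // => H.
  have [H1 H2] := es_uniq es (gPi _ xPi) (hL _ lL) (mem0v _) (mem0v _) (etrans H (esym (addr0 0))).
  by rewrite vE (semi_inj g_semi xPi H1) (semi_inj h_semi lL H2) addr0.
- move=> v; have [xPi lL vE] := dE v; rewrite {1}vE GE // (quad_es es) ?gPi ?hL //.
  by rewrite gQ // hQ // {3}vE (quad_es es) // (autD s_aut) mulrDr.
- by move=> x xPi; rewrite -[X in G X]addr0 GE ?mem0v // (semi0 h_semi) addr0.
by move=> l lL; rewrite -[X in G X]add0r GE ?mem0v // (semi0 g_semi) add0r hL.
Qed.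

Lemma section_isomorphism_extends (dimPi : \dim Pi = 4%N) O1 O2 f :
  O1 `<=` points Pi -> O2 `<=` points Pi -> collineation Pi f ->
  f @` section_quadric Q Pi = section_quadric Q Pi -> f @` O1 = O2 ->
  quadric_isomorphic Q (hyperoval_of Q Pi O1) (hyperoval_of Q Pi O2).
Proof.
move=> O1Pi O2Pi f_coll fS fO.
have [|s [g [g_semi fg]]] := fundamental_theorem_projective_geometry char2 _ f_coll.
  by rewrite dimPi.
have s_aut := semi_aut g_semi.
have g0 v : v \in Pi -> v != 0 -> g v != 0 by move=> vPi; rewrite (semi_eq0 g_semi).
have fT := collineation_image f_coll fg.
have g_singular v : v \in Pi -> Q (g v) = 0 <-> Q v = 0.
  move=> vPi; have [->|v0] := eqVneq v 0.
    by rewrite (semi0 g_semi) quad0.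
  have gvPi := semi_mem g_semi vPi.
  have := fT _ _ (@subIsetl _ _ _) fS v vPi v0.
  have := section_quadricP es (g0 _ vPi v0).
  have := section_quadricP es v0.
  tauto.
have nondeg v : v \in Pi -> v != 0 -> exists2 w, w \in Pi & B v w != 0.
  move=> vPi v0; have [w wPi vw] := es_nondeg es vPi v0.
  by exists w; rewrite ?vw ?oner_eq0.
have [c c0 gQ] := semisimilarity char2 Q_quad g_semi nondeg (es_sing es) g_singular.
have [G [G_semi GQ Gg GL]] := similarity_extension g_semi c0 gQ.
exists (line_map G); split; first exact: line_map_collineation G_semi.
  apply: (line_map_image G_semi); try by move=> p [].
  move=> v _ v0; have Gv0 : G v != 0 by rewrite (semi_eq0 G_semi) ?memvf.
  rewrite !(quadricP es) // GQ; split=> [->|/eqP].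
    by rewrite (aut0 s_aut) mulr0.
  by rewrite mulf_eq0 (negPf c0) (aut_eq0 s_aut) => /eqP.
apply: (line_map_image G_semi); try exact: hyperoval_points.
move=> v _ v0; have [Qv|Qv] := eqVneq (Q v) 0.
  apply: (hyperoval_similar O1Pi O2Pi G_semi GQ) => //.
    by move=> x xPi; rewrite Gg // (semi_mem g_semi).
  move=> x xPi; rewrite Gg //; have [->|x0] := eqVneq x 0.
    by rewrite (semi0 g_semi); split=> -[_ /eqP].
  have gO := fT _ _ O1Pi fO x xPi x0.
  split=> -[_ _ /gO Ox]; split=> //; rewrite ?(semi_mem g_semi) ?g0 //.
have nH O w : w != 0 -> Q w != 0 -> ~ hyperoval_of Q Pi O <[w]>%VS.
  move=> w0 /eqP Qw; case=> [[q _ [_ Hq]]|[[_ Hq] _]];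
  by apply: Qw; apply/(quadricP es w0).
split=> [/nH|/nH]; first by case.
rewrite (semi_eq0 G_semi) ?memvf // GQ mulf_eq0 (negPf c0) (aut_eq0 s_aut).
by case.
Qed.
End Extension.

(** * Ovoids of W(q) *)

Section AffineCount.
Variable F : finFieldType.
Implicit Types t y z : F.

Lemma sum_unique (P : F -> bool) : (exists! t, P t) -> (\sum_t P t = 1)%N.
Proof.
move=> [t [Pt uniq_t]]; rewrite (bigD1 t) //= Pt big1 // => t' t't.
by case Pt': (P t') => //; case/eqP: t't; rewrite (uniq_t t').
Qed.

Lemma sum_at_most_one (P : F -> bool) t t' :
  (\sum_t P t = 1)%N -> P t -> P t' -> t = t'.
Proof.
move=> S1 Pt Pt'; apply/eqP; apply: contraT => tt'; move: S1.
by rewrite (bigD1 t) //= Pt (bigD1 t') 1?eq_sym //= Pt'.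
Qed.

(* The affine points off the hyperplane [x^perp] of a symplectic space: [A] is
   counted along the lines in a fixed direction, then in the planes of fixed
   height by means of the lines through [(a, 0, 0)]. *)
Lemma affine_count (A : F -> F -> F -> bool) :
  (forall a y1 y2 z1 z2, (z1, z2) != (0, 0) ->
    exists! t, A (a + t * (z1 * y2 + z2 * y1)) (y1 + t * z1) (y2 + t * z2)) ->
  (\sum_a A a 0%R 0%R = 1)%N.
Proof.
move=> H.
(* The lines in direction z = (0, 1) through the points (a, y1, 0) partition the space, and each
   carries one point of [A]. *)
have count_all : (\sum_a \sum_y1 \sum_y2 A a y1 y2 = #|F| * #|F|)%N.
  transitivity (\sum_(y1 : F) \sum_(a : F) 1)%N; last first.
    by rewrite !sum_nat_const muln1.
  rewrite exchange_big; apply: eq_bigr => y1 _ /=.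
  rewrite exchange_big /=.
  transitivity (\sum_(t : F) \sum_(a : F) A (a + t * y1)%R y1 t)%N.
    apply: eq_bigr => t _.
    rewrite [LHS](reindex_inj (addIr (t * y1))) //.
  rewrite exchange_big; apply: eq_bigr => a _ /=.
  have [|t [At uniq_t]] := H a y1 0 0 1.
    by rewrite xpair_eqE oner_eq0 andbF.
  apply: sum_unique; exists t; split.
    by move: At; rewrite !(mul0r, mul1r, mulr0, mulr1, add0r, addr0).
  by move=> t' At'; apply: uniq_t; rewrite !(mul0r, mul1r, mulr0, mulr1, add0r, addr0).
(* The q + 1 lines through (a, 0, 0) stay at height [a] and cover that plane; counting [A] along
   them counts (a, 0, 0) itself q + 1 times. *)
have count_plane a : (\sum_y1 \sum_y2 A a y1 y2 + #|F| * A a 0%R 0%R = 1 + #|F|)%N.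
  have line z1 z2 : (z1, z2) != (0, 0) -> (\sum_t A a (t * z1)%R (t * z2)%R = 1)%N.
    move=> z0; have [t [At uniq_t]] := H a 0 0 z1 z2 z0.
    apply: sum_unique; exists t; split.
      by move: At; rewrite !(mulr0, add0r, addr0).
    by move=> t' At'; apply: uniq_t; rewrite !(mulr0, add0r, addr0).
  rewrite (bigD1 0) //=; have -> : (\sum_y2 A a 0%R y2 = 1)%N.
    rewrite -(line 0 1); last by rewrite xpair_eqE oner_eq0 andbF.
    by apply: eq_bigr => t _; rewrite mulr0 mulr1.
  rewrite -addnA; congr (_ + _)%N.
  have -> : (\sum_(y1 | y1 != 0%R) \sum_y2 A a y1 y2 =
             \sum_(s : F) \sum_(t | t != 0%R) A a t (t * s)%R)%N.
    rewrite [RHS]exchange_big /=; apply: eq_bigr => t t0.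
    by rewrite [LHS](reindex_inj (mulfI t0)).
  have -> : (#|F| * A a 0%R 0%R = \sum_(s : F) A a 0%R 0%R)%N.
    by rewrite sum_nat_const.
  rewrite -big_split /= -[RHS]muln1 -sum_nat_const; apply: eq_bigr => s _.
  have s1 : (1 : F, s) != (0, 0) by rewrite xpair_eqE oner_eq0.
  rewrite -(line 1 s s1) [RHS](bigD1 0) //= !mul0r addnC; congr (_ + _)%N.
  by apply: eq_bigr => t _; rewrite mulr1.
have F0 : (0 < #|F|)%N by apply/card_gt0P; exists 0.
(* Summing over the q heights gives q^2 + q S = q (1 + q) for the sum S sought. *)
have : (\sum_a (\sum_y1 \sum_y2 A a y1 y2 + #|F| * A a 0%R 0%R) =
        \sum_(a : F) (1 + #|F|))%N by apply: eq_bigr => a _.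
rewrite big_split /= count_all -big_distrr /= sum_nat_const mulnDr muln1 addnC.
by move/addIn => /eqP; rewrite -[X in _ == X]muln1 eqn_pmul2l // => /eqP.
Qed.

End AffineCount.

Section NoThreeCollinear.
Variables (F : finFieldType) (Q : 'rV[F]_6 -> F) (Pi L : {vspace 'rV[F]_6}).
Local Notation B := (polar_form Q).
Hypotheses (char2 : (1 + 1 : F) = 0) (es : elliptic_section Q Pi L).
Let Q_quad := es_quad es.
Let quadE := quadE char2 Q_quad.
Variable o : 'rV[F]_6 -> Prop.
Hypothesis ov : ovoid_vectors Q Pi o.

Lemma ovoid_polar u v : o u -> o v -> v \notin <[u]>%VS -> B u v != 0.
Proof. by move=> ou ove; apply: contraNneq => /(ov_uniq ov ou ove). Qed.

(** The vectors with B x w = 1 have affine coordinates (b, y1, y2). As [x] is on the ovoid, no other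
    point of x^perp is, so an isotropic line through such a vector has its ovoid point among them;
    [affine_count] then leaves one ovoid point on the secant besides [x]. *)
Lemma ovoid_secant x y a a' : o x -> y \in Pi -> B x y = 1 ->
  o (y + a *: x) -> o (y + a' *: x) -> a = a'.
Proof.
move=> ox yPi xy oa oa'; have [xPi x0] := ov_mem ov ox.
have [u [v [uPi vPi uv [[xu xv] [yu yv]] _]]] := es_frame es xPi yPi xy.
pose w b y1 y2 := y + b *: x + y1 *: u + y2 *: v.
have wPi b y1 y2 : w b y1 y2 \in Pi by rewrite !rpredD ?rpredZ.
have xw b y1 y2 : B x (w b y1 y2) = 1 by rewrite /w !quadE xy xu xv; ring.
pose A b y1 y2 := `[< o (w b y1 y2) >].
suff count : (\sum_b A b 0%R 0%R = 1)%N.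
  by apply: (sum_at_most_one count); apply/asboolP; rewrite /w !scale0r !addr0.
apply: affine_count => b y1 y2 z1 z2 z0.
(* [k] is the coefficient that makes [d] orthogonal to [w b y1 y2]. *)
pose k := z1 * y2 + z2 * y1; pose d := k *: x + z1 *: u + z2 *: v.
have wE t : w (b + t * k) (y1 + t * z1) (y2 + t * z2) = w b y1 y2 + t *: d.
  by rewrite /w /d; vring.
have dPi : d \in Pi by rewrite !rpredD ?rpredZ.
have vu := uv; rewrite polarC in vu.
have xd : B x d = 0 by rewrite /d !quadE xu xv; ring.
have d0 : d \notin <[x]>%VS.
  apply/vlineP => -[m dE]; case/negP: z0; rewrite xpair_eqE.
  have : B v d = 0 by rewrite dE !quadE (polarC Q v) xv mulr0.
  have : B u d = 0 by rewrite dE !quadE (polarC Q u) xu mulr0.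
  rewrite /d !quadE (polarC Q u x) (polarC Q v x) xu xv uv vu.
  by rewrite !(mulr0, mulr1, addr0, add0r) => -> ->; rewrite eqxx.
have dw : B d (w b y1 y2) = 0.
  rewrite /d /w !quadE (polarC Q u y) (polarC Q v y) (polarC Q u x) (polarC Q v x).
  rewrite xy xu xv yu yv uv vu /k; by ring: char2.
have wd c : B x (w b y1 y2 + c *: d) = 1.
  by rewrite (polarDr Q_quad) xw (polarZr Q_quad) xd mulr0 addr0.
have nw c : w b y1 y2 + c *: d \notin <[d]>%VS.
  apply/vlineP => -[m E]; have := wd c; rewrite E (polarZr Q_quad) xd mulr0 => /eqP.
  by rewrite eq_sym oner_eq0.
have nod : ~ o d by move=> /(ov_uniq ov ox) /(_ xd); apply/negP.
have w_nd : w b y1 y2 \notin <[d]>%VS by have := nw 0; rewrite scale0r addr0.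
have [//|[t ot]] := ov_meet ov dPi (wPi _ _ _) (notin_line0 d0) w_nd dw.
exists t; split; first by apply/asboolP; rewrite wE.
move=> t' /asboolP; rewrite wE => ot'.
have /vlineP [m E] : w b y1 y2 + t' *: d \in <[(w b y1 y2 + t *: d)%R]>%VS.
  apply: (ov_uniq ov) => //; move: (w b y1 y2) dw => w' dw.
  by rewrite (polarDl Q_quad) !(polarDr Q_quad) !(polarZl Q_quad) !(polarZr Q_quad)
    (polarC Q w' d) dw !polarvv //; ring.
have m1 : m = 1 by have := wd t'; rewrite E polarZr // wd mulr1.
apply/eqP; rewrite -subr_eq0; have /eqP : (t - t') *: d = 0.
  have := E; rewrite m1 scale1r => /addrI E'.
  by rewrite scalerBl E' subrr.
by rewrite scaler_eq0 (negPf (notin_line0 d0)) orbF.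
Qed.

Lemma no_three_collinear x y a b : o x -> o y -> y \notin <[x]>%VS ->
  a != 0 -> b != 0 -> ~ o (a *: x + b *: y).
Proof.
move=> ox oy yx a0 b0 oz; have xy := ovoid_polar ox oy yx.
have [yPi y0] := ov_mem ov oy.
pose k := (B x y)^-1; have k0 : k != 0 by rewrite invr_eq0.
have E : (b^-1 * k) *: (a *: x + b *: y) = k *: y + (b^-1 * k * a) *: x.
  by rewrite scalerDr !scalerA addrC mulrAC mulVf // mul1r.
have := @ovoid_secant x (k *: y) 0 (b^-1 * k * a) ox.
rewrite rpredZ // polarZr // mulVf // scale0r addr0 -E => /(_ isT erefl).
move=> /(_ (ov_scale ov k0 oy)) H.
have bk0 : b^-1 * k != 0 by rewrite mulf_neq0 // invr_eq0.
have /eqP := H (ov_scale ov bk0 oz).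
by rewrite eq_sym mulf_eq0 (negPf bk0) (negPf a0).
Qed.

End NoThreeCollinear.

Section OvoidFacts.
Variables (F : finFieldType) (Q : 'rV[F]_6 -> F) (Pi L : {vspace 'rV[F]_6}).
Local Notation B := (polar_form Q).
Hypotheses (char2 : (1 + 1 : F) = 0) (es : elliptic_section Q Pi L).
Let Q_quad := es_quad es.
Let quadE := quadE char2 Q_quad.
Implicit Types (o : 'rV[F]_6 -> Prop) (x y a b w : 'rV[F]_6).

Lemma polar_notin x y w : B x w = 0 -> B y w != 0 -> y \notin <[x]>%VS.
Proof.
by move=> xw; apply: contra => /vlineP [k ->]; rewrite !quadE xw mulr0.
Qed.

Lemma perp_point x : x \in Pi -> x != 0 ->
  exists2 y, y \in Pi & B x y = 0 /\ y \notin <[x]>%VS.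
Proof.
move=> xPi x0; have [f fPi xf] := es_nondeg es xPi x0.
have [u [v [uPi vPi uv [[xu xv] _] _]]] := es_frame es xPi fPi xf.
exists u => //; split=> //; apply: (polar_notin xv); rewrite uv; exact: oner_neq0.
Qed.

Lemma perp_singular x : x \in Pi -> x != 0 ->
  exists2 y, y \in Pi & [/\ B x y = 0, y != 0 & Q y = 0].
Proof.
move=> xPi x0; have [Qx|Qx] := eqVneq (Q x) 0.
  by exists x => //; split=> //; rewrite polarvv.
have [y yPi [xy yx]] := perp_point xPi x0.
have [k kE] := sqrt2 char2 (Q y / Q x).
exists (y + k *: x); first by rewrite rpredD ?rpredZ.
split; first by rewrite !quadE xy mulr0 addr0.
  apply: contraNneq yx => /eqP; rewrite addr_eq0 => /eqP ->.
  by rewrite rpredN memvZ // memv_line.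
by rewrite !quadE kE divfK // (polarC Q y) xy; ring: char2.
Qed.

Section OneOvoid.
Variable o : 'rV[F]_6 -> Prop.
Hypothesis ov : ovoid_vectors Q Pi o.

Lemma ov_neq x y : o x -> ~ o y -> y != 0 -> y \notin <[x]>%VS.
Proof.
move=> ox oy y0; apply/vlineP => -[k yE]; apply: oy; rewrite yE.
by apply: (ov_scale ov) => //; apply: contraNneq y0 => k0; rewrite yE k0 scale0r.
Qed.

Lemma ov_through x y : x \in Pi -> y \in Pi -> ~ o x -> x != 0 ->
  y \notin <[x]>%VS -> B x y = 0 -> exists t, o (y + t *: x).
Proof. by move=> xPi yPi ox x0 yx xy; have [] := ov_meet ov xPi yPi x0 yx xy. Qed.

(** If [y] were off the ovoid, an isotropic line through [y] would have an ovoid point, which is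
    singular and so, by ellipticity, equal to [y]. *)
Lemma ov_all_singular : (forall x, o x -> Q x = 0) ->
  forall y, y \in Pi -> y != 0 -> Q y = 0 -> o y.
Proof.
move=> oQ y yPi y0 Qy; have [w wPi [yw wy]] := perp_point yPi y0.
have [//|[t ot]] := ov_meet ov yPi wPi y0 wy yw.
have wtPi : w + t *: y \in Pi by rewrite rpredD ?rpredZ.
have : w + t *: y \in <[y]>%VS.
  by apply: (es_ell es) => //; [exact: oQ | rewrite !quadE yw mulr0 addr0].
move=> H; case/negP: wy; rewrite -(addrK (t *: y) w) rpredB // memvZ //.
exact: memv_line.
Qed.

(** Every point of Pi is orthogonal to a singular point, and orthogonal points of the ovoid
    coincide. *)
Lemma ov_singular_all : (forall y, y \in Pi -> y != 0 -> Q y = 0 -> o y) ->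
  forall x, o x -> Q x = 0.
Proof.
move=> Qo x ox; have [xPi x0] := ov_mem ov ox.
have [y yPi [xy y0 Qy]] := perp_singular xPi x0.
have /vlineP [k yE] := ov_uniq ov ox (Qo _ yPi y0 Qy) xy.
move/eqP: Qy; rewrite yE quadZ // mulf_eq0 sqrf_eq0 => /orP [/eqP k0|/eqP //].
by rewrite yE k0 scale0r eqxx in y0.
Qed.

Hypothesis o_nonsingular : exists2 x, o x & Q x != 0.

Lemma ov_missing : exists2 y, y \in Pi & [/\ y != 0, Q y = 0 & ~ o y].
Proof.
apply: contrapT => H; have [x ox /eqP] := o_nonsingular; apply.
apply: ov_singular_all ox => y yPi y0 Qy; apply: contrapT => oy.
by apply: H; exists y.
Qed.

(** A singular [y] orthogonal to the nonsingular ovoid vector [z] is off the ovoid. On an isotropic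
    line through [y] not contained in z^perp, the ovoid point differs from [y], so it is
    nonsingular, and is not orthogonal to [z], so it differs from [z]. *)
Lemma ov_second x : x \in Pi -> exists2 w, o w & Q w != 0 /\ w \notin <[x]>%VS.
Proof.
move=> xPi; have [z oz Qz] := o_nonsingular.
have [zx|zx] := boolP (z \in <[x]>%VS); last by exists z.
have [zPi z0] := ov_mem ov oz.
rewrite (_ : <[x]>%VS = <[z]>%VS); last first.
  by rewrite (line_eq z0 zx).
have [y yPi [zy y0 Qy]] := perp_singular zPi z0.
have yz : y \notin <[z]>%VS.
  apply/vlineP => -[k yE]; move/eqP: Qy; rewrite yE quadZ // mulf_eq0.
  rewrite (negPf Qz) orbF sqrf_eq0 => /eqP k0.
  by rewrite yE k0 scale0r eqxx in y0.
have oy : ~ o y by move=> oy; case/negP: yz; exact: (ov_uniq ov).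
have [f fPi yf] := es_nondeg es yPi y0.
have [u [v [uPi vPi uv [[yu yv] _] span]]] := es_frame es yPi fPi yf.
have [w wPi [yw wy zw]] : exists2 w, w \in Pi & [/\ B y w = 0, w \notin <[y]>%VS & B z w != 0].
  have uy : u \notin <[y]>%VS by apply: (polar_notin yv); rewrite uv oner_neq0.
  have vy : v \notin <[y]>%VS.
    by apply: (polar_notin yu); rewrite polarC uv oner_neq0.
  have [zu|zu] := eqVneq (B z u) 0; last by exists u.
  have [zv|zv] := eqVneq (B z v) 0; last by exists v.
  have [p [q [r [s zE]]]] := span z zPi; case/negP: yz.
  have fy := yf; rewrite polarC in fy.
  have q0 : q = 0.
    by have := zy; rewrite polarC zE !quadE yf yu yv !(mulr0, mulr1, addr0, add0r).
  have vu := uv; rewrite polarC in vu.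
  have [uf vf] : B u f = B f u /\ B v f = B f v by split; exact: polarC.
  have s0 : s = 0.
    have := zu; rewrite zE q0 !quadE yu vu.
    by rewrite !(mul0r, mulr0, mulr1, addr0, add0r).
  have r0 : r = 0.
    have := zv; rewrite zE q0 !quadE yv uv.
    by rewrite !(mul0r, mulr0, mulr1, addr0, add0r).
  move: zE z0; rewrite q0 s0 r0 !scale0r !addr0 => zE z0.
  have p0 : p != 0 by apply: contraNneq z0 => p0; rewrite zE p0 scale0r.
  by rewrite zE scale_line // memv_line.
have [t ot] := ov_through yPi wPi oy y0 wy yw.
exists (w + t *: y) => //; split.
  apply: contraNneq wy => Qwt; rewrite -(addrK (t *: y) w) rpredB //.
    apply: (es_ell es) => //; first by rewrite rpredD ?rpredZ.
    by rewrite !quadE yw mulr0 addr0.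
  by rewrite memvZ // memv_line.
apply: (@polar_notin z _ z); first by rewrite polarvv.
by rewrite !quadE (polarC Q y) zy (polarC Q w) mulr0 addr0.
Qed.

End OneOvoid.

(* [x^perp] would be contained in [{Q = B(a, .)^2}], where [Q] is additive. *)
Lemma ov_contained_unique o1 o2 a : ovoid_vectors Q Pi o1 -> ovoid_vectors Q Pi o2 ->
  (forall x, o1 x -> Q x = B a x ^+ 2) -> (forall x, o2 x -> Q x = B a x ^+ 2) ->
  forall x, o1 x -> o2 x.
Proof.
move=> ov1 ov2 o1a o2a x o1x; apply: contrapT => o2x.
have [xPi x0] := ov_mem ov1 o1x; have [f fPi xf] := es_nondeg es xPi x0.
have [u [v [uPi vPi uv [[xu xv] _] span]]] := es_frame es xPi fPi xf.
(* The isotropic line <x, w> has a point of [o2]; [Q] and B(a, .)^2 agree there and at [x], and both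
   are additive on the line, so they agree at [w]. *)
have key w z : w \in Pi -> B x w = 0 -> B x z = 0 -> B w z != 0 -> Q w = B a w ^+ 2.
  move=> wPi xw xz wz.
  have [t /o2a] := ov_through ov2 xPi wPi o2x x0 (polar_notin xz wz) xw.
  rewrite !quadE (o1a _ o1x) (polarC Q w) xw => E.
  rewrite -[LHS]addr0 -(addxx2 char2 (t ^+ 2 * B a x ^+ 2)) addrA.
  by have := congr1 (fun e => e + t ^+ 2 * B a x ^+ 2) E; rewrite mulr0 addr0 => ->; ring: char2.
have Qu : Q u = B a u ^+ 2 by apply: (key _ v) => //; rewrite uv oner_neq0.
have Qv : Q v = B a v ^+ 2 by apply: (key _ u) => //; rewrite polarC uv oner_neq0.
have : Q (u + v) = B a (u + v) ^+ 2.
  apply: (key _ v); rewrite ?rpredD //; first by rewrite !quadE xu xv addr0.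
  by rewrite !quadE uv addr0 oner_neq0.
rewrite !quadE Qu Qv uv => E; move/eqP: (oner_neq0 F); case.
rewrite -[LHS](addKr (B a u ^+ 2 + B a v ^+ 2)) E; ring: char2.
Qed.

End OvoidFacts.

(** * Isometries of Pi and ovoids contained in quadrics *)

Section Containment.
Variables (F : finFieldType) (Q : 'rV[F]_6 -> F) (Pi L : {vspace 'rV[F]_6}).
Local Notation B := (polar_form Q).
Hypotheses (char2 : (1 + 1 : F) = 0) (es : elliptic_section Q Pi L).
Let Q_quad := es_quad es.
Let quadE := quadE char2 Q_quad.
Implicit Types (o : 'rV[F]_6 -> Prop) (x y a b w : 'rV[F]_6).

(* The sum of two anisotropic planes has Witt index two. *)
Lemma anisotropic_perp_singular a x : a \in Pi -> x \in Pi -> B a x = 1 ->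
  ~~ artin_schreier (Q a * Q x) ->
  exists2 y, y \in Pi & [/\ y != 0, Q y = 0, B a y = 0 & B x y = 0].
Proof.
move=> aPi xPi ax axI.
have [u [v [uPi vPi uv [[au av] [xu xv]] _]]] := es_frame es aPi xPi ax.
have vu := uv; rewrite polarC in vu.
have [Qu|Qu] := eqVneq (Q u) 0.
  exists u => //; split=> //; apply/eqP => u0; move/eqP: uv.
  by rewrite u0 (polar0l Q_quad) eq_sym oner_eq0.
have [|uvI] := boolP (artin_schreier (Q u * Q v)).
  move=> /artin_schreierP [z zE]; exists (v + (z / Q u) *: u).
    by rewrite rpredD ?rpredZ.
  split.
  - apply/eqP => H; have : B u (v + (z / Q u) *: u) = 1 by rewrite !quadE uv mulr0 addr0.
    by move/eqP; rewrite H (polar0r Q_quad) eq_sym oner_eq0.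
  - rewrite !quadE vu.
    have -> : Q v = (z ^+ 2 + z) / Q u by rewrite -zE mulrC mulKf.
    have -> : (z ^+ 2 + z) / Q u + (z / Q u) ^+ 2 * Q u + z / Q u * 1 =
      (1 + 1) * (z ^+ 2 + z) / Q u by field.
    by rewrite char2 !mul0r.
  - by rewrite !quadE au av; ring.
  - by rewrite !quadE xu xv; ring.
have /artin_schreierP [z zE] := artin_schreier_add char2 axI uvI.
have Qa : Q a != 0 by apply: contraNneq axI => ->; rewrite mul0r artin_schreier0.
have [k kE] := sqrt2 char2 (Q a / Q u).
have k0 : k != 0 by rewrite -sqrf_eq0 kE mulf_neq0 ?invr_eq0.
have QaE : Q a = k ^+ 2 * Q u by rewrite kE divfK.
(* Two orthogonal singular vectors: [k] balances Q a against Q u, the coefficient of [v] gives B w1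
   w2 = 1 + 1, and that of [u] gives Q w2 = 0 by the equation for [z]. *)
pose w1 := a + k *: u; pose w2 := x + (z / k / Q u) *: u + k^-1 *: v.
have w1Pi : w1 \in Pi by rewrite rpredD ?rpredZ.
have w2Pi : w2 \in Pi by rewrite !rpredD ?rpredZ.
have aw1 : B a w1 = 0 by rewrite /w1 !quadE au; ring.
have aw2 : B a w2 = 1 by rewrite /w2 !quadE ax au av; ring.
have : w2 \in <[w1]>%VS.
  apply: (es_ell es) => //.
  - apply/eqP => H; have : B x w1 = 1 by rewrite /w1 !quadE polarC ax xu mulr0 addr0.
    by move/eqP; rewrite H (polar0r Q_quad) eq_sym oner_eq0.
  - by rewrite /w1 !quadE au QaE; ring: char2.
  - rewrite /w2 !quadE xu xv uv.
    transitivity ((k ^+ 2 * Q u * Q x + Q u * Q v + (z ^+ 2 + z)) / (k ^+ 2 * Q u)).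
      by field; rewrite Qu k0.
    by rewrite -QaE zE addxx2 // mul0r.
  rewrite /w1 /w2 !quadE ax au av (polarC Q u x) xu uv.
  by rewrite !(mulr0, addr0, add0r, mulr1) divff // addxx2.
by move=> /vlineP [c w2E]; move/eqP: aw2; rewrite w2E polarZr // aw1 mulr0 eq_sym oner_eq0.
Qed.

Lemma transvection_semilinear p : p \in Pi -> Q p != 0 -> semilinear Pi id (transvection Q p).
Proof.
move=> pPi p0; split.
- by split=> //; exists id.
- by move=> v vPi; rewrite rpredD ?rpredZ.
- move=> u v _ _; rewrite /transvection !quadE mulrDl scalerDl addrACA; by [].
- by move=> c v _; rewrite /transvection !quadE scalerDr scalerA mulrA.
move=> v vPi H; have : B (transvection Q p v) p = 0 by rewrite H (polar0l Q_quad).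
rewrite {1}/transvection !quadE mulr0 addr0 => vp; move: H.
by rewrite /transvection vp mul0r scale0r addr0.
Qed.

Lemma transvection_swap a b : Q a = Q b -> B a b != 0 -> transvection Q (a + b) a = b.
Proof.
move=> ab ab0; rewrite /transvection !quadE ab add0r.
rewrite addxx2 // add0r divff // scale1r addrA addvv2 // add0r; by [].
Qed.

(** The transvection with center a + b sends [a] to [b] when they are not orthogonal; otherwise an
    intermediate vector is used. The alternatives are those met later: over two elements, distinct
    nonzero singular vectors of Pi are not orthogonal; over four, Q a = 1. *)
Lemma isometry_transitive a b : a \in Pi -> b \in Pi -> Q a = Q b ->
  (B a b != 0) \/ a = b \/ (Q a != 0 /\ (2 < #|F|)%N) ->
  exists h, [/\ semilinear Pi id h, (forall v, v \in Pi -> Q (h v) = Q v) & h a = b].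
Proof.
move=> aPi bPi Qab.
have swap x y : x \in Pi -> y \in Pi -> Q x = Q y -> B x y != 0 ->
  exists h, [/\ semilinear Pi id h, (forall v, v \in Pi -> Q (h v) = Q v) & h x = y].
  move=> xPi yPi Qxy xy; have p0 : Q (x + y) != 0.
    by rewrite !quadE Qxy addxx2 // add0r.
  exists (transvection Q (x + y)); split.
  - by apply: transvection_semilinear => //; rewrite rpredD.
  - by move=> v _; rewrite transvection_quad.
  - exact: transvection_swap.
case=> [ab|[<-|[Qa F2]]]; first exact: swap.
  exists id; split=> //; split=> //; split=> //; by exists id.
have [ab|ab] := eqVneq (B a b) 0; last exact: swap.
have a0 : a != 0 by apply: contraNneq Qa => ->; rewrite quad0.
have b0 : b != 0 by apply: contraNneq Qa => b0; rewrite Qab b0 quad0.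
have nondeg v : v \in Pi -> v != 0 -> exists2 w, w \in Pi & B v w != 0.
  move=> vPi v0; have [w wPi vw] := es_nondeg es vPi v0.
  by exists w; rewrite ?vw ?oner_eq0.
have [u uPi [au bu]] := two_hyperplanes Q_quad nondeg aPi bPi a0 b0.
(* A nonsingular center [p] orthogonal to neither vector moves [a] to some [z] not orthogonal to
   [b]. If [u] is singular, Q (u + s a) = s (s Q a + B a u) is nonzero for [s] outside two
   values. *)
have [p pPi [Qp ap bp]] : exists2 p, p \in Pi & [/\ Q p != 0, B a p != 0 & B b p != 0].
  have [Qu|Qu] := eqVneq (Q u) 0; last by exists u.
  have [s] := @exists_notin _ [:: 0; B a u / Q a] F2.
  rewrite !inE negb_or => /andP [s0 s1]; exists (u + s *: a).
    by rewrite rpredD ?rpredZ.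
  rewrite !quadE Qu (polarC Q u) (polarC Q b a) ab !mulr0 !addr0 add0r; split=> //.
  have -> : s ^+ 2 * Q a + s * B a u = s * (s * Q a - B a u).
    by rewrite oppr2 //; ring.
  rewrite mulf_neq0 // subr_eq0; apply: contraNneq s1 => H.
  by rewrite -H mulfK.
pose z := transvection Q p a; have tp_semi := transvection_semilinear pPi Qp.
have zPi : z \in Pi := semi_mem tp_semi aPi.
have Qz : Q z = Q b by rewrite transvection_quad.
have zb : B z b != 0.
  rewrite /z /transvection !quadE ab add0r !mulf_neq0 ?invr_eq0 //.
  by rewrite polarC.
have [h [h_semi hQ hz]] := swap z b zPi bPi Qz zb.
exists (h \o transvection Q p); split=> //; last first.
  by move=> v vPi; rewrite /= hQ ?transvection_quad // (semi_mem tp_semi).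
split.
- by split=> //; exists id.
- by move=> v vPi; rewrite /= (semi_mem h_semi) // (semi_mem tp_semi).
- move=> v w vPi wPi; rewrite /= (semiD tp_semi) // (semiD h_semi) //.
    by rewrite (semi_mem tp_semi).
  by rewrite (semi_mem tp_semi).
- move=> c v vPi; rewrite /= (semiZ tp_semi) // (semiZ h_semi) //.
  by rewrite (semi_mem tp_semi).
move=> v vPi /= /(semi_inj h_semi) H; apply: (semi_inj tp_semi) => //; apply: H.
by rewrite (semi_mem tp_semi).
Qed.

Lemma semilinear_section_isomorphism s g (O1 O2 : set {vspace 'rV[F]_6}) :
  O1 `<=` points Pi -> O2 `<=` points Pi -> semilinear Pi s g ->
  (forall x, x \in Pi -> Q (g x) = 0 <-> Q x = 0) ->
  (forall x, x \in Pi -> ovoid_pred Pi O1 x <-> ovoid_pred Pi O2 (g x)) ->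
  exists f : {vspace 'rV[F]_6} -> {vspace 'rV[F]_6},
    [/\ collineation Pi f, f @` section_quadric Q Pi = section_quadric Q Pi
      & f @` O1 = O2].
Proof.
move=> O1Pi O2Pi g_semi gQ gO; exists (line_map g).
have g0 v : v \in Pi -> v != 0 -> g v != 0 by move=> vPi; rewrite (semi_eq0 g_semi).
split; first exact: line_map_collineation g_semi.
  apply: (line_map_image g_semi); try exact: subIsetl.
  move=> v vPi v0; rewrite !(section_quadricP es) ?g0 // gQ //.
  have gvPi := semi_mem g_semi vPi; tauto.
apply: (line_map_image g_semi) => // v vPi v0.
have gvPi := semi_mem g_semi vPi; have gv0 := g0 _ vPi v0.
by have := gO v vPi; split=> [Ov|Ov]; [case: (H.1 (And3 vPi v0 Ov))|case: (H.2 (And3 gvPi gv0 Ov))].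
Qed.

Lemma contained_isomorphism a b (O1 O2 : set {vspace 'rV[F]_6}) :
  O1 `<=` points Pi -> O2 `<=` points Pi ->
  ovoid_vectors Q Pi (ovoid_pred Pi O1) -> ovoid_vectors Q Pi (ovoid_pred Pi O2) ->
  a \in Pi -> b \in Pi -> Q a = Q b ->
  (B a b != 0) \/ a = b \/ (Q a != 0 /\ (2 < #|F|)%N) ->
  (forall x, ovoid_pred Pi O1 x -> Q x = B a x ^+ 2) ->
  (forall x, ovoid_pred Pi O2 x -> Q x = B b x ^+ 2) ->
  exists f : {vspace 'rV[F]_6} -> {vspace 'rV[F]_6},
    [/\ collineation Pi f, f @` section_quadric Q Pi = section_quadric Q Pi
      & f @` O1 = O2].
Proof.
move=> O1Pi O2Pi ov1 ov2 aPi bPi Qab ab O1a O2b.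
have [h [h_semi hQ hab]] := isometry_transitive aPi bPi Qab ab.
have hB u v : u \in Pi -> v \in Pi -> B (h u) (h v) = B u v.
  by move=> uPi vPi; rewrite /polar_form -(semiD h_semi) // !hQ ?rpredD.
(* [h] carries the first ovoid into {Q = B(b, .)^2}, where [ov_contained_unique] identifies it with
   the second. *)
have hO : ovoid_vectors Q Pi (fun y => exists2 x, ovoid_pred Pi O1 x & y = h x).
  split.
  - move=> _ [x ox ->]; have [xPi x0] := ov_mem ov1 ox.
    by rewrite (semi_mem h_semi) // (semi_eq0 h_semi).
  - move=> c _ c0 [x ox ->]; have [xPi x0] := ov_mem ov1 ox.
    by exists (c *: x); [exact: (ov_scale ov1) | rewrite (semiZ h_semi)].
  - move=> _ _ [x ox ->] [z oz ->]; have [[xPi x0] [zPi z0]] := (ov_mem ov1 ox, ov_mem ov1 oz).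
    by rewrite hB // (semilinear_line h_semi) //; exact: (ov_uniq ov1).
  move=> u v uPi vPi u0 vu uv.
  have [u' u'Pi uE] := semilinear_surj h_semi uPi.
  have [v' v'Pi vE] := semilinear_surj h_semi vPi.
  have [|||ou'|[t ot]] := ov_meet ov1 u'Pi v'Pi.
  - by rewrite -(semi_eq0 h_semi) // uE.
  - by rewrite -(semilinear_line h_semi) ?uE ?vE // -(semi_eq0 h_semi) // uE.
  - by rewrite -hB // uE vE.
  - by left; exists u'.
  right; exists t; exists (v' + t *: u') => //.
  by rewrite (semiD h_semi) ?rpredZ // (semiZ h_semi) // uE vE.
apply: (semilinear_section_isomorphism O1Pi O2Pi h_semi).
  by move=> x xPi; rewrite hQ.
have hOb y : (exists2 x, ovoid_pred Pi O1 x & y = h x) -> Q y = B b y ^+ 2.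
  move=> [x ox ->]; have [xPi _] := ov_mem ov1 ox.
  by rewrite -hab hB // hQ // O1a.
move=> x xPi; split=> [ox|ohx].
  by apply: (ov_contained_unique char2 es hO ov2 hOb O2b); exists x.
have [x' ox' E] := ov_contained_unique char2 es ov2 hO O2b hOb ohx.
have [x'Pi _] := ov_mem ov1 ox'.
by rewrite (semilinear_inj h_semi xPi x'Pi E).
Qed.

End Containment.

(** * Ovoids over the fields with two and four elements *)

Section SmallFields.
Variables (F : finFieldType) (Q : 'rV[F]_6 -> F) (Pi L : {vspace 'rV[F]_6}).
Local Notation B := (polar_form Q).
Hypotheses (char2 : (1 + 1 : F) = 0) (es : elliptic_section Q Pi L).
Let Q_quad := es_quad es.
Let quadE := quadE char2 Q_quad.
Variable o : 'rV[F]_6 -> Prop.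
Hypothesis ov : ovoid_vectors Q Pi o.
Hypothesis o_nonsingular : exists2 x, o x & Q x != 0.

Lemma card2_ne0 (c : F) : #|F| = 2%N -> c != 0 -> c = 1.
Proof.
move=> F2 c0; have : c * (c - 1) == 0.
  rewrite oppr2 // mulrDr mulr1 -expr2.
  by have := expf_card c; rewrite F2 => ->; rewrite addxx2.
by rewrite mulf_eq0 (negPf c0) subr_eq0 => /eqP.
Qed.

(** Let [y] be a singular point off the ovoid. Over two elements nonorthogonal means B = 1, so the
    ovoid points w + t y on the isotropic lines through [y] give B w a = B w b on y^perp. This
    forces b = y + a, which is not singular. *)
Lemma card2_singular_unique a b : #|F| = 2%N -> o a -> o b -> Q a = 0 -> Q b = 0 ->
  b \in <[a]>%VS.
Proof.
move=> F2 oa ob Qa Qb; apply: contraT => ba.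
have one c := @card2_ne0 c F2.
have [y yPi [y0 Qy oy]] := ov_missing char2 es ov o_nonsingular.
have [aPi a0] := ov_mem ov oa; have [bPi b0] := ov_mem ov ob.
have oB x z : o x -> o z -> z \notin <[x]>%VS -> B x z = 1.
  by move=> ox oz zx; apply/one/(ovoid_polar ov ox oz zx).
have ab : B a b = 1 by exact: oB.
have yB x : o x -> Q x = 0 -> B y x = 1.
  move=> ox Qx; have [xPi x0] := ov_mem ov ox; apply: one.
  apply: contraNneq (ov_neq ov ox oy y0) => yx; have xy := yx; rewrite polarC in xy.
  exact: (es_ell es).
have [ya yb] := (yB _ oa Qa, yB _ ob Qb).
have [u [v [uPi vPi uv [[yu yv] [au av]] span]]] := es_frame es yPi aPi ya.
have key w z : w \in Pi -> B y w = 0 -> B y z = 0 -> B w z = 1 -> B w a = B w b.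
  move=> wPi yw yz wz; have wy : w \notin <[y]>%VS.
    by apply: (polar_notin es yz); rewrite wz oner_neq0.
  have [t ot] := ov_through ov yPi wPi oy y0 wy yw.
  have zB x : o x -> B y x = 1 -> B w x + t = 1.
    move=> ox yx; have : B (w + t *: y) x = 1.
      apply: oB => //; apply: (@polar_notin _ _ _ _ es _ _ y).
        by rewrite !quadE (polarC Q w) yw mulr0 addr0.
      by rewrite polarC yx oner_neq0.
    by rewrite !quadE yx mulr1.
  by apply: (addIr t); rewrite !zB.
have bu : B u b = 0 by rewrite -(key u v) // polarC.
have bv : B v b = 0 by rewrite -(key v u) 1?polarC // polarC.
have [c [d [e [g bE]]]] := span b bPi.
have vu := uv; rewrite polarC in vu.
move: ab yb bu bv; rewrite bE !quadE (polarC Q a y) (polarC Q u y) (polarC Q v y).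
rewrite (polarC Q u a) (polarC Q v a) ya yu yv au av uv vu.
rewrite !(mulr0, mulr1, addr0, add0r) => c1 d1 g0 e0.
have {}bE : b = y + a by rewrite bE c1 d1 e0 g0 !scale0r !addr0 !scale1r.
by move/eqP: Qb; rewrite bE quadD Qy Qa ya !add0r oner_eq0.
Qed.

(** Once a singular ovoid point [a] is found, every other ovoid point [x] has Q x and B a x nonzero,
    that is, equal to 1. *)
Lemma card2_contained : #|F| = 2%N -> exists2 a, a \in Pi &
  [/\ a != 0, Q a = 0 & forall x, o x -> Q x = B a x ^+ 2].
Proof.
move=> F2; have one c := @card2_ne0 c F2.
have [a oa Qa] : exists2 a, o a & Q a = 0.
  apply: contrapT => H; have Qo x : o x -> Q x = 1.
    by move=> ox; apply: one; apply/eqP => Qx; apply: H; exists x.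
  have [x ox _] := o_nonsingular; have [xPi x0] := ov_mem ov ox.
  have [x' ox' [_ x'x]] := ov_second char2 es ov o_nonsingular xPi.
  have [x'Pi _] := ov_mem ov ox'.
  have xx' : B x x' = 1 by apply/one/(ovoid_polar ov ox ox' x'x).
  have [u [v [uPi vPi uv [[xu xv] [x'u x'v]] _]]] := es_frame es xPi x'Pi xx'.
  (* If Q = 1 on the ovoid, the isotropic line of [r] and x + x' has no ovoid point: x + x' is
     collinear with [x] and [x'], [r] is orthogonal to [x], and r + x + x' is singular. Such an [r]
     exists since [u], [v], [u + v] are not all singular. *)
  have [r rPi [Qr xr x'r]] : exists2 r, r \in Pi & [/\ Q r = 1, B x r = 0 & B x' r = 0].
    have [Qu|/one Qu] := eqVneq (Q u) 0; last by exists u.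
    have [Qv|/one Qv] := eqVneq (Q v) 0; last by exists v.
    exists (u + v); first by rewrite rpredD.
    by rewrite !quadE Qu Qv uv xu xv x'u x'v !addr0 add0r.
  pose p := x + x'; have pPi : p \in Pi by rewrite rpredD.
  have op : ~ o p.
    have := no_three_collinear char2 es ov ox ox' x'x (oner_neq0 F) (oner_neq0 F).
    by rewrite !scale1r.
  have xp : B x p = 1 by rewrite /p !quadE xx' add0r.
  have rp : r \notin <[p]>%VS.
    apply/vlineP => -[k rE]; move/eqP: xr; rewrite rE polarZr // xp mulr1.
    by move/eqP => k0; move/eqP: Qr; rewrite rE k0 scale0r quad0 // eq_sym oner_eq0.
  have p0 : p != 0.
    by apply/eqP => p0; move/eqP: xp; rewrite p0 (polar0r Q_quad) eq_sym oner_eq0.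
  have pr : B p r = 0 by rewrite /p !quadE xr x'r addr0.
  have [t ot] := ov_through ov pPi rPi op p0 rp pr.
  have [t0|/one t1] := eqVneq t 0.
    move: ot; rewrite t0 scale0r addr0 => or.
    have := ov_uniq ov ox or xr => /vlineP [k rE].
    move/eqP: x'r; rewrite rE polarZr // polarC xx' mulr1 => /eqP k0.
    by move/eqP: Qr; rewrite rE k0 scale0r quad0 // eq_sym oner_eq0.
  have := Qo _ ot; rewrite t1 scale1r /p !quadE Qr (Qo x) // (Qo x') // xx'.
  rewrite (polarC Q r x) (polarC Q r x') xr x'r => /eqP.
  have -> : 1 + (1 + 1 + 1) + (0 + 0) = (1 + 1) + (1 + 1) :> F by ring.
  by rewrite char2 addr0 eq_sym oner_eq0.
have [aPi a0] := ov_mem ov oa; exists a => //; split=> // x ox.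
have [/vlineP [k ->]|xa] := boolP (x \in <[a]>%VS).
  by rewrite !quadE Qa !mulr0 expr0n.
rewrite (one _ (ovoid_polar ov oa ox xa)) expr1n; apply: one.
apply: contraNneq xa => Qx; exact: card2_singular_unique.
Qed.

(* Off [a^perp], the vectors of [o] normalised by [B a x = 1] have [Q x = 0] or
   [Q x = 1], and adding to [x] a vector [w] orthogonal to [a] and [x] with [Q w = 1]
   changes both [Q x] and membership in [o].  Two such steps from a vector with
   [Q = 0] lead to a vector orthogonal to any given one with [Q = 1]. *)
Lemma card4_contained a : #|F| = 4%N -> a \in Pi -> Q a = 1 ->
  (forall y, y \in Pi -> y != 0 -> Q y = 0 -> B a y = 0 -> o y) ->
  forall x, o x -> Q x = B a x ^+ 2.
Proof.
move=> F4 aPi Qa conic_o.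
have AS01 (c : F) : artin_schreier c -> c != 0 -> c = 1.
  by rewrite card4_artin_schreier // !inE => /orP [/eqP ->|/eqP //]; rewrite eqxx.
(* Projecting [x] from [a] to the quadric gives a point [y] of the conic, which is on the ovoid and
   orthogonal to [x], hence equal to [x] as a point. *)
have perp_a x : o x -> B a x = 0 -> Q x = 0.
  move=> ox ax; have [xPi x0] := ov_mem ov ox.
  have [/vlineP [k xE]|xa] := boolP (x \in <[a]>%VS).
    have a0 : a != 0 by apply: contraNneq x0 => a0; rewrite xE a0 scaler0.
    have [y yPi [ay y0 Qy]] := perp_singular char2 es aPi a0.
    have xy : B x y = 0 by rewrite xE polarZl // ay mulr0.
    have /vlineP [m yE] := ov_uniq ov ox (conic_o _ yPi y0 Qy ay) xy.
    move/eqP: Qy; rewrite yE quadZ // mulf_eq0 sqrf_eq0 => /orP [/eqP m0|/eqP //].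
    by rewrite yE m0 scale0r eqxx in y0.
  have xa0 := ax; rewrite polarC in xa0.
  have [k kE] := sqrt2 char2 (Q x); pose y := x + k *: a.
  have Qy : Q y = 0 by rewrite /y !quadE Qa kE xa0; ring: char2.
  have ay : B a y = 0 by rewrite /y !quadE ax mulr0 addr0.
  have y0 : y != 0.
    apply: contraNneq xa => /eqP; rewrite addr_eq0 => /eqP ->.
    by rewrite rpredN memvZ // memv_line.
  have yPi : y \in Pi by rewrite rpredD ?rpredZ.
  have xy : B x y = 0 by rewrite /y !quadE xa0 mulr0 addr0.
  have /vlineP [m yE] := ov_uniq ov ox (conic_o _ yPi y0 Qy ay) xy.
  have [m0|m0] := eqVneq m 0; first by rewrite yE m0 scale0r eqxx in y0.
  by move/eqP: Qy; rewrite yE quadZ // mulf_eq0 sqrf_eq0 (negPf m0) => /eqP.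
have off_a x : o x -> B a x = 1 -> artin_schreier (Q x).
  move=> ox ax; have [xPi x0] := ov_mem ov ox; apply: contraT => QI.
  have [|y yPi [y0 Qy ay xy]] := anisotropic_perp_singular char2 es aPi xPi ax.
    by rewrite Qa mul1r.
  have /vlineP [k yE] := ov_uniq ov ox (conic_o _ yPi y0 Qy ay) xy.
  move/eqP: ay; rewrite yE polarZr // ax mulr1 => /eqP k0.
  by rewrite yE k0 scale0r eqxx in y0.
have notin_x x w : B a x = 1 -> B a w = 0 -> Q w = 1 -> w \notin <[x]>%VS.
  move=> ax aw Qw; apply/vlineP => -[k wE]; move/eqP: aw.
  rewrite wE polarZr // ax mulr1 => /eqP k0; move/eqP: Qw.
  by rewrite wE k0 scale0r quad0 // eq_sym oner_eq0.
have step_out x w : o x -> B a x = 1 -> B a w = 0 -> B x w = 0 -> Q w = 1 -> ~ o (x + w).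
  move=> ox ax aw xw Qw oxw; case/negP: (notin_x x w ax aw Qw).
  rewrite -(addKr x w) rpredD ?rpredN ?memv_line //.
  by apply: (ov_uniq ov ox oxw); rewrite !quadE xw addr0.
have step_in x w : x \in Pi -> w \in Pi -> ~ o x -> artin_schreier (Q x) ->
    B a x = 1 -> B a w = 0 -> B x w = 0 -> Q w = 1 -> o (x + w).
  move=> xPi wPi ox Qx ax aw xw Qw; have wx := notin_x x w ax aw Qw.
  have x0 : x != 0.
    by apply/eqP => x0; move/eqP: ax; rewrite x0 (polar0r Q_quad) eq_sym oner_eq0.
  have [t ot] := ov_through ov xPi wPi ox x0 wx xw.
  have [t0|t0] := eqVneq t 0.
    move: ot; rewrite t0 scale0r addr0 => ow.
    by have /eqP := perp_a w ow aw; rewrite Qw oner_eq0.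
  have ot' : o (x + t^-1 *: w).
    have -> : x + t^-1 *: w = t^-1 *: (w + t *: x).
      by rewrite scalerDr scalerA mulVf // scale1r addrC.
    by apply: (ov_scale ov) => //; rewrite invr_eq0.
  have := off_a _ ot'; rewrite !quadE aw ax xw Qw !(mulr0, mulr1, addr0) => /(_ erefl).
  move=> /(artin_schreierD char2 Qx); rewrite addrA addxx2 // add0r => /AS01.
  rewrite sqrf_eq0 invr_eq0 => /(_ t0) t1.
  have tV : t^-1 = 1.
    apply/eqP; rewrite -subr_eq0 -sqrf_eq0; apply/eqP.
    have -> : (t^-1 - 1) ^+ 2 = t^-1 ^+ 2 + 1 - (1 + 1) * t^-1 by ring.
    by rewrite t1 char2 mul0r subr0.
  by move: ot'; rewrite tV scale1r.
have nomix x0 y0 : o x0 -> o y0 -> B a x0 = 1 -> B a y0 = 1 -> Q x0 = 0 -> Q y0 = 1 -> False.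
  move=> ox0 oy0 ax ay Qx Qy.
  have [x0Pi x00] := ov_mem ov ox0; have [y0Pi y00] := ov_mem ov oy0.
  have [u [v [uPi vPi uv [[au av] [xu xv]] span]]] := es_frame es aPi x0Pi ax.
  have xa := ax; rewrite polarC in xa; have vu := uv; rewrite polarC in vu.
  have n_aniso w : w \in Pi -> B a w = 0 -> B x0 w = 0 -> Q w = 0 -> w = 0.
    move=> wPi aw xw Qw; have /vlineP [k wE] := es_ell es x0Pi wPi x00 Qx Qw xw.
    by move/eqP: aw; rewrite wE polarZr // ax mulr1 => /eqP ->; rewrite scale0r.
  have value r b c : r \in Pi -> B a r = 0 -> B x0 r = 0 -> Q r = 1 -> b != 0 ->
      ~~ artin_schreier (c / b ^+ 2) ->
      exists2 w, w \in Pi & [/\ B a w = 0, B x0 w = 0, Q w = c & B r w = b].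
    move=> rPi ar xr Qr b0 cI.
    have [z zPi [az xz rz]] : exists2 z, z \in Pi & [/\ B a z = 0, B x0 z = 0 & B r z = 1].
      have [z zPi [az xz rz]] :
          exists2 z, z \in Pi & [/\ B a z = 0, B x0 z = 0 & B r z != 0].
        have [ru|ru] := eqVneq (B r u) 0; last by exists u.
        have [rv|rv] := eqVneq (B r v) 0; last by exists v.
        have [p [q [g [h rE]]]] := span r rPi.
        move: ar xr ru rv; rewrite rE !quadE xa ax au av xu xv uv vu.
        rewrite !(mulr0, mulr1, addr0, add0r) => q0 p0 h0 g0.
        move/eqP: Qr.
        by rewrite rE q0 p0 h0 g0 !scale0r !addr0 quad0 // eq_sym oner_eq0.
      exists ((B r z)^-1 *: z); first by rewrite rpredZ.
      by rewrite !polarZr // az xz !mulr0 mulVf.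
    have QI : ~~ artin_schreier (Q r * Q z).
      apply: anisotropic_plane => //; first by rewrite Qr oner_neq0.
      move=> k; apply/eqP => Q0.
      have := n_aniso (z + k *: r); rewrite rpredD ?rpredZ // !polarDr // !polarZr //.
      rewrite az ar xz xr !mulr0 !addr0 => /(_ isT erefl erefl Q0) H.
      have := congr1 (B r) H; rewrite polarDr // polarZr // polarvv // rz mulr0 addr0.
      by rewrite (polar0r Q_quad) => /eqP; rewrite oner_eq0.
    have [|k kE] := plane_value char2 Q_quad rz QI b0 (c := c).
      by rewrite Qr mulr1.
    exists (b *: z + k *: r); first by rewrite rpredD ?rpredZ.
    by rewrite kE plane_value_polar // !quadE az ar xz xr !mulr0 addr0.
  pose b := B x0 y0.
  have b0 : b != 0.
    apply: (ovoid_polar ov ox0 oy0); apply/vlineP => -[k yE]; move/eqP: Qy.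
    by rewrite yE quadZ // Qx mulr0 eq_sym oner_eq0.
  (* The component of [y0] orthogonal to [a] and [x0]. *)
  pose w0 := y0 + x0 + b *: a.
  have w0Pi : w0 \in Pi by rewrite !rpredD ?rpredZ.
  have aw0 : B a w0 = 0 by rewrite /w0 !quadE ay ax; ring: char2.
  have xw0 : B x0 w0 = 0 by rewrite /w0 !quadE -/b xa; ring: char2.
  have Qw0 : Q w0 = 1 + b + b ^+ 2.
    rewrite /w0 !quadE Qy Qx Qa (polarC Q y0 x0) -/b (polarC Q y0 a) ay xa.
    transitivity (1 + b + b ^+ 2 + (1 + 1) * b); first by ring.
    by rewrite char2 mul0r addr0.
  have nAS (c : F) : c != 0 -> c != 1 -> ~~ artin_schreier c.
    by move=> c0 c1; rewrite card4_artin_schreier // !inE negb_or c0.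
  have sq1 (c : F) : c ^+ 2 == 1 -> c = 1.
    rewrite -subr_eq0 => /eqP H; apply/eqP; rewrite -subr_eq0 -sqrf_eq0 -H.
    by rewrite !oppr2 //; apply/eqP; ring: char2.
  (* The target of the two steps is x0 + g a + r: it is singular because g^2 = g + 1 and Q r = 1,
     and orthogonal to [y0] when B r w0 = b + g. For b = 1 this is solvable since (b + g)^2 = g;
     otherwise g = b works because w0 = 0. *)
  have [g [g0 g1 [r rPi [ar xr Qr rw0]]]] : exists g, [/\ g != 0, g != 1 &
      exists2 r, r \in Pi & [/\ B a r = 0, B x0 r = 0, Q r = 1 & B r w0 = b + g]].
    have [b1|b1] := eqVneq b 1.
      have [g] : exists z : F, z \notin [:: 0; 1] by apply: exists_notin; rewrite F4.
      rewrite !inE negb_or => /andP [g0 g1]; exists g; split=> //.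
      have gE := card4_non_artin_schreier char2 F4 (nAS g g0 g1).
      have bg0 : b + g != 0 by rewrite b1 addrC -gE sqrf_eq0.
      have Qw01 : Q w0 = 1 by rewrite Qw0 b1 expr1n char2 add0r.
      have [|r rPi [ar xr Qr w0r]] := value w0 (b + g) 1 w0Pi aw0 xw0 Qw01 bg0.
        have -> : (b + g) ^+ 2 = g by rewrite b1 addrC -gE -exprM -[RHS]expf_card F4.
        apply: nAS.
          by rewrite mul1r invr_eq0.
        by rewrite mul1r invr_eq1.
      by exists r => //; split=> //; rewrite polarC.
    exists b; split=> //.
    have bE := card4_non_artin_schreier char2 F4 (nAS b b0 b1).
    have w00 : w0 = 0 by apply: n_aniso => //; rewrite Qw0 bE (addrC 1) addxx2.
    have Qu : Q u != 0.
      apply/eqP => /(n_aniso u uPi au xu) u0; move/eqP: uv.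
      by rewrite u0 (polar0l Q_quad) eq_sym oner_eq0.
    have [k kE] := sqrt2 char2 (Q u)^-1; exists (k *: u); first by rewrite rpredZ.
    by rewrite w00 (polar0r Q_quad) addxx2 // !quadE au xu kE mulVf // !mulr0.
  have gE := card4_non_artin_schreier char2 F4 (nAS g g0 g1).
  (* The intermediate vector is x0 + w; the condition B r w = g makes the second step g a + r + w
     orthogonal to it and gives that step the value 1. *)
  have [|w wPi [aw xw Qw rw]] := value r g 1 rPi ar xr Qr g0.
    rewrite mul1r; apply: nAS; first by rewrite invr_eq0 sqrf_eq0.
    by rewrite invr_eq1; apply: contraNneq g1 => /eqP/sq1 ->.
  have ox1 : ~ o (x0 + w) by exact: step_out.
  pose w' := g *: a + r + w.
  have w'Pi : w' \in Pi by rewrite !rpredD ?rpredZ.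
  have Qw' : Q w' = 1.
    rewrite /w' !quadE Qa Qr Qw ar aw rw gE.
    transitivity (1 + (1 + 1) * (g + 1)); first by ring.
    by rewrite char2 mul0r addr0.
  have aw' : B a w' = 0 by rewrite /w' !quadE ar aw; ring.
  have xw' : B (x0 + w) w' = 0.
    rewrite /w' !quadE xa xr xw (polarC Q w a) aw (polarC Q w r) rw.
    by ring: char2.
  have Qx1 : Q (x0 + w) = 1 by rewrite !quadE Qx Qw xw addr0 add0r.
  have ax1 : B a (x0 + w) = 1 by rewrite !quadE ax aw addr0.
  have ASx1 : artin_schreier (Q (x0 + w)) by rewrite Qx1 card4_artin_schreier // !inE eqxx orbT.
  have ox2 : o (x0 + w + w') by apply: step_in => //; rewrite rpredD.
  have Qx2 : Q (x0 + w + w') = 0 by rewrite quadD Qx1 Qw' xw' addr0.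
  have x2y : B (x0 + w + w') y0 = 0.
    have -> : x0 + w + w' = x0 + g *: a + r.
      by rewrite /w'; apply/rowP => i; rewrite !mxE; ring: char2.
    have ry : B r y0 = b + g.
      rewrite -rw0 /w0 !quadE (polarC Q r x0) (polarC Q r a) xr ar; ring.
    by rewrite !quadE ay ry -/b; ring: char2.
  have /vlineP [k yE] := ov_uniq ov ox2 oy0 x2y.
  by move/eqP: Qy; rewrite yE quadZ // Qx2 mulr0 eq_sym oner_eq0.
have scaled x : o x -> B a x != 0 -> o ((B a x)^-1 *: x) /\ B a ((B a x)^-1 *: x) = 1.
  move=> ox ax; rewrite polarZr // mulVf //; split=> //.
  by apply: (ov_scale ov) => //; rewrite invr_eq0.
move=> x ox; have [ax|ax] := eqVneq (B a x) 0.
  by rewrite ax (perp_a x ox ax) expr0n.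
have [ox' ax'] := scaled x ox ax; set x' := _ *: x in ox' ax'.
suff Qx' : Q x' = 1.
  have -> : x = B a x *: x' by rewrite /x' scalerA divff // scale1r.
  by rewrite quadZ // Qx' polarZr // ax' !mulr1.
apply: (AS01); first exact: off_a.
apply/eqP => Qx'; have [z oz Qz] := o_nonsingular.
have az : B a z != 0 by apply: contraNneq Qz => /(perp_a z oz) ->.
have [oz' az'] := scaled z oz az.
apply: (nomix x' _ ox' oz' ax' az' Qx').
apply: (AS01); first exact: off_a.
by rewrite quadZ // mulf_neq0 // sqrf_eq0 invr_eq0.
Qed.

End SmallFields.

(** * Similarities moving the line orthogonal to Pi *)

Section Mixed.
Variables (F : finFieldType) (Q : 'rV[F]_6 -> F) (Pi L : {vspace 'rV[F]_6}).
Local Notation B := (polar_form Q).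
Hypotheses (char2 : (1 + 1 : F) = 0) (es : elliptic_section Q Pi L).
Let Q_quad := es_quad es.
Let quadE := quadE char2 Q_quad.

(** Stated for a bare predicate, to serve both the ovoid and the image of the other one, which need
    not lie in Pi. *)
Lemma three_on_line (P : 'rV[F]_6 -> Prop) x d c1 c2 c3 :
  (forall x y a b, P x -> P y -> y \notin <[x]>%VS -> a != 0 -> b != 0 ->
    ~ P (a *: x + b *: y)) ->
  d \notin <[x]>%VS -> x != 0 -> c1 != c2 -> c1 != c3 -> c2 != c3 ->
  P (x + c1 *: d) -> P (x + c2 *: d) -> P (x + c3 *: d) -> False.
Proof.
move=> no3 dx x0 c12 c13 c23 P1 P2 P3.
have c12' : c1 - c2 != 0 by rewrite subr_eq0.
apply: (no3 _ _ ((c3 - c2) / (c1 - c2)) ((c1 - c3) / (c1 - c2)) P1 P2).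
- apply/vlineP => -[k E]; have H : (c2 - k * c1) *: d = (k - 1) *: x.
    have -> : (c2 - k * c1) *: d = (x + c2 *: d) - x - (k * c1) *: d by vring.
    by rewrite E; vring.
  have [H0|H0] := eqVneq (c2 - k * c1) 0; last first.
    by case/negP: dx; rewrite -[d](scalerK H0) H !memvZ // memv_line.
  move/eqP: H; rewrite H0 scale0r eq_sym scaler_eq0 (negPf x0) orbF subr_eq0.
  by move=> /eqP k1; move/eqP: H0; rewrite k1 mul1r subr_eq0 eq_sym (negPf c12).
- by rewrite mulf_neq0 ?invr_eq0 // subr_eq0 eq_sym.
- by rewrite mulf_neq0 ?invr_eq0 // subr_eq0.
suff -> : (c3 - c2) / (c1 - c2) *: (x + c1 *: d) + (c1 - c3) / (c1 - c2) *: (x + c2 *: d) =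
  x + c3 *: d by [].
by apply/rowP => i; rewrite !mxE; field.
Qed.

Lemma anisotropic_non_artin_schreier : exists d : F, ~~ artin_schreier d.
Proof.
have [m mL m0] := es_nonempty es; have [u uL [mu _]] := es_pair es mL m0.
exists (Q m * Q u); apply: anisotropic_plane => //.
  by apply: contra_neq m0 => /(es_aniso es mL).
move=> k; apply/eqP => /(es_aniso es (rpredD uL (rpredZ k mL))) H.
have := congr1 (B m) H; rewrite polarDr // polarZr // polarvv // mu mulr0 addr0.
by rewrite (polar0r Q_quad) => /eqP; rewrite oner_eq0.
Qed.

Variable o : 'rV[F]_6 -> Prop.
Hypothesis ov : ovoid_vectors Q Pi o.
Hypothesis o_nonsingular : exists2 x, o x & Q x != 0.
Variables (a m : 'rV[F]_6).
Hypotheses (aPi : a \in Pi) (a0 : a != 0) (mL : m \in L) (m0 : m != 0).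
Hypothesis Qam : Q a + Q m != 0.
(* Invariance of the hyperoval under the reflection with center [a + m]. *)
Hypothesis reflection : forall x l c, x \in Pi -> l \in L -> l != 0 -> Q x = Q l ->
  l + c *: m != 0 -> Q (x + c *: a) = Q (l + c *: m) -> o x -> o (x + c *: a).

(* [x + l] is a point of the hyperoval for every [l] in [L] with [Q l = Q x];
   the [l] with [B m l = b] yields the value [(B x a + b) / Q (a + m)]. *)
Lemma mixed_value d x : ~~ artin_schreier d -> o x -> Q x != 0 ->
  exists2 b, b ^+ 2 = Q x * Q m / d & o (x + ((B x a + b) / (Q a + Q m)) *: a).
Proof.
move=> dI ox Qx; have [xPi x0] := ov_mem ov ox.
have d0 : d != 0 by apply: contraNneq dI => ->; rewrite artin_schreier0.
have Qm : Q m != 0 by apply: contra_neq m0 => /(es_aniso es mL).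
have [b bE] := sqrt2 char2 (Q x * Q m / d); exists b => //.
have b0 : b != 0 by rewrite -sqrf_eq0 bE !mulf_neq0 ?invr_eq0.
have [u uL [mu _]] := es_pair es mL m0.
have mn0 k v : B m v != 0 -> v + k *: m != 0.
  move=> mv; apply/eqP => H; have := congr1 (B m) H.
  rewrite polarDr // polarZr // polarvv // mulr0 addr0 (polar0r Q_quad) => /eqP.
  by rewrite (negPf mv).
have muI : ~~ artin_schreier (Q m * Q u).
  apply: anisotropic_plane => // k; apply/eqP.
  move=> /(es_aniso es (rpredD uL (rpredZ k mL))) /eqP; apply/negP/mn0.
  by rewrite mu oner_neq0.
have [|k kE] := plane_value char2 Q_quad mu muI b0 (c := Q x).
  by rewrite bE invf_div mulrC divfK // mulf_neq0.
set l := _ + _ in kE; have lL : l \in L by rewrite rpredD ?rpredZ.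
have ml : B m l = b by apply: plane_value_polar.
have l0 : l != 0 by have := mn0 0 l; rewrite scale0r addr0 ml; apply.
clearbody l; apply: (reflection xPi lL) => //; first by apply: mn0; rewrite ml.
set c := _ / _; rewrite !quadE kE (polarC Q l) ml.
have cE : c * (Q a + Q m) = B x a + b by rewrite /c divfK.
apply/eqP; rewrite -subr_eq0 oppr2 //; apply/eqP.
transitivity ((1 + 1) * Q x + c * (c * (Q a + Q m)) + c * (B x a + b)); first by ring.
by rewrite cE char2 mul0r add0r addxx2.
Qed.

Lemma mixed_values d1 d2 x b1 b2 : ~~ artin_schreier d1 -> ~~ artin_schreier d2 ->
  Q x != 0 -> d1 != d2 -> b1 ^+ 2 = Q x * Q m / d1 -> b2 ^+ 2 = Q x * Q m / d2 ->
  (B x a + b1) / (Q a + Q m) != (B x a + b2) / (Q a + Q m).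
Proof.
move=> d1I d2I Qx d12 b1E b2E; apply: contraNneq d12.
have Qm : Q m != 0 by apply: contra_neq m0 => /(es_aniso es mL).
have QQ : Q x * Q m != 0 by rewrite mulf_neq0.
have QV : (Q a + Q m)^-1 != 0 by rewrite invr_eq0.
move=> /(mulIf QV) /addrI b12; move: b2E; rewrite -b12 b1E => /(mulfI QQ).
by move/invr_inj ->.
Qed.

Lemma mixed_large : (4 < #|F|)%N -> False.
Proof.
move=> F4; have [d dI] := anisotropic_non_artin_schreier.
have [d1 [d2 [d1d d2d d12 d1I d2I]]] := three_non_artin_schreier char2 F4 dI.
have [x ox [Qx xa]] := ov_second char2 es ov o_nonsingular aPi.
have [xPi x0] := ov_mem ov ox.
have [b bE ob] := mixed_value dI ox Qx; have [b1 b1E ob1] := mixed_value d1I ox Qx.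
have [b2 b2E ob2] := mixed_value d2I ox Qx.
have := three_on_line (no_three_collinear char2 es ov) (notin_line_sym a0 xa) x0.
move=> /(_ _ _ _ _ _ _ ob ob1 ob2); apply; [apply: (mixed_values dI d1I)
  | apply: (mixed_values dI d2I) | apply: (mixed_values d1I d2I)] => //.
- by rewrite eq_sym.
- by rewrite eq_sym.
Qed.

(** Two ovoid points on a line through [a] show that [a] is off the ovoid, and that no nonsingular
    ovoid point is orthogonal to [a], as this line would be isotropic. Hence each isotropic line
    through [a] meets the ovoid in its singular point. *)
Lemma mixed_conic : (2 < #|F|)%N -> Q a != 0 /\
  forall y, y \in Pi -> y != 0 -> Q y = 0 -> B a y = 0 -> o y.
Proof.
move=> F2; have [d dI] := anisotropic_non_artin_schreier.
have [d1 [d1d d1I]] := two_non_artin_schreier char2 F2 dI.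
have two x : o x -> Q x != 0 ->
    exists c c1, [/\ c != c1, o (x + c *: a) & o (x + c1 *: a)].
  move=> ox Qx; have [b bE ob] := mixed_value dI ox Qx.
  have [b1 b1E ob1] := mixed_value d1I ox Qx.
  exists ((B x a + b) / (Q a + Q m)), ((B x a + b1) / (Q a + Q m)); split=> //.
  by apply: (mixed_values dI d1I); rewrite // eq_sym.
have oa : ~ o a.
  move=> oa; have [x ox [Qx xa]] := ov_second char2 es ov o_nonsingular aPi.
  have [c [c1 [cc1 oc oc1]]] := two x ox Qx.
  have cc0 : c1 - c != 0 by rewrite subr_eq0 eq_sym.
  have xca : x + c *: a \notin <[a]>%VS.
    by apply: contra xa => H; rewrite -(addrK (c *: a) x) rpredB // memvZ // memv_line.
  apply: (no_three_collinear char2 es ov oa oc xca cc0 (oner_neq0 F)).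
  suff -> : (c1 - c) *: a + 1 *: (x + c *: a) = x + c1 *: a by [].
  by vring.
have oQ x : o x -> B a x = 0 -> Q x = 0.
  move=> ox ax; apply/eqP; apply: contraT => Qx.
  have [c [c1 [cc1 oc oc1]]] := two x ox Qx; have [xPi x0] := ov_mem ov ox.
  have xa : a \notin <[x]>%VS by exact: (ov_neq ov).
  have xa0 := ax; rewrite polarC in xa0.
  have /vlineP [k kE] : x + c1 *: a \in <[(x + c *: a)%R]>%VS.
    by apply: (ov_uniq ov) => //; rewrite !quadE ax xa0; ring.
  have H : (c1 - k * c) *: a = (k - 1) *: x.
    have -> : (c1 - k * c) *: a = (x + c1 *: a) - x - (k * c) *: a by vring.
    by rewrite kE; vring.
  have [H0|H0] := eqVneq (c1 - k * c) 0; last first.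
    by case/negP: xa; rewrite -[a](scalerK H0) H !memvZ // memv_line.
  move/eqP: H; rewrite H0 scale0r eq_sym scaler_eq0 (negPf x0) orbF subr_eq0.
  move=> /eqP k1; move/eqP: H0; rewrite k1 mul1r subr_eq0 => /eqP c1c.
  by rewrite c1c eqxx in cc1.
have Qa : Q a != 0.
  apply/eqP => Qa; have [y yPi [ay ya]] := perp_point es aPi a0.
  have [t ot] := ov_through ov aPi yPi oa a0 ya ay.
  have ayt : B a (y + t *: a) = 0 by rewrite !quadE ay mulr0 addr0.
  have [ytPi _] := ov_mem ov ot.
  have := es_ell es aPi ytPi a0 Qa (oQ _ ot ayt) ayt => H.
  by case/negP: ya; rewrite -(addrK (t *: a) y) rpredB // memvZ // memv_line.
split=> // y yPi y0 Qy ay.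
have ya : y \notin <[a]>%VS.
  apply/vlineP => -[k yE]; move/eqP: Qy; rewrite yE quadZ // mulf_eq0 (negPf Qa) orbF.
  by rewrite sqrf_eq0 => /eqP k0; rewrite yE k0 scale0r eqxx in y0.
have [t ot] := ov_through ov aPi yPi oa a0 ya ay.
have := oQ _ ot; rewrite !quadE ay mulr0 addr0 Qy (polarC Q y) ay => /(_ erefl) /eqP.
rewrite mulr0 addr0 add0r mulf_eq0 (negPf Qa) orbF sqrf_eq0 => /eqP t0.
by move: ot; rewrite t0 scale0r addr0.
Qed.

End Mixed.

(* The image of [L] is the span [P] of [p] and [r], orthogonal in [Pi] to the span
   [M] of [e] and [f]; [o'] is the image of the other ovoid.  The hypotheses [both],
   [first] and [second] equate the two descriptions of the hyperoval at a singular
   vector of [L + P + M]. *)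
Section InsidePi.
Variables (F : finFieldType) (Q : 'rV[F]_6 -> F) (Pi L : {vspace 'rV[F]_6}).
Local Notation B := (polar_form Q).
Hypotheses (char2 : (1 + 1 : F) = 0) (es : elliptic_section Q Pi L).
Let Q_quad := es_quad es.
Let quadE := quadE char2 Q_quad.
Variables o o' : 'rV[F]_6 -> Prop.
Hypothesis ov : ovoid_vectors Q Pi o.
Hypothesis o_nonsingular : exists2 x, o x & Q x != 0.
Hypothesis o'_uniq : forall u v, o' u -> o' v -> B u v = 0 -> v \in <[u]>%VS.
Hypothesis o'_no3 : forall x y a b, o' x -> o' y -> y \notin <[x]>%VS ->
  a != 0 -> b != 0 -> ~ o' (a *: x + b *: y).
Variables p r : 'rV[F]_6.
Hypotheses (pPi : p \in Pi) (rPi : r \in Pi) (pr : B p r = 1).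
Let P := (<[p]> + <[r]>)%VS.
Hypothesis P_aniso : forall v, v \in P -> Q v = 0 -> v = 0.

Section Frame.
Variables e f : 'rV[F]_6.
Hypotheses (ePi : e \in Pi) (fPi : f \in Pi) (ef : B e f = 1).
Hypotheses (pe : B p e = 0) (re : B r e = 0) (pf : B p f = 0) (rf : B r f = 0).
Hypotheses (Qe : Q e = 0) (Qf : Q f = 0).
Let M := (<[e]> + <[f]>)%VS.
Hypothesis Pi_split : forall x, x \in Pi -> exists2 v, v \in P & exists2 w, w \in M & x = v + w.
Hypothesis both : forall l v w, l \in L -> l != 0 -> v \in P -> v != 0 -> w \in M ->
  Q (l + (v + w)) = 0 -> o (v + w) <-> o' (l + w).
Hypothesis first : forall v w, v \in P -> v != 0 -> w \in M ->
  Q (v + w) = 0 -> ~ o (v + w) <-> o' w.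
Hypothesis second : forall l w, l \in L -> l != 0 -> w \in M ->
  Q (l + w) = 0 -> o w <-> ~ o' (l + w).

Let fe : B f e = 1. Proof. by rewrite polarC. Qed.
Let rp : B r p = 1. Proof. by rewrite polarC. Qed.

Let memP v : v \in P <-> exists a b, v = a *: p + b *: r.
Proof. by split=> [/mem_add2|H]; last exact/mem_add2. Qed.

Let memM w : w \in M <-> exists a b, w = a *: e + b *: f.
Proof. by split=> [/mem_add2|H]; last exact/mem_add2. Qed.

Let pP : p \in P. Proof. by apply/memP; exists 1, 0; vring. Qed.
Let rP : r \in P. Proof. by apply/memP; exists 0, 1; vring. Qed.
Let eM : e \in M. Proof. by apply/memM; exists 1, 0; vring. Qed.
Let fM : f \in M. Proof. by apply/memM; exists 0, 1; vring. Qed.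

Let PPi v : v \in P -> v \in Pi.
Proof. by move=> /memP [a [b ->]]; rewrite rpredD ?rpredZ. Qed.

Let MPi w : w \in M -> w \in Pi.
Proof. by move=> /memM [a [b ->]]; rewrite rpredD ?rpredZ. Qed.

Let PM v w : v \in P -> w \in M -> B v w = 0.
Proof. by move=> /memP [a [b ->]] /memM [c [d ->]]; rewrite !quadE pe re pf rf; ring. Qed.

Let eft t : e + t *: f \in M. Proof. by rewrite rpredD ?rpredZ. Qed.

Let Qeft t : Q (e + t *: f) = t.
Proof. by rewrite !quadE Qe Qf ef; ring. Qed.

Let e0 : e != 0.
Proof. by apply/eqP => e0; move/eqP: ef; rewrite e0 (polar0l Q_quad) eq_sym oner_eq0. Qed.

Let f_e : f \notin <[e]>%VS.
Proof. by apply: (polar_notin es (polarvv char2 Q_quad e)); rewrite fe oner_neq0. Qed.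

Let circle_in t v : t != 0 -> ~ o' (e + t *: f) -> v \in P -> Q v = t -> o (v + (e + t *: f)).
Proof.
move=> t0 o't vP Qv; apply: contrapT => ovt; apply: o't.
have v0 : v != 0 by apply: contraNneq t0 => v0; rewrite -Qv v0 quad0.
have Q0 : Q (v + (e + t *: f)) = 0 by rewrite quadD PM // Qeft Qv addr0 addxx2.
by apply/(first vP v0 (eft t) Q0).
Qed.

Let three_secant t1 t2 t3 : t1 != t2 -> t1 != t3 -> t2 != t3 ->
  o' (e + t1 *: f) -> o' (e + t2 *: f) -> o' (e + t3 *: f) -> False.
Proof. by apply: three_on_line o'_no3 f_e e0. Qed.

(** At most two of the points e + t f are on [o'], so some nonzero [t] remains. Then [circle_in]
    puts on [o] all v + e + t f with Q v = t, which up to scalars are the singular vectors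
    orthogonal to e + t f. *)
Lemma inside_conic : (3 < #|F|)%N -> exists2 a, a \in Pi & Q a != 0 /\
  forall y, y \in Pi -> y != 0 -> Q y = 0 -> B a y = 0 -> o y.
Proof.
move=> F3.
have [t t0 o't] : exists2 t, t != 0 & ~ o' (e + t *: f).
  apply: contrapT => H; have o't t : t != 0 -> o' (e + t *: f).
    by move=> t0; apply: contrapT => o't; apply: H; exists t.
  have [t1] := @exists_notin F [:: 0] (ltn_trans (isT : 1 < 3)%N F3).
  have [t2] := @exists_notin F [:: 0; t1] (ltn_trans (isT : 2 < 3)%N F3).
  have [t3] := @exists_notin F [:: 0; t1; t2] F3.
  rewrite !inE !negb_or => /and3P [t30 t31 t32] /andP [t20 t21] t10.
  by apply: (@three_secant t1 t2 t3); rewrite // 1?eq_sym //; exact: o't.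
exists (e + t *: f); first exact: MPi.
rewrite Qeft; split=> // y yPi y0 Qy ay.
have [v vP [w /memM [a [b wE]] yE]] := Pi_split yPi.
have wM : w \in M by apply/memM; exists a, b.
have bE : b = t * a.
  move: ay; rewrite yE polarDr // (polarC Q _ v) PM // add0r wE !quadE ef fe.
  by rewrite !(mulr0, mulr1, addr0, add0r) => /eqP; rewrite addr_eq0 oppr2 // mulrC => /eqP.
have wE' : w = a *: (e + t *: f) by rewrite wE bE; vring.
have [a_0|a_0] := eqVneq a 0.
  move: yE; rewrite wE' a_0 scale0r addr0 => yE; case/eqP: y0; rewrite yE.
  by apply: P_aniso; rewrite // -yE.
have aVP : a^-1 *: v \in P by rewrite rpredZ.
have -> : y = a *: (a^-1 *: v + (e + t *: f)).
  by rewrite yE wE' [RHS]scalerDr scalerA divff // scale1r.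
apply: (ov_scale ov) => //; apply: circle_in => //.
move: Qy; rewrite yE quadD PM // wE' !quadZ // Qeft addr0 => /eqP.
rewrite addr_eq0 oppr2 // => /eqP ->.
by rewrite exprVn mulKf // sqrf_eq0.
Qed.

(** For nonzero [t], e + t f is a third point of a secant, so off [o], and [second] puts k + e + t f
    on [o'] for some [k] in [L]. This is orthogonal to e + t f, which is therefore off [o'];
    [circle_in] then puts every singular point of Pi on [o]. *)
Lemma not_both : o e -> o f -> False.
Proof.
move=> oe of_; have [y yPi [y0 Qy oy]] := ov_missing char2 es ov o_nonsingular.
have oeft t : t != 0 -> ~ o (e + t *: f).
  move=> t0; have := no_three_collinear char2 es ov oe of_ f_e (oner_neq0 F) t0.
  by rewrite scale1r.
have [l lL l0] := es_nonempty es.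
have o'eft t : t != 0 -> ~ o' (e + t *: f).
  move=> t0 o't; have [k kL Qk] := es_value char2 es t lL l0.
  have k0 : k != 0 by apply: contraNneq t0 => k0; rewrite -Qk k0 quad0.
  have kM : B (e + t *: f) k = 0 by rewrite (es_perp es) // MPi.
  have Qkt : Q (k + (e + t *: f)) = 0.
    by rewrite quadD Qk Qeft polarC kM addr0 addxx2.
  have o'k : o' (k + (e + t *: f)).
    by apply: contrapT => H; apply: (oeft t t0); apply/(second kL k0 (eft t) Qkt).
  have /vlineP [c kE] : k + (e + t *: f) \in <[(e + t *: f)%R]>%VS.
    by apply: o'_uniq; rewrite // polarDr // kM add0r polarvv.
  case/eqP: k0; apply: (es_disjoint es) => //.
  have wPi := MPi (eft t).
  by rewrite -(addrK (e + t *: f) k) kE rpredB // rpredZ.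
apply: oy; have [v vP [w /memM [a [b wE]] yE]] := Pi_split yPi.
have wM : w \in M by apply/memM; exists a, b.
have Qvw : Q v = a * b.
  move: Qy; rewrite yE quadD PM // addr0 wE !quadE Qe Qf ef => /eqP.
  by rewrite addr_eq0 oppr2 // => /eqP ->; ring.
have [ab0|] := eqVneq (a * b) 0.
  have v0 : v = 0 by apply: P_aniso; rewrite // Qvw.
  move: y0; rewrite yE v0 add0r wE; move/eqP: ab0; rewrite mulf_eq0.
  case/orP => /eqP ->; rewrite scale0r ?add0r ?addr0 scaler_eq0 negb_or => /andP [k0 _];
  exact: (ov_scale ov).
rewrite mulf_eq0 negb_or => /andP [a_0 b_0].
have ba0 : b / a != 0 by rewrite mulf_neq0 ?invr_eq0.
have -> : y = a *: (a^-1 *: v + (e + (b / a) *: f)).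
  by rewrite yE wE; apply/rowP => i; rewrite !mxE; field.
apply: (ov_scale ov) => //; apply: circle_in => //; first exact: o'eft.
  by rewrite rpredZ.
by rewrite quadZ // Qvw; field.
Qed.

(* [v0 + e] is in [o] for [Q v0 = c], and so is [v + e + t f] for [Q v = t]
   unless [e + t f] is in [o'].  They are orthogonal for a suitable [v] when
   [c / t] is not of the form [z^2 + z]. *)

Lemma inside_large : (4 < #|F|)%N -> ~ o e -> False.
Proof.
move=> F4 oe; have [l lL l_0] := es_nonempty es.
have Qp : Q p != 0.
  apply/eqP => /(P_aniso pP) p0; move/eqP: pr.
  by rewrite p0 (polar0l Q_quad) eq_sym oner_eq0.
have p_0 : p != 0 by apply: contraNneq Qp => ->; rewrite quad0.
(* By [both], membership of v + w in [o] equals membership of k + w in [o'] with Q k = Q v + Q w, so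
   it depends on [v] only through Q v. *)
have transfer v v' w : v \in P -> v' \in P -> w \in M -> v != 0 -> v' != 0 ->
    Q v = Q v' -> Q v + Q w != 0 -> o (v + w) -> o (v' + w).
  move=> vP v'P wM v0 v'0 Qvv' Qvw ovw.
  have [k kL Qk] := es_value char2 es (Q v + Q w) lL l_0.
  have k0 : k != 0 by apply: contraNneq Qvw => k0; rewrite -Qk k0 quad0.
  have Qkv z : z \in P -> Q z = Q v -> Q (k + (z + w)) = 0.
    move=> zP Qz; have zwPi : z + w \in Pi by apply: rpredD; [exact: PPi | exact: MPi].
    by rewrite quadD polarC (es_perp es) // addr0 quadD PM // addr0 Qz Qk addxx2.
  have := both kL k0 v'P v'0 wM (Qkv _ v'P (esym Qvv')).
  have := both kL k0 vP v0 wM (Qkv _ vP erefl); tauto.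
(* Otherwise [transfer] with w = 0 puts the whole line [P] on [o]. *)
have op : ~ o p.
  move=> op; have oP v : v \in P -> v != 0 -> o v.
    move=> vP v0; have Qv : Q v != 0 by apply: contra_neq v0 => /(P_aniso vP).
    have [k kE] := sqrt2 char2 (Q p / Q v).
    have k0 : k != 0 by rewrite -sqrf_eq0 kE mulf_neq0 ?invr_eq0.
    rewrite -(scalerK k0 v); apply: (ov_scale ov); rewrite ?invr_eq0 //.
    have := @transfer p (k *: v) 0 pP; rewrite rpredZ // mem0v !addr0.
    by apply; rewrite ?scaler_eq0 ?negb_or ?k0 // ?quad0 ?addr0 // quadZ // kE divfK.
  have r_0 : r != 0.
    by apply/eqP => r0; move/eqP: pr; rewrite r0 (polar0r Q_quad) eq_sym oner_eq0.
  have rp_ : r \notin <[p]>%VS.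
    by apply: (polar_notin es (polarvv char2 Q_quad p)); rewrite rp oner_neq0.
  have := no_three_collinear char2 es ov op (oP _ rP r_0) rp_ (oner_neq0 F) (oner_neq0 F).
  rewrite !scale1r; apply; apply: oP; first by rewrite rpredD.
  apply/eqP => H; have := congr1 (B p) H; rewrite polarDr // polarvv // add0r pr.
  by rewrite (polar0r Q_quad) => /eqP; rewrite oner_eq0.
have e_p : e \notin <[p]>%VS.
  apply/vlineP => -[k eE]; move/eqP: re; rewrite eE polarZr // rp mulr1 => /eqP k0.
  by move: e0; rewrite eE k0 scale0r eqxx.
have [k ok] := ov_through ov pPi ePi op p_0 e_p pe.
have k0 : k != 0 by apply/eqP => k0; apply: oe; move: ok; rewrite k0 scale0r addr0.
pose c := Q (k *: p); have c0 : c != 0 by rewrite /c quadZ // mulf_neq0 // sqrf_eq0.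
have kp0 : k *: p != 0 by rewrite scaler_eq0 negb_or k0.
have kpP : k *: p \in P by rewrite rpredZ.
have kr : B (k *: p) (k^-1 *: r) = 1 by rewrite polarZl // polarZr // pr mulr1 divff.
have krP : k^-1 *: r \in P by rewrite rpredZ.
have krI : ~~ artin_schreier (Q (k *: p) * Q (k^-1 *: r)).
  apply: anisotropic_plane => // z; apply/eqP.
  move=> /(P_aniso (rpredD krP (rpredZ z kpP))) H.
  have := congr1 (B (k *: p)) H.
  rewrite (polarDr Q_quad) (polarZr Q_quad z) (polarvv char2 Q_quad) kr mulr0 addr0.
  by rewrite (polar0r Q_quad) => /eqP; rewrite oner_eq0.
(* With t = c / s, [plane_value] yields [v] with Q v = t and B (k p) v = t; the latter cancels B e
   (t f), so v + e + t f is orthogonal to e + k p. Three values of [s] will give three collinear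
   points of [o']. *)
have in_A s : ~~ artin_schreier s -> o' (e + (c / s) *: f).
  move=> sI; apply: contrapT => o't.
  have s0 : s != 0 by apply: contraNneq sI => ->; rewrite artin_schreier0.
  have t0 : c / s != 0 by rewrite mulf_neq0 ?invr_eq0.
  have [|z zE] := plane_value char2 Q_quad kr krI t0 (c := c / s).
    rewrite -/c; suff -> : c / s * c / (c / s) ^+ 2 = s by [].
    by field; rewrite s0 c0.
  set v := _ + _ in zE; have vP : v \in P by rewrite rpredD ?rpredZ.
  have kv : B (k *: p) v = c / s by apply: plane_value_polar.
  clearbody v.
  have ovt := circle_in t0 o't vP zE.
  have ev : B e v = 0 by rewrite polarC PM.
  have H0 : B (e + k *: p) (v + (e + (c / s) *: f)) = 0.
    rewrite polarDl // polarDr // (polarDr Q_quad v) kv !quadE ev ef pe pf.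
    by rewrite !(mulr0, mulr1, addr0, add0r) addxx2.
  have /vlineP [h hE] := ov_uniq ov ok ovt H0.
  have H1 : B e (v + (e + (c / s) *: f)) = c / s by rewrite !quadE ev ef; ring.
  case/eqP: t0; rewrite -H1 hE !quadE (polarC Q e p) pe.
  by ring.
have [d dI] := anisotropic_non_artin_schreier char2 es.
have [d1 [d2 [d1d d2d d12 d1I d2I]]] := three_non_artin_schreier char2 F4 dI.
have inj x y : x != y -> c / x != c / y.
  by apply: contra_neq => /(mulfI c0) /invr_inj.
by apply: (three_secant _ _ _ (in_A d dI) (in_A d1 d1I) (in_A d2 d2I));
  apply: inj; rewrite // eq_sym.
Qed.

End Frame.
End InsidePi.

(** * From isomorphic hyperovals to isomorphic ovoids *)

Section Isomorphisms.
Variables (F : finFieldType) (Q : 'rV[F]_6 -> F) (Pi L : {vspace 'rV[F]_6}).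
Local Notation B := (polar_form Q).
Hypotheses (char2 : (1 + 1 : F) = 0) (es : elliptic_section Q Pi L).
Let Q_quad := es_quad es.
Let quadE := quadE char2 Q_quad.
Local Notation ovoid_pred := (ovoid_pred Pi).

Record quadric_similarity (O1 O2 : set {vspace 'rV[F]_6}) (s : F -> F)
    (c : F) (G : 'rV[F]_6 -> 'rV[F]_6) : Prop := {
  qs_semi : semilinear fullv s G;
  qs_quad : forall v, Q (G v) = c * s (Q v);
  qs_factor : c != 0;
  qs_image : forall v, v != 0 -> Q v = 0 ->
    hyperoval_of Q Pi O1 <[v]>%VS <-> hyperoval_of Q Pi O2 <[G v]>%VS }.

Lemma es_polar_nondeg v : v != 0 -> exists w, B v w != 0.
Proof.
have [x [l [xPi lL ->]]] := es_decomp es v; have [->|x0] := eqVneq x 0.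
  rewrite add0r => l0; have [u uL [lu _]] := es_pair es lL l0.
  by exists u; rewrite lu oner_neq0.
move=> _; have [y yPi xy] := es_nondeg es xPi x0; exists y.
by rewrite polarDl // xy (polarC Q l) (es_perp es) // addr0 oner_neq0.
Qed.

Lemma isomorphism_similarity O1 O2 :
  quadric_isomorphic Q (hyperoval_of Q Pi O1) (hyperoval_of Q Pi O2) ->
  exists s c G, quadric_similarity O1 O2 s c G.
Proof.
move=> [f [f_coll fQ fH]].
have [|s [G [G_semi fG]]] := fundamental_theorem_projective_geometry char2 _ f_coll.
  by rewrite dimvf.
have fT := collineation_image f_coll fG.
have s_aut := semi_aut G_semi.
have G0 v : v != 0 -> G v != 0 by rewrite (semi_eq0 G_semi) ?memvf.
have G_singular v : v \in fullv -> Q (G v) = 0 <-> Q v = 0.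
  move=> _; have [->|v0] := eqVneq v 0; first by rewrite (semi0 G_semi) quad0.
  have quadric_points : quadric Q `<=` points fullv by move=> p [].
  have := fT _ _ quadric_points fQ v (memvf v) v0.
  rewrite !(quadricP es) ?G0 //; tauto.
have nondeg v : v \in fullv -> v != 0 -> exists2 w, w \in fullv & B v w != 0.
  by move=> _ /es_polar_nondeg [w vw]; exists w; rewrite ?memvf.
have sing : exists2 x, x \in fullv & x != 0 /\ Q x = 0.
  by have [x _ Hx] := es_sing es; exists x; rewrite ?memvf.
have [c c0 GQ] := semisimilarity char2 Q_quad G_semi nondeg sing G_singular.
exists s, c, G; split=> // [v|v v0 _]; first by rewrite GQ ?memvf.
by apply: (fT _ _ (hyperoval_points (O := O1)) fH); rewrite ?memvf.
Qed.

Lemma similarity_inverse O1 O2 s c G : quadric_similarity O1 O2 s c G ->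
  exists t d K, quadric_similarity O2 O1 t d K /\ cancel G K /\ cancel K G.
Proof.
move=> [G_semi GQ c0 GH]; have s_aut := semi_aut G_semi.
have [t ts st] := aut_bij s_aut.
have Gsurj w : exists v, G v = w.
  by have [v _ <-] := semilinear_surj G_semi (memvf w); exists v.
have [K GK] := choice Gsurj.
have Ginj u v : G u = G v -> u = v by exact: (semilinear_inj G_semi (memvf _) (memvf _)).
have KG v : K (G v) = v by apply: Ginj; rewrite GK.
have tinj := can_inj ts.
have t_aut : field_automorphism t.
  split=> [x y|x y|]; last by exists s.
  - by apply: tinj; rewrite st (autD s_aut) !st.
  - by apply: tinj; rewrite st (autM s_aut) !st.
have K_semi : semilinear fullv t K.
  split=> // [v _|u v _ _|k v _|v _ Kv].
  - exact: memvf.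
  - by apply: Ginj; rewrite (semiD G_semi) ?memvf // !GK.
  - by apply: Ginj; rewrite (semiZ G_semi) ?memvf // !GK st.
  by rewrite -(GK v) Kv (semi0 G_semi).
have tc0 : t c != 0 by rewrite (aut_eq0 t_aut).
exists t, (t c)^-1, K; split; last by [].
split=> // [v||v v0 Qv].
- apply: (mulfI tc0); rewrite mulVKf //.
  by rewrite -{2}(GK v) GQ (autM t_aut) ts.
- by rewrite invr_eq0.
have Kv0 : K v != 0 by rewrite (semi_eq0 K_semi) ?memvf.
have QKv : Q (K v) = 0.
  by have := GQ (K v); rewrite GK Qv => /esym/eqP; rewrite mulf_eq0 (negPf c0) (aut_eq0 s_aut) => /eqP.
by have := GH _ Kv0 QKv; rewrite GK; apply: iff_sym.
Qed.

(** [l] and [l'] vanish together, so by [hyperovalP] both sides depend on [x] alone. This is the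
    invariance under reflections with centers on [L]. *)
Lemma hyperoval_conic_invariant O x l l' : O `<=` points Pi -> x \in Pi -> l \in L -> l' \in L ->
  x + l != 0 -> x + l' != 0 -> Q (x + l) = 0 -> Q (x + l') = 0 ->
  hyperoval_of Q Pi O <[(x + l)%R]>%VS <-> hyperoval_of Q Pi O <[(x + l')%R]>%VS.
Proof.
move=> OPi xPi lL l'L xl0 xl'0 Ql Ql'.
have := hyperovalP char2 es OPi xPi lL xl0 Ql.
have := hyperovalP char2 es OPi xPi l'L xl'0 Ql'.
have /eqP := Ql; rewrite (quad_es_eq0 char2 es) // => /eqP QxQl.
have /eqP := Ql'; rewrite (quad_es_eq0 char2 es) // => /eqP QxQl'.
have [l0|l0] := eqVneq l 0.
  suff l'0 : l' = 0 by rewrite l0 l'0.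
  by apply: (es_aniso es) => //; rewrite -QxQl' QxQl l0 quad0.
have l'0 : l' != 0.
  apply: contra_neq l0 => l'0; apply: (es_aniso es) => //.
  by rewrite -QxQl QxQl' l'0 quad0.
move/eqP: (l0) => nl0; move/eqP: (l'0) => nl'0; rewrite l'0; tauto.
Qed.

Section OneSimilarity.
Variables (O1 O2 : set {vspace 'rV[F]_6}) (s : F -> F) (c : F) (G : 'rV[F]_6 -> 'rV[F]_6).
Hypotheses (O1Pi : O1 `<=` points Pi) (O2Pi : O2 `<=` points Pi).
Hypothesis GH : quadric_similarity O1 O2 s c G.
Hypotheses (ov1 : ovoid_vectors Q Pi (ovoid_pred O1)).
Hypotheses (ov2 : ovoid_vectors Q Pi (ovoid_pred O2)).
Hypothesis O2_nonsingular : exists2 x, ovoid_pred O2 x & Q x != 0.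
Let G_semi := qs_semi GH.
Let s_aut := semi_aut G_semi.
Let c0 := qs_factor GH.

Let GD u v : G (u + v) = G u + G v. Proof. by rewrite (semiD G_semi) ?memvf. Qed.
Let GZ k v : G (k *: v) = s k *: G v. Proof. by rewrite (semiZ G_semi) ?memvf. Qed.
Let G0 v : (G v == 0) = (v == 0). Proof. by rewrite (semi_eq0 G_semi) ?memvf. Qed.
Let G_inj u v : G u = G v -> u = v.
Proof. exact: (semilinear_inj G_semi (memvf _) (memvf _)). Qed.
Let G_surj w : exists v, G v = w.
Proof. by have [v _ <-] := semilinear_surj G_semi (memvf w); exists v. Qed.
Let GB u v : B (G u) (G v) = c * s (B u v).
Proof.
have GQ v' : v' \in fullv -> Q (G v') = c * s (Q v') by rewrite (qs_quad GH).
by rewrite (semisimilarity_polar G_semi GQ) ?memvf.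
Qed.
Let GB0 u v : (B (G u) (G v) == 0) = (B u v == 0).
Proof. by rewrite GB mulf_eq0 (negPf c0) (aut_eq0 s_aut). Qed.
Let GQ0 v : (Q (G v) == 0) = (Q v == 0).
Proof. by rewrite (qs_quad GH) mulf_eq0 (negPf c0) (aut_eq0 s_aut). Qed.

(** Provides the hypothesis [reflection] of the mixed case: the preimages under [G] of x + l0 and (x
    + k a) + (l0 + k m) differ by a multiple of [l], so they have the same component in Pi. *)
Lemma mixed_image l a m x l0 k : l \in L -> G l = a + m -> a \in Pi -> m \in L ->
  x \in Pi -> l0 \in L -> l0 != 0 -> Q x = Q l0 -> l0 + k *: m != 0 ->
  Q (x + k *: a) = Q (l0 + k *: m) -> ovoid_pred O2 x -> ovoid_pred O2 (x + k *: a).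
Proof.
move=> lL Gl aPi mL xPi l0L l0_0 Qxl0 lm0 Qxlm O2x.
have [t ts st] := aut_bij s_aut.
have xaPi : x + k *: a \in Pi by rewrite rpredD ?rpredZ.
have lmL : l0 + k *: m \in L by rewrite rpredD ?rpredZ.
pose v := x + l0; pose w := (x + k *: a) + (l0 + k *: m).
have v0 : v != 0.
  apply: contraNneq l0_0 => v0; have [_ -> //] := es_uniq es xPi l0L (mem0v _) (mem0v _) (etrans v0 (esym (addr0 0))).
have w0 : w != 0.
  apply: contraNneq lm0 => w0; have [_ -> //] := es_uniq es xaPi lmL (mem0v _) (mem0v _) (etrans w0 (esym (addr0 0))).
have Qv : Q v = 0 by apply/eqP; rewrite (quad_es_eq0 char2 es) // Qxl0.
have Qw : Q w = 0 by apply/eqP; rewrite (quad_es_eq0 char2 es) // Qxlm.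
have [v' Gv'] := G_surj v; have [x1 [l1 [x1Pi l1L v'E]]] := es_decomp es v'.
have Gw' : G (x1 + (l1 + t k *: l)) = w.
  rewrite addrA GD -v'E Gv' GZ st Gl /v /w; vring.
have l1tL : l1 + t k *: l \in L by rewrite rpredD ?rpredZ.
have xl0 : x1 + l1 != 0 by rewrite -v'E -G0 Gv'.
have xl1 : x1 + (l1 + t k *: l) != 0 by rewrite -G0 Gw'.
have Qxl : Q (x1 + l1) = 0 by apply/eqP; rewrite -v'E -GQ0 Gv' Qv.
have Qxl1 : Q (x1 + (l1 + t k *: l)) = 0 by apply/eqP; rewrite -GQ0 Gw' Qw.
have := hyperoval_conic_invariant O1Pi x1Pi l1L l1tL xl0 xl1 Qxl Qxl1.
have := qs_image GH xl0 Qxl; have := qs_image GH xl1 Qxl1.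
rewrite Gw' -v'E Gv'.
have := hyperovalP char2 es O2Pi xPi l0L v0 Qv.
have := hyperovalP char2 es O2Pi xaPi lmL w0 Qw.
rewrite -/v -/w; move/eqP: (lm0) => nlm0; move/eqP: (l0_0) => nl0.
tauto.
Qed.

Let o' w := exists2 x, ovoid_pred O1 x & w = G x.

Lemma image_uniq u v : o' u -> o' v -> B u v = 0 -> v \in <[u]>%VS.
Proof.
move=> [x ox ->] [y oy ->] /eqP; rewrite GB0 => /eqP xy.
have [_ x0] := ov_mem ov1 ox.
by rewrite (semilinear_line G_semi) ?memvf //; exact: (ov_uniq ov1).
Qed.

Lemma image_no3 x y a b : o' x -> o' y -> y \notin <[x]>%VS ->
  a != 0 -> b != 0 -> ~ o' (a *: x + b *: y).
Proof.
move=> [x1 ox ->] [y1 oy ->] yx a0 b0 [z oz zE].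
have [t ts st] := aut_bij s_aut; have [_ x10] := ov_mem ov1 ox.
have t0 k : k != 0 -> t k != 0 by rewrite -(aut_eq0 s_aut) st.
apply: (@no_three_collinear _ _ _ _ char2 es _ ov1 x1 y1 (t a) (t b)) => //.
- by rewrite -(semilinear_line G_semi) ?memvf.
- exact: t0.
- exact: t0.
suff <- : z = t a *: x1 + t b *: y1 by [].
by apply: G_inj; rewrite -zE GD !GZ !st.
Qed.

Lemma inside_dichotomy : (3 < #|F|)%N -> (forall l, l \in L -> G l \in Pi) ->
  ((4 < #|F|)%N -> False) /\ exists2 a, a \in Pi & Q a != 0 /\
  forall y, y \in Pi -> y != 0 -> Q y = 0 -> B a y = 0 -> ovoid_pred O2 y.
Proof.
move=> F3 GLPi; have [m mL m0] := es_nonempty es.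
have [u uL [mu span]] := es_pair es mL m0.
pose p := G m; pose r := c^-1 *: G u.
have pPi : p \in Pi by exact: GLPi.
have rPi : r \in Pi by rewrite rpredZ ?GLPi.
have pr : B p r = 1 by rewrite /p /r polarZr // GB mu (aut1 s_aut) mulr1 mulVf.
have [t ts st] := aut_bij s_aut.
have memP v : v \in (<[p]> + <[r]>)%VS -> exists2 l, l \in L & v = G l.
  move=> /mem_add2 [a [b ->]]; exists (t a *: m + t (b / c) *: u).
    by rewrite rpredD ?rpredZ.
  by rewrite GD !GZ !st /r scalerA.
have GL_P l : l \in L -> G l \in (<[p]> + <[r]>)%VS.
  move=> /span [a [b ->]]; apply/mem_add2; exists (s a), (s b * c).
  by rewrite GD !GZ /r scalerA mulfK.
have P_aniso v : v \in (<[p]> + <[r]>)%VS -> Q v = 0 -> v = 0.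
  move=> /memP [l lL ->] /eqP; rewrite GQ0 => /eqP /(es_aniso es lL) ->.
  exact: semi0 G_semi.
clearbody p r.
have rp := pr; rewrite polarC in rp.
have pP : p \in (<[p]> + <[r]>)%VS by apply/mem_add2; exists 1, 0; vring.
have rP : r \in (<[p]> + <[r]>)%VS by apply/mem_add2; exists 0, 1; vring.
have prI : ~~ artin_schreier (Q p * Q r).
  apply: anisotropic_plane => // [|a]; apply/eqP.
    move=> /(P_aniso _ pP) p0; move/eqP: pr.
    by rewrite p0 (polar0l Q_quad) eq_sym oner_eq0.
  move=> /(P_aniso _ (rpredD rP (rpredZ a pP))) H; have := congr1 (B p) H.
  rewrite polarDr // polarZr // polarvv // mulr0 addr0 pr (polar0r Q_quad).
  by move/eqP; rewrite oner_eq0.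
have [e ePi [e0 Qe pe re]] := anisotropic_perp_singular char2 es pPi rPi pr prI.
have [f0 f0Pi ef0] := es_nondeg es ePi e0.
have er : B e r = 0 by rewrite polarC.
have ep : B e p = 0 by rewrite polarC.
(* [f0] is corrected to be orthogonal to [p] and [r], and then, along [e], to be singular. *)
pose f1 := f0 + B f0 r *: p + B f0 p *: r.
have f1Pi : f1 \in Pi by rewrite !rpredD ?rpredZ.
have pf1 : B p f1 = 0 by rewrite /f1 !quadE pr (polarC Q f0 p); ring: char2.
have rf1 : B r f1 = 0 by rewrite /f1 !quadE rp (polarC Q f0 r); ring: char2.
have ef1 : B e f1 = 1 by rewrite /f1 !quadE ef0 ep er; ring.
clearbody f1.
pose f := f1 + Q f1 *: e.
have fPi : f \in Pi by rewrite rpredD ?rpredZ.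
have pf : B p f = 0 by rewrite /f !quadE pf1 pe; ring.
have rf : B r f = 0 by rewrite /f !quadE rf1 re; ring.
have ef : B e f = 1 by rewrite /f !quadE ef1; ring.
have Qf : Q f = 0 by rewrite /f !quadE Qe (polarC Q f1) ef1; ring: char2.
clearbody f.
have fe := ef; rewrite polarC in fe.
have split x : x \in Pi -> exists2 v, v \in (<[p]> + <[r]>)%VS &
    exists2 w, w \in (<[e]> + <[f]>)%VS & x = v + w.
  move=> xPi.
  exists (B x r *: p + B x p *: r); first by apply/mem_add2; exists (B x r), (B x p).
  exists (B x f *: e + B x e *: f); first by apply/mem_add2; exists (B x f), (B x e).
  (* [e] and [f] have no components along [p] and [r], so they are combinations of [a] and [b], with
     coordinate determinant B e f = 1; this verifies the decomposition of [x]. *)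
  have [a [b [aPi bPi ab [[pa pb] [ra rb]] span']]] := es_frame es pPi rPi pr.
  have [x1 [x2 [x3 [x4 xE]]]] := span' x xPi.
  have [e1 [e2 [e3 [e4 eE]]]] := span' e ePi.
  have [f1' [f2 [f3 [f4 fE]]]] := span' f fPi.
  have ba := ab; rewrite polarC in ba.
  have [ap bp] : B a p = 0 /\ B b p = 0 by rewrite !(polarC _ _ p).
  have [ar br] : B a r = 0 /\ B b r = 0 by rewrite !(polarC _ _ r).
  have coords z z1 z2 z3 z4 : z = z1 *: p + z2 *: r + z3 *: a + z4 *: b ->
      [/\ B z r = z1, B z p = z2, B z b = z3 & B z a = z4].
    by move=> ->; rewrite !quadE pr rp ap ar bp br ab ba pa pb ra rb; split; ring.
  have [e1E e2E _ _] := coords _ _ _ _ _ eE; have [f1E f2E _ _] := coords _ _ _ _ _ fE.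
  have [x1E x2E _ _] := coords _ _ _ _ _ xE.
  have {}eE : e = e3 *: a + e4 *: b.
    by rewrite {1}eE -e1E -e2E er ep !scale0r !add0r.
  have {}fE : f = f3 *: a + f4 *: b.
    by rewrite {1}fE -f1E -f2E !(polarC Q f) rf pf !scale0r !add0r.
  have det : e3 * f4 + e4 * f3 = 1.
    rewrite -ef eE fE !quadE ab ba; ring.
  have xeE : B x e = x3 * e4 + x4 * e3.
    by rewrite xE eE !quadE pa pb ra rb ab ba; ring.
  have xfE : B x f = x3 * f4 + x4 * f3.
    by rewrite xE fE !quadE pa pb ra rb ab ba; ring.
  rewrite {1}xE -addrA; congr (_ + _); first by rewrite x1E x2E.
  rewrite xeE xfE {1}eE {1}fE; apply/rowP => i; rewrite !mxE.
  transitivity ((e3 * f4 + e4 * f3) * (x3 * a 0 i + x4 * b 0 i)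
    + (1 + 1) * (x4 * f3 * e3 * a 0 i + x3 * e4 * f4 * b 0 i)); last by ring.
  by rewrite det char2 mul0r addr0 mul1r.
have PMframe e' f' : B p e' = 0 -> B r e' = 0 -> B p f' = 0 -> B r f' = 0 ->
    forall v w, v \in (<[p]> + <[r]>)%VS -> w \in (<[e']> + <[f']>)%VS -> B v w = 0.
  move=> pe' re' pf' rf' v w /mem_add2 [a [b ->]] /mem_add2 [a' [b' ->]].
  by rewrite !quadE pe' re' pf' rf'; ring.
have PM := PMframe e f pe re pf rf.
have MPi w : w \in (<[e]> + <[f]>)%VS -> w \in Pi.
  by move=> /mem_add2 [a [b ->]]; rewrite rpredD ?rpredZ.
have PPi v : v \in (<[p]> + <[r]>)%VS -> v \in Pi.
  by move=> /mem_add2 [a [b ->]]; rewrite rpredD ?rpredZ.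
(* l + w is orthogonal to the image of [L], so its preimage is orthogonal to [L] and lies in Pi. *)
have preim l w : l \in L -> w \in (<[e]> + <[f]>)%VS -> exists2 x, x \in Pi & G x = l + w.
  move=> lL wM; have [x Gx] := G_surj (l + w); exists x => //.
  apply: (es_memPi es) => l' l'L; apply/eqP; rewrite -GB0 Gx.
  have GP := GL_P _ l'L; rewrite polarDl // (polarC Q l) (es_perp es) ?PPi // add0r.
  by rewrite polarC PM.
have o'G x : o' (G x) <-> ovoid_pred O1 x.
  by split=> [[y oy /G_inj ->]|ox]; last by exists x.
have zero0 : ~ (0 : 'rV[F]_6) != 0 by rewrite eqxx.
have zeroE : (0 : 'rV[F]_6) = 0 by [].
(* One singular vector decomposed twice: as (v + w) + l along Pi and [L], and as the image of x1 +
   l1 with G x1 = l + w and G l1 = v. [hyperovalP] applies to both. *)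
have key l v w : l \in L -> v \in (<[p]> + <[r]>)%VS -> w \in (<[e]> + <[f]>)%VS ->
    (l + (v + w)) != 0 -> Q (l + (v + w)) = 0 ->
    (l != 0 /\ ovoid_pred O2 (v + w) \/ l = 0 /\ ~ ovoid_pred O2 (v + w)) <->
    (v != 0 /\ o' (l + w) \/ v = 0 /\ ~ o' (l + w)).
  move=> lL vP wM z0 Qz; have [x1 x1Pi Gx1] := preim l w lL wM.
  have [l1 l1L vE] := memP v vP.
  have zE : G (x1 + l1) = l + (v + w) by rewrite GD Gx1 -vE; vring.
  have xl0 : x1 + l1 != 0 by rewrite -G0 zE.
  have Qxl : Q (x1 + l1) = 0 by apply/eqP; rewrite -GQ0 zE Qz.
  have := qs_image GH xl0 Qxl; have := hyperovalP char2 es O1Pi x1Pi l1L xl0 Qxl.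
  have vwPi : v + w \in Pi by apply: rpredD; [exact: PPi | exact: MPi].
  rewrite zE; rewrite (addrC l) in z0 Qz *.
  have := hyperovalP char2 es O2Pi vwPi lL z0 Qz.
  have l1v : (l1 != 0) = (v != 0) by rewrite vE G0.
  have l1v0 : l1 = 0 <-> v = 0.
    by split=> /eqP; [rewrite -[l1 == 0]negbK l1v negbK | rewrite -[v == 0]negbK -l1v negbK] => /eqP.
  have := o'G x1; rewrite Gx1 l1v; tauto.
have both l v w : l \in L -> l != 0 -> v \in (<[p]> + <[r]>)%VS -> v != 0 ->
    w \in (<[e]> + <[f]>)%VS -> Q (l + (v + w)) = 0 -> ovoid_pred O2 (v + w) <-> o' (l + w).
  move=> lL l0 vP v0 wM Qz; have vwPi : v + w \in Pi by apply: rpredD; [exact: PPi | exact: MPi].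
  have z0 : l + (v + w) != 0.
    apply: contraNneq l0 => /eqP; rewrite addr_eq0 => /eqP lE.
    by apply/eqP/(es_disjoint es) => //; rewrite lE rpredN.
  have := key l v w lL vP wM z0 Qz.
  move/eqP: (l0) => nl0; move/eqP: (v0) => nv0; tauto.
have first v w : v \in (<[p]> + <[r]>)%VS -> v != 0 -> w \in (<[e]> + <[f]>)%VS ->
    Q (v + w) = 0 -> ~ ovoid_pred O2 (v + w) <-> o' w.
  move=> vP v0 wM Qz; have z0 : 0 + (v + w) != 0.
    rewrite add0r; apply: contraNneq v0 => H; apply/eqP/P_aniso => //.
    have wE : w = - v by apply/eqP; rewrite -addr_eq0 addrC H.
    have p0 := PM _ _ pP wM; have r0 := PM _ _ rP wM.
    have /mem_add2 [a [b vE]] := vP.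
    move: p0 r0; rewrite wE -scaleN1r !(polarZr Q_quad) vE !quadE pr rp !(mulr0, addr0, add0r, mulr1).
    by move=> /eqP + /eqP; rewrite !mulN1r !oppr_eq0 => /eqP -> /eqP ->; rewrite !expr0n !mul0r !addr0.
  have Qz0 : Q (0 + (v + w)) = 0 by rewrite add0r.
  have := key 0 v w (mem0v L) vP wM z0 Qz0; rewrite add0r.
  move/eqP: (v0) => nv0; tauto.
have second l w : l \in L -> l != 0 -> w \in (<[e]> + <[f]>)%VS ->
    Q (l + w) = 0 -> ovoid_pred O2 w <-> ~ o' (l + w).
  move=> lL l0 wM Qz; have z0 : l + (0 + w) != 0.
    rewrite add0r; apply: contraNneq l0 => /eqP; rewrite addr_eq0 => /eqP lE.
    by apply/eqP/(es_disjoint es) => //; rewrite lE rpredN MPi.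
  have Qz0 : Q (l + (0 + w)) = 0 by rewrite add0r.
  have := key l 0 w lL (mem0v _) wM z0 Qz0; rewrite add0r.
  move/eqP: (l0) => nl0; tauto.
split; last first.
  exact: (inside_conic char2 es ov2 image_no3 P_aniso ePi fPi ef pe re pf rf Qe Qf split first F3).
move=> F4; have [oe|oe] := pselect (ovoid_pred O2 e).
  have [of_|of_] := pselect (ovoid_pred O2 f).
    exact: (not_both char2 es ov2 O2_nonsingular image_uniq P_aniso ePi fPi ef
      pe re pf rf Qe Qf split first second oe of_).
  have feM w : w \in (<[f]> + <[e]>)%VS -> w \in (<[e]> + <[f]>)%VS by rewrite addvC.
  apply: (inside_large char2 es ov2 image_no3 pPi rPi pr P_aniso fPi ePi fe
    pf rf pe re Qf Qe _ _ F4 of_) => [l v w lL l0 vP v0 /feM|v w vP v0 /feM].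
    exact: both.
  exact: first.
exact: (inside_large char2 es ov2 image_no3 pPi rPi pr P_aniso ePi fPi ef
  pe re pf rf Qe Qf both first F4 oe).
Qed.

Lemma similarity_dichotomy : (3 < #|F|)%N -> (forall l, l \in L -> G l \in L) \/
  ((4 < #|F|)%N -> False) /\ exists2 a, a \in Pi & Q a != 0 /\
  forall y, y \in Pi -> y != 0 -> Q y = 0 -> B a y = 0 -> ovoid_pred O2 y.
Proof.
move=> F3; have [|GL] := pselect (forall l, l \in L -> G l \in L); first by left.
right; have [[l [a [m [lL Gl [aPi a0] [mL m0]]]]]|nomix] := pselect (exists l a m,
    [/\ l \in L, G l = a + m, a \in Pi /\ a != 0 & m \in L /\ m != 0]).
  have Qam : Q a + Q m != 0.
    rewrite -(quad_es es aPi mL) -Gl GQ0; apply: contra_neq m0 => /(es_aniso es lL) l0.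
    have Ga0 : a + m = 0 + 0 by rewrite -Gl l0 (semi0 G_semi) addr0.
    by have [_] := es_uniq es aPi mL (mem0v _) (mem0v _) Ga0.
  have refl x k t := @mixed_image l a m x k t lL Gl aPi mL.
  split=> [F4|].
    exact: (mixed_large char2 es ov2 O2_nonsingular aPi a0 mL m0 Qam refl F4).
  exists a => //.
  exact: (mixed_conic char2 es ov2 O2_nonsingular aPi a0 mL m0 Qam refl (ltnW F3)).
apply: inside_dichotomy => // l lL.
(* Now every image lies in Pi or in [L]; as a space is not the union of two proper subspaces and
   some image is off [L], all lie in Pi. *)
have [l1 l1L Gl1] : exists2 l1, l1 \in L & G l1 \notin L.
  apply: contrapT => H; apply: GL => l1 l1L; apply: contrapT => /negP Gl1.
  by apply: H; exists l1.
have pure k : k \in L -> G k \notin L -> G k \in Pi.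
  move=> kL Gk; have [a [m [aPi mL GkE]]] := es_decomp es (G k).
  have [m0|m0] := eqVneq m 0; first by rewrite GkE m0 addr0.
  case: nomix; exists k, a, m; split=> //; split=> //.
  by apply: contraNneq Gk => a0; rewrite GkE a0 add0r.
have [GlL|GlL] := boolP (G l \in L); last exact: pure.
have GllL : G (l + l1) \notin L.
  by rewrite GD; apply: contra Gl1 => H; rewrite -(addKr (G l) (G l1)) rpredD // rpredN.
have := pure _ (rpredD lL l1L) GllL; rewrite GD => H.
by rewrite -(addrK (G l1) (G l)) rpredB // pure.
Qed.

(** [G] preserves Pi as the orthogonal of [L]. For each [x] in Pi some [l] in [L] has Q l = Q x, and
    the singular vector x + l transfers membership of [x] through [hyperovalP], whether or not l =
    0. *)
Lemma similarity_restriction : (forall l, l \in L -> G l \in L) ->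
  exists f : {vspace 'rV[F]_6} -> {vspace 'rV[F]_6},
    [/\ collineation Pi f, f @` section_quadric Q Pi = section_quadric Q Pi
      & f @` O1 = O2].
Proof.
move=> GL.
have GL_semi : semilinear L s G.
  by split=> // v _ /eqP; rewrite G0 => /eqP.
have GPi x : x \in Pi -> G x \in Pi.
  move=> xPi; apply: (es_memPi es) => l lL; have [l' l'L <-] := semilinear_surj GL_semi lL.
  by rewrite GB (es_perp es) // (aut0 s_aut) mulr0.
have GPi_semi : semilinear Pi s G.
  by split=> // v _ /eqP; rewrite G0 => /eqP.
apply: (semilinear_section_isomorphism char2 es O1Pi O2Pi GPi_semi) => x xPi.
  by split=> H; apply/eqP; [rewrite -GQ0 H | rewrite GQ0 H].
have [->|x0] := eqVneq x 0.
  by rewrite (semi0 G_semi); split=> -[_ /eqP].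
have [k kL k0] := es_nonempty es.
have [l lL Ql] := es_value char2 es (Q x) kL k0.
have Gl0 : (G l == 0) = (l == 0) := G0 l.
have xl0 : x + l != 0.
  apply: contraNneq x0 => H; have [-> //] := es_uniq es xPi lL (mem0v _) (mem0v _) (etrans H (esym (addr0 0))).
have Qxl : Q (x + l) = 0 by apply/eqP; rewrite (quad_es_eq0 char2 es) // Ql.
have Gxl0 : G x + G l != 0 by rewrite -GD G0.
have QGxl : Q (G x + G l) = 0 by apply/eqP; rewrite -GD GQ0 Qxl.
have := qs_image GH xl0 Qxl; rewrite GD.
have := hyperovalP char2 es O1Pi xPi lL xl0 Qxl.
have := hyperovalP char2 es O2Pi (GPi x xPi) (GL l lL) Gxl0 QGxl.
have Gl0P : G l = 0 <-> l = 0 by split=> H; apply/eqP; [rewrite -Gl0 H | rewrite Gl0 H].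
rewrite Gl0; have [l0|l0] := pselect (l = 0).
  have : ~ l != 0 by rewrite l0 eqxx.
  have := pselect (ovoid_pred O1 x); have := pselect (ovoid_pred O2 (G x)); tauto.
have : l != 0 by apply/eqP.
tauto.
Qed.

End OneSimilarity.

Lemma ovoid_nonsingular O : O `<=` points Pi -> ovoid_vectors Q Pi (ovoid_pred O) ->
  O <> section_quadric Q Pi -> exists2 x, ovoid_pred O x & Q x != 0.
Proof.
move=> OPi ov O_neq; apply: contrapT => H; apply: O_neq.
have oQ x : ovoid_pred O x -> Q x = 0.
  by move=> ox; apply: contrapT => /eqP Qx; apply: H; exists x.
rewrite eqEsubset; split=> p.
  move=> Op; have [x [xPi x0 pE]] := pointsP (OPi _ Op); rewrite pE.
  by apply/(section_quadricP es) => //; split=> //; apply: oQ; split; rewrite -?pE.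
move=> Sp; have [x [xPi x0 pE]] := pointsP Sp.1; move: Sp; rewrite pE.
move=> /(section_quadricP es x0) [_ Qx].
by have [] := ov_all_singular char2 es ov oQ xPi x0 Qx.
Qed.

Lemma quadric_isomorphic_section O1 O2 : ~~ odd #|F| ->
  O1 `<=` points Pi -> O2 `<=` points Pi ->
  ovoid_vectors Q Pi (ovoid_pred O1) -> ovoid_vectors Q Pi (ovoid_pred O2) ->
  O1 <> section_quadric Q Pi -> O2 <> section_quadric Q Pi ->
  quadric_isomorphic Q (hyperoval_of Q Pi O1) (hyperoval_of Q Pi O2) ->
  exists f : {vspace 'rV[F]_6} -> {vspace 'rV[F]_6},
    [/\ collineation Pi f, f @` section_quadric Q Pi = section_quadric Q Pi
      & f @` O1 = O2].
Proof.
move=> q_even O1Pi O2Pi ov1 ov2 /(ovoid_nonsingular O1Pi ov1) ns1.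
move=> /(ovoid_nonsingular O2Pi ov2) ns2 /isomorphism_similarity [s [c [G GH]]].
have F1 : (1 < #|F|)%N := finNzRing_gt1 F.
have [F2|F2] := eqVneq #|F| 2%N.
  have [a aPi [a0 Qa O1a]] := card2_contained char2 es ov1 ns1 F2.
  have [b bPi [b0 Qb O2b]] := card2_contained char2 es ov2 ns2 F2.
  apply: (contained_isomorphism char2 es O1Pi O2Pi ov1 ov2 aPi bPi _ _ O1a O2b).
    by rewrite Qa Qb.
  have [ab|ab] := eqVneq (B a b) 0; [right; left|by left].
  have /vlineP [k bE] := es_ell es aPi bPi a0 Qa Qb ab.
  have k0 : k != 0 by apply: contraNneq b0 => k0; rewrite bE k0 scale0r.
  by rewrite bE (card2_ne0 char2 F2 k0) scale1r.
have F3 : (3 < #|F|)%N by move: F1 F2 q_even; case: #|F| => [|[|[|[|]]]].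
have [GL|[F4 [b bPi [Qb conic_b]]]] := similarity_dichotomy O1Pi O2Pi GH ov1 ov2 ns2 F3.
  exact: (similarity_restriction O1Pi O2Pi GH GL).
have [t [d [K [KH [GK KG]]]]] := similarity_inverse GH.
(* The inverse similarity supplies the conic in the first ovoid; if it preserves [L], so does
   [G]. *)
have [KL|[_ [a aPi [Qa conic_a]]]] := similarity_dichotomy O2Pi O1Pi KH ov2 ov1 ns1 F3.
  apply: (similarity_restriction O1Pi O2Pi GH) => l lL.
  have KL_semi : semilinear L t K.
    have K_semi := qs_semi KH; split=> //; first exact: semi_aut K_semi.
    - by move=> u v _ _; rewrite (semiD K_semi) ?memvf.
    - by move=> k v _; rewrite (semiZ K_semi) ?memvf.
    by move=> v _; apply: (semi_inj K_semi); rewrite memvf.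
  by have [l' l'L <-] := semilinear_surj KL_semi lL; rewrite KG.
have card4 : #|F| = 4%N by apply/eqP; rewrite eqn_leq F3 andbT leqNgt; apply/negP.
have normal (z : 'rV[F]_6) o : z \in Pi -> Q z != 0 ->
    (forall y, y \in Pi -> y != 0 -> Q y = 0 -> B z y = 0 -> o y) ->
    exists2 z', z' \in Pi & Q z' = 1 /\
      forall y, y \in Pi -> y != 0 -> Q y = 0 -> B z' y = 0 -> o y.
  move=> zPi Qz zo; have [k kE] := sqrt2 char2 (Q z)^-1.
  exists (k *: z); first by rewrite rpredZ.
  split=> [|y yPi y0 Qy]; first by rewrite quadZ // kE mulVf.
  rewrite polarZl // => /eqP; rewrite mulf_eq0 -(sqrf_eq0 k) kE invr_eq0 (negPf Qz).
  by move=> /eqP; exact: zo.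
have [a' a'Pi [Qa' O1a]] := normal _ _ aPi Qa conic_a.
have [b' b'Pi [Qb' O2b]] := normal _ _ bPi Qb conic_b.
apply: (contained_isomorphism char2 es O1Pi O2Pi ov1 ov2 a'Pi b'Pi).
- by rewrite Qa' Qb'.
- by right; right; rewrite Qa' oner_neq0 card4.
- exact: (card4_contained char2 es ov1 ns1 card4 a'Pi Qa' O1a).
exact: (card4_contained char2 es ov2 ns2 card4 b'Pi Qb' O2b).
Qed.

End Isomorphisms.

Theorem theorem4p31 (F : finFieldType) (Q : 'rV[F]_6 -> F)
    (Pi : {vspace 'rV[F]_6}) (O1 O2 : set {vspace 'rV[F]_6})
    (q_even : ~~ odd #|F|)
    (Q_quadratic : quadratic_form Q)
    (Q_nondegenerate : nondegenerate_on Q fullv)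
    (Q_plus : plus_type Q fullv)
    (dim_Pi : \dim Pi = 4%N)
    (Pi_nondegenerate : nondegenerate_on Q Pi)
    (Pi_minus : minus_type Q Pi)
    (O1_ovoid : W_ovoid Q Pi O1) (O1_neq : O1 <> section_quadric Q Pi)
    (O2_ovoid : W_ovoid Q Pi O2) (O2_neq : O2 <> section_quadric Q Pi) :
  quadric_isomorphic Q (hyperoval_of Q Pi O1) (hyperoval_of Q Pi O2) <->
  exists f : {vspace 'rV[F]_6} -> {vspace 'rV[F]_6},
    [/\ collineation Pi f,
        f @` section_quadric Q Pi = section_quadric Q Pi
      & f @` O1 = O2].
Proof.
have char2 := even_card_char2 q_even.
have [L es] := elliptic_section_exists char2 Q_quadratic Q_nondegenerate Q_plus
  dim_Pi Pi_nondegenerate Pi_minus.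
have [O1Pi O2Pi] := (O1_ovoid.1, O2_ovoid.1).
have ov1 := W_ovoid_vectors char2 es O1_ovoid.
have ov2 := W_ovoid_vectors char2 es O2_ovoid.
split; first exact: (quadric_isomorphic_section char2 es q_even O1Pi O2Pi ov1 ov2 O1_neq O2_neq).
move=> [f [f_coll fS fO]].
exact: (section_isomorphism_extends char2 es dim_Pi O1Pi O2Pi f_coll fS fO).
Qed.
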